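(* Let $(T_t)_{t\ge 0}$ be a $C_0$-semigroup on a separable complex Banach space $X$ and let $A$ be its infinitesimal generator. Assume that there exist an open connected subset $U\subset \mathbb{C}$ and weakly holomorphic functions $f_j: U\rightarrow X$, $j\in J$, such that 1. $U\cap i\mathbb{R}\neq \emptyset$, 2. $f_j(\lambda)\in \ker (\lambda I-A)$ for every $\lambda \in U$, $j\in J$, 3. for any $x^\ast\in X^\ast$, if $\langle f_j(\lambda),x^\ast\rangle=0$ for all $\lambda\in U$ and $j\in J$, then $x^\ast=0$. Then the semigroup $(T_t)_{t\geq 0}$ has the specification property for semigroups (SgSP).
   Context: A $C_0$-semigroup on a Banach space $X$ is a family $(T_t)_{t\ge 0}$ of bounded linear operators on $X$ with $T_0=\mathrm{Id}$, $T_tT_s=T_{t+s}$ for all $t,s\ge 0$, and $\lim_{t\to s}T_tx=T_sx$ for all $x\in X$, $s\ge 0$. Its generator is $Ax=\lim_{t\to0^+}\frac1t(T_tx-x)$, defined on the subspace $D(A)$ of those $x$ for which the limit exists. $X^\ast$ is the topological dual of $X$; $f:U\to X$ is weakly holomorphic if $\lambda\mapsto\langle f(\lambda),x^\ast\rangle$ is holomorphic on $U$ for every $x^\ast\in X^\ast$. SgSP: A $C_0$-semigroup $(T_t)_{t\ge 0}$ on a separable Banach space $X$ has the SgSP if there exist an increasing sequence $(K_n)_{n\in\mathbb{N}}$ of subsets of $X$ with $0\in K_1$ and $\overline{\bigcup_{n} K_n}=X$, and a $t_0>0$, such that for each $n\in\mathbb{N}$ the set $K_n$ is $T_{t_0}$-invariant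 (i.e. $T_{t_0}(K_n)\subset K_n$), and for every $\delta>0$ there is $M_{\delta,n}>t_0$ such that for any integer $s\ge 2$, any set $\{y_1,\dots,y_s\}\subset K_n$ and any real numbers $0=a_1\le b_1<a_2\le b_2<\dots<a_s\le b_s$ satisfying $a_{r+1}-b_r\ge M_{\delta,n}$ for $r=1,\dots,s-1$, there is a point $x\in K_n$ such that - $\|T_t(x)-T_t(y_r)\|<\delta$ for each $t\in[a_r,b_r]$, $r=1,\dots,s$; - $T_{t'}(x)=x$, where $t'$ is the (unique) element of $[M_{\delta,n}+b_s,\,M_{\delta,n}+b_s+t_0)\cap \mathbb{N}\cdot t_0$, with $\mathbb{N}\cdot t_0=\{kt_0 : k\in\mathbb{N}\}$. *)

(* Defs.v *)
(* Stdlib's reals with Coquelicot.  A complex Banach space is a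
   [CompleteNormedModule C_AbsRing], whose [norm] is real-valued. *)
From Stdlib Require Import Reals.
From Coquelicot Require Import Coquelicot.
Set Implicit Arguments.
Open Scope R_scope.

Definition norm_dense (X : NormedModule C_AbsRing) (D : X -> Prop) : Prop :=
  forall (x : X) (eps : R), 0 < eps -> exists d : X, D d /\ norm (minus x d) < eps.

(* A sequence suffices for a countable dense subset, a vector space being
   inhabited. *)
Definition separable (X : NormedModule C_AbsRing) : Prop :=
  exists u : nat -> X, norm_dense X (fun x => exists n, x = u n).

(* [T t] is the operator T_t for t >= 0; the values at t < 0 are irrelevant and
   no definition below depends on them.  [is_linear] includes boundedness. *)
Record C0_semigroup (X : NormedModule C_AbsRing) (T : R -> X -> X) : Prop := {
  C0_bounded_linear : forall t : R, 0 <= t -> is_linear (T t);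
  C0_zero : forall x : X, T 0 x = x;
  C0_add : forall (t s : R) (x : X), 0 <= t -> 0 <= s -> T t (T s x) = T (t + s) x;
  C0_continuous : forall (x : X) (s : R), 0 <= s ->
    filterlim (fun t => T t x) (within (fun t => 0 <= t) (locally s))
      (locally (T s x))
}.

(* The generator A is unbounded in general and is given by its graph:
   [generator T x y] says that x is in D(A) and A x = y. *)
Definition generator (X : NormedModule C_AbsRing) (T : R -> X -> X) (x y : X) : Prop :=
  filterlim (fun t : R => scal (RtoC (/ t)) (minus (T t x) x))
    (at_right 0) (locally y).

Definition ker_shift (X : NormedModule C_AbsRing) (T : R -> X -> X) (lambda : C)
    (x : X) : Prop :=
  exists y : X, generator X T x y /\ minus (scal lambda x) y = zero.

Definition in_dual (X : NormedModule C_AbsRing) (phi : X -> C) : Prop :=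
  @is_linear C_AbsRing X C_NormedModule phi.

(* Functions on U are total functions on C whose values off U are irrelevant;
   [ex_derive] over [C_AbsRing] is complex differentiability. *)
Definition weakly_holomorphic (X : NormedModule C_AbsRing) (U : C -> Prop)
    (f : C -> X) : Prop :=
  forall phi : X -> C, in_dual X phi ->
  forall z : C, U z ->
    @ex_derive C_AbsRing C_NormedModule (fun w => phi (f w)) z.

(* Coquelicot's [is_connected] is only about subsets of R. *)
Definition connected (S : UniformSpace) (U : S -> Prop) : Prop :=
  forall V W : S -> Prop, open V -> open W ->
    (forall z, U z -> V z \/ W z) ->
    (exists z, U z /\ V z) -> (exists z, U z /\ W z) ->
    exists z, U z /\ V z /\ W z.

(* Specification property for semigroups.  Both the sets K n and the points
   y r, a r, b r are indexed from 1, so entries of index 0 play no role; the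
   points y 1, ..., y s need not be distinct.  The number k * t0 is the unique
   multiple of t0 in a half-open interval of length t0. *)
Definition SgSP (X : NormedModule C_AbsRing) (T : R -> X -> X) : Prop :=
  exists (K : nat -> X -> Prop) (t0 : R),
    0 < t0 /\
    (forall n : nat, (1 <= n)%nat -> forall x : X, K n x -> K (S n) x) /\
    K 1%nat zero /\
    norm_dense X (fun x => exists n : nat, (1 <= n)%nat /\ K n x) /\
    forall n : nat, (1 <= n)%nat ->
      (forall x : X, K n x -> K n (T t0 x)) /\
      forall delta : R, 0 < delta ->
      exists M : R, t0 < M /\
      forall (s : nat) (y : nat -> X) (a b : nat -> R),
        (2 <= s)%nat ->
        (forall r : nat, (1 <= r <= s)%nat -> K n (y r)) ->
        a 1%nat = 0 ->
        (forall r : nat, (1 <= r <= s)%nat -> a r <= b r) ->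
        (forall r : nat, (1 <= r < s)%nat -> b r < a (S r)) ->
        (forall r : nat, (1 <= r < s)%nat -> M <= a (S r) - b r) ->
        exists x : X, K n x /\
          (forall r : nat, (1 <= r <= s)%nat ->
            forall t : R, a r <= t <= b r ->
            norm (minus (T t x) (T t (y r))) < delta) /\
          (exists k : nat,
            M + b s <= INR k * t0 < M + b s + t0 /\ T (INR k * t0) x = x).

(* Main.v *)
(* A homoclinic orbit is a two-sided orbit (eta t) of the semigroup, t real, with
   |eta t| <= m / (1 + t^2).  Given a sequence (eta_k), k in Z, of such orbits
   with a common m, the series of the eta_k(-k) converges and the semigroup at
   time 1 acts on its sums as the shift of the sequence; the set of all these sums
   is taken for K_m.  Shadowing finitely many points over well separated time
   intervals amounts to copying blocks of their sequences, filling in with zeros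
   and repeating periodically; the decay bounds the error uniformly.

   Homoclinic orbits are obtained by integrating e^(tz) f_j(z) against a polynomial
   weight vanishing at the ends of a segment of the imaginary axis; Goursat's
   theorem moves the path into either half-plane, whence the decay.  A functional
   that kills all the eta(0) vanishes on f_j along the imaginary axis, hence on U
   by the identity theorem, so it is zero, and the eta(0) are dense by
   Hahn-Banach. *)

(* The operators need not be invertible, so a point has no backward orbit in general. Two-sided
   orbits supply one, and with it a coding by sequences over all integers, where any finite pattern
   can be repeated periodically. The rate 1 / (1 + t^2) sums over unit translates, and it costs a
   double zero of the weight at each end: close to an end the moved path has small real part, so
   that the exponential alone would not decay uniformly there.

   Holomorphy is available only after pairing with a functional, and it is always used in that form.
   The strong information needed is norm continuity of the f_j, drawn from uniform boundedness of
   difference quotients; it makes the vector integrals exist and bounds f_j near the axis.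

   Complex analysis rests on Goursat's theorem for triangles, without power series: zeros spread
   because a function that vanishes on one side of a square vanishes at its center.

   Separability lets Hahn-Banach run through a dense sequence of directions, so the functional is
   the limit of a decreasing sequence of sublinear ones. *)
Require Import Defs.
From Stdlib Require Import Reals Lra Lia ZArith Classical IndefiniteDescription Ring.
From Coquelicot Require Import Coquelicot.
Open Scope R_scope.

(** * Computing in complex vector spaces *)

(* Identities in a complex vector space are checked by [ring] in its
   square-zero extension C + X, where X embeds as an ideal. *)
Section SquareZero.
Context {X : NormedModule C_AbsRing}.

Definition sq0 : Type := (C * X)%type.
Definition sq0_add (p q : sq0) : sq0 := (Cplus (fst p) (fst q), plus (snd p) (snd q)).
Definition sq0_mul (p q : sq0) : sq0 :=
  (Cmult (fst p) (fst q), plus (scal (fst p) (snd q)) (scal (fst q) (snd p))).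
Definition sq0_opp (p : sq0) : sq0 := (Copp (fst p), opp (snd p)).
Definition sq0_C (c : C) : sq0 := (c, zero).
Definition sq0_X (x : X) : sq0 := (RtoC 0, x).

Lemma sq0_ring : ring_theory (sq0_C 0) (sq0_C 1) sq0_add sq0_mul
  (fun p q => sq0_add p (sq0_opp q)) sq0_opp eq.
Proof.
  assert (hs : forall (a b : C) (x : X), scal a (scal b x) = scal (Cmult a b) x)
    by (intros; exact (@scal_assoc C_Ring X a b x)).
  assert (hd : forall (a b : C) (x : X),
    plus (scal a x) (scal b x) = scal (Cplus a b) x)
    by (intros; symmetry; exact (@scal_distr_r C_Ring X a b x)).
  assert (hz : forall a : C, scal a (zero : X) = zero)
    by (intros; exact (@scal_zero_r C_Ring X a)).
  assert (hl : forall (a : C) (x y : X), scal a (plus x y) = plus (scal a x) (scal a y))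
    by (intros; exact (@scal_distr_l C_Ring X a x y)).
  assert (h1 : forall x : X, scal (RtoC 1) x = x)
    by (intros; exact (@scal_one C_Ring X x)).
  assert (h4 : forall a b c d : X,
    plus (plus a b) (plus c d) = plus (plus a c) (plus b d)).
  { intros; rewrite <- !plus_assoc; f_equal.
    rewrite plus_comm, <- plus_assoc; f_equal; apply plus_comm. }
  split; intros; unfold sq0_add, sq0_mul, sq0_opp, sq0_C; simpl;
    repeat match goal with p : sq0 |- _ => destruct p as [? ?]; simpl end;
    try (apply f_equal2; [ring |]).
  - apply plus_zero_l.
  - apply plus_comm.
  - apply plus_assoc.
  - rewrite h1, hz. apply plus_zero_r.
  - apply plus_comm.
  - rewrite !hl, !hs, plus_assoc.
    f_equal; [f_equal |]; f_equal; ring.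
  - rewrite hl, <- hd. apply h4.
  - reflexivity.
  - exact (@plus_opp_r X s).
Qed.

Lemma sq0_X_eq (x y : X) (p q : sq0) : sq0_X x = p -> sq0_X y = q -> p = q -> x = y.
Proof. intros <- <- H; injection H; auto. Qed.

Lemma sq0_X_plus (x y : X) p q :
  sq0_X x = p -> sq0_X y = q -> sq0_X (plus x y) = sq0_add p q.
Proof. intros <- <-; unfold sq0_X, sq0_add; simpl; f_equal; ring. Qed.

Lemma sq0_X_opp (x : X) p : sq0_X x = p -> sq0_X (opp x) = sq0_opp p.
Proof. intros <-; unfold sq0_X, sq0_opp; simpl; f_equal; ring. Qed.

Lemma sq0_X_minus (x y : X) p q :
  sq0_X x = p -> sq0_X y = q -> sq0_X (minus x y) = sq0_add p (sq0_opp q).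
Proof. intros; apply sq0_X_plus; [| apply sq0_X_opp]; assumption. Qed.

Lemma sq0_X_zero : sq0_X zero = sq0_C 0.
Proof. reflexivity. Qed.

Lemma sq0_X_scal (c : C) (x : X) p q :
  sq0_C c = p -> sq0_X x = q -> sq0_X (scal c x) = sq0_mul p q.
Proof.
  intros <- <-; unfold sq0_X, sq0_mul, sq0_C; simpl; f_equal; [ring |].
  rewrite (@scal_zero_r C_Ring X), plus_zero_r; reflexivity.
Qed.

Lemma sq0_C_plus (a b : C) p q :
  sq0_C a = p -> sq0_C b = q -> sq0_C (a + b)%C = sq0_add p q.
Proof.
  intros <- <-; unfold sq0_C, sq0_add; simpl; f_equal; symmetry; apply plus_zero_r.
Qed.

Lemma sq0_C_opp (a : C) p : sq0_C a = p -> sq0_C (- a)%C = sq0_opp p.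
Proof.
  intros <-; unfold sq0_C, sq0_opp; simpl; f_equal; symmetry; exact (@opp_zero X).
Qed.

Lemma sq0_C_minus (a b : C) p q :
  sq0_C a = p -> sq0_C b = q -> sq0_C (a - b)%C = sq0_add p (sq0_opp q).
Proof. intros; apply sq0_C_plus; [| apply sq0_C_opp]; assumption. Qed.

Lemma sq0_C_mult (a b : C) p q :
  sq0_C a = p -> sq0_C b = q -> sq0_C (a * b)%C = sq0_mul p q.
Proof.
  intros <- <-; unfold sq0_C, sq0_mul; simpl; f_equal.
  rewrite !(@scal_zero_r C_Ring X); symmetry; apply plus_zero_r.
Qed.

Lemma sq0_C_eq (a b : C) p : a = b -> sq0_C b = p -> sq0_C a = p.
Proof. intros ->; auto. Qed.

End SquareZero.

(* Fixing the canonical structures keeps the operations syntactically equal,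
   which [rewrite] and [lra] need. *)
Notation vadd := (@plus (NormedModule.AbelianMonoid C_AbsRing _)) (only parsing).
Notation vsub := (@minus (NormedModule.AbelianGroup C_AbsRing _)) (only parsing).
Notation vopp := (@opp (NormedModule.AbelianGroup C_AbsRing _)) (only parsing).
Notation vscal := (@scal C_Ring (NormedModule.ModuleSpace C_AbsRing _)) (only parsing).
Notation vzero := (@zero (NormedModule.AbelianMonoid C_AbsRing _)) (only parsing).

(** The image in the extension is an existential variable, filled in while the term is traversed.
    Real operations under [RtoC] are opened as well, so that [ring] sees real and complex
    coefficients in one algebra. *)
Ltac quote_C :=
  lazymatch goal with
  | |- sq0_C ?c = _ =>
    lazymatch c with
    | Cplus _ _ => refine (sq0_C_plus _ _ _ _ _ _); quote_C
    | Cminus _ _ => refine (sq0_C_minus _ _ _ _ _ _); quote_C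
    | Cmult _ _ => refine (sq0_C_mult _ _ _ _ _ _); quote_C
    | Copp _ => refine (sq0_C_opp _ _ _); quote_C
    | RtoC (_ + _) => refine (sq0_C_eq _ _ _ (RtoC_plus _ _) _); quote_C
    | RtoC (_ - _) => refine (sq0_C_eq _ _ _ (RtoC_minus _ _) _); quote_C
    | RtoC (_ * _) => refine (sq0_C_eq _ _ _ (RtoC_mult _ _) _); quote_C
    | RtoC (- _) => refine (sq0_C_eq _ _ _ (RtoC_opp _) _); quote_C
    | _ => reflexivity
    end
  end.

Ltac quote_X :=
  lazymatch goal with
  | |- sq0_X ?t = _ =>
    lazymatch t with
    | plus _ _ => refine (sq0_X_plus _ _ _ _ _ _); quote_X
    | minus _ _ => refine (sq0_X_minus _ _ _ _ _ _); quote_X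
    | opp _ => refine (sq0_X_opp _ _ _); quote_X
    | scal _ _ => refine (sq0_X_scal _ _ _ _ _ _); [quote_C | quote_X]
    | zero => exact sq0_X_zero
    | _ => reflexivity
    end
  end.

Ltac vec := intros; eapply sq0_X_eq; [quote_X | quote_X | ring].

(** * Hahn-Banach and uniform boundedness in separable spaces *)

Section Norm.
Context {X : NormedModule C_AbsRing}.
Add Ring sq0_ring_norm : (@sq0_ring X).

Lemma norm_scal_C (c : C) (x : X) : norm (vscal c x) <= Cmod c * norm x.
Proof. exact (@norm_scal C_AbsRing X c x). Qed.

Lemma norm_scal_pos (t : R) (x : X) : 0 <= t -> norm (vscal (RtoC t) x) <= t * norm x.
Proof.
  intros Ht. eapply Rle_trans; [apply norm_scal_C |].
  rewrite Cmod_R, Rabs_pos_eq by assumption. lra.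
Qed.

Lemma norm_minus_sym (x y : X) : norm (vsub x y) = norm (vsub y x).
Proof. rewrite <- (norm_opp (vsub y x)). f_equal. vec. Qed.

Lemma norm_minus_triangle (x y z : X) :
  norm (vsub x z) <= norm (vsub x y) + norm (vsub y z).
Proof.
  replace (vsub x z) with (vadd (vsub x y) (vsub y z)) by vec.
  apply (@norm_triangle C_AbsRing X).
Qed.

Lemma norm_minus_le (x y : X) : norm (vsub x y) <= norm x + norm y.
Proof.
  rewrite <- (norm_opp y). exact (@norm_triangle C_AbsRing X x (vopp y)).
Qed.

Lemma norm_le_minus (x y : X) : norm x <= norm y + norm (vsub x y).
Proof.
  replace x with (vadd y (vsub x y)) at 1 by vec.
  exact (@norm_triangle C_AbsRing X _ _).
Qed.

Lemma minus_norm_eq_0 (x y : X) : norm (vsub x y) <= 0 -> x = y.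
Proof.
  intros H. assert (H0 : vsub x y = zero).
  { apply (@norm_eq_zero C_AbsRing X). apply Rle_antisym; [exact H |].
    apply (@norm_ge_0 C_AbsRing X). }
  replace x with (vadd y (vsub x y)) by vec. rewrite H0. vec.
Qed.

End Norm.

(** [Glb_Rbar] takes values in the extended reals; the lower bound [m] and the element [v] force it
    to be finite, so that [real] returns the true infimum and not a default value. *)
Lemma Glb_lower (E : R -> Prop) (m v : R) :
  (forall w, E w -> m <= w) -> E v -> real (Glb_Rbar E) <= v.
Proof.
  intros Hm Hv. destruct (Glb_Rbar_correct E) as [Hl Hg].
  pose proof (Hl v Hv) as H1.
  pose proof (Hg (Finite m) (fun w hw => Hm w hw)) as H2.
  destruct (Glb_Rbar E); simpl in *; tauto || lra.
Qed.

Lemma Glb_greatest (E : R -> Prop) (m v : R) :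
  (forall w, E w -> m <= w) -> E v -> m <= real (Glb_Rbar E).
Proof.
  intros Hm Hv. destruct (Glb_Rbar_correct E) as [Hl Hg].
  pose proof (Hl v Hv) as H1.
  pose proof (Hg (Finite m) (fun w hw => Hm w hw)) as H2.
  destruct (Glb_Rbar E); simpl in *; tauto || lra.
Qed.

Section HahnBanach.
Context {X : NormedModule C_AbsRing}.
Add Ring sq0_ring_hb : (@sq0_ring X).

(** One inequality of positive homogeneity is enough: applied to the inverse factor it yields the
    other one, see [sublinear_scal]. *)
Definition sublinear (q : X -> R) : Prop :=
  (forall x y : X, q (vadd x y) <= q x + q y) /\
  (forall (t : R) (x : X), 0 <= t -> q (vscal (RtoC t) x) <= t * q x).

Lemma sublinear_zero (q : X -> R) : sublinear q -> q (vzero : X) = 0.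
Proof.
  intros [Ha Hs]. pose proof (Hs 0 (vzero : X) (Rle_refl 0)) as H0.
  pose proof (Ha (vzero : X) (vzero : X)) as H1.
  replace (vscal (RtoC 0) (vzero : X)) with (vzero : X) in H0 by vec.
  replace (vadd (vzero : X) zero) with (vzero : X) in H1 by vec. lra.
Qed.

Lemma sublinear_opp (q : X -> R) (x : X) : sublinear q -> 0 <= q x + q (vopp x).
Proof.
  intros Hq. pose proof (proj1 Hq x (vopp x)) as H.
  replace (vadd x (vopp x)) with (vzero : X) in H by vec.
  rewrite (sublinear_zero q Hq) in H. exact H.
Qed.

Lemma scal_scal_inv (t : R) (x : X) :
  t <> 0 -> vscal (RtoC (/ t)) (vscal (RtoC t) x) = x.
Proof.
  intros Ht.
  replace x with (vscal (RtoC 1) x) at 2 by vec.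
  replace (RtoC 1) with (RtoC (/ t) * RtoC t)%C.
  - vec.
  - rewrite <- RtoC_mult. f_equal. field. exact Ht.
Qed.

Lemma sublinear_scal (q : X -> R) (t : R) (x : X) :
  sublinear q -> 0 <= t -> q (vscal (RtoC t) x) = t * q x.
Proof.
  intros Hq Ht. apply Rle_antisym; [apply Hq; exact Ht |].
  destruct (Req_dec t 0) as [-> | Hn].
  - replace (vscal (RtoC 0) x) with (vzero : X) by vec.
    rewrite (sublinear_zero q Hq). lra.
  - assert (0 < / t) by (apply Rinv_0_lt_compat; lra).
    pose proof (proj2 Hq (/ t) (vscal (RtoC t) x) ltac:(lra)) as H1.
    rewrite scal_scal_inv in H1 by exact Hn.
    apply Rle_trans with (t * (/ t * q (vscal (RtoC t) x))).
    + apply Rmult_le_compat_l; assumption.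
    + right. field. exact Hn.
Qed.

(* The largest sublinear functional below q that is linear along the line
   through y. *)
Definition linearize (q : X -> R) (y x : X) : R :=
  real (Glb_Rbar (fun v =>
    exists t, 0 <= t /\ v = q (vadd x (vscal (RtoC t) y)) - t * q y)).

Lemma linearize_bound (q : X -> R) (y x : X) (v : R) : sublinear q ->
  (exists t, 0 <= t /\ v = q (vadd x (vscal (RtoC t) y)) - t * q y) ->
  - q (vopp x) <= v.
Proof.
  intros Hq (t & Ht & ->). rewrite <- (sublinear_scal q t y Hq Ht).
  pose proof (proj1 Hq (vadd x (vscal (RtoC t) y)) (vopp x)) as H.
  replace (vadd (vadd x (vscal (RtoC t) y)) (vopp x)) with (vscal (RtoC t) y) in H by vec.
  lra.
Qed.

Lemma linearize_le (q : X -> R) (y x : X) (t : R) : sublinear q -> 0 <= t ->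
  linearize q y x <= q (vadd x (vscal (RtoC t) y)) - t * q y.
Proof.
  intros Hq Ht. apply Glb_lower with (- q (vopp x)).
  - intros w Hw. eapply linearize_bound; eassumption.
  - exists t; auto.
Qed.

Lemma linearize_ge (q : X -> R) (y x : X) (m : R) :
  (forall t, 0 <= t -> m <= q (vadd x (vscal (RtoC t) y)) - t * q y) ->
  m <= linearize q y x.
Proof.
  intros H. apply Glb_greatest with (q (vadd x (vscal (RtoC 0) y)) - 0 * q y).
  - intros w (t & Ht & ->). auto.
  - exists 0. split; [lra | reflexivity].
Qed.

Lemma linearize_le_self (q : X -> R) (y x : X) : sublinear q -> linearize q y x <= q x.
Proof.
  intros Hq. pose proof (linearize_le q y x 0 Hq (Rle_refl 0)) as H.
  replace (vadd x (vscal (RtoC 0) y)) with x in H by vec. lra.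
Qed.

(** With [linearize_le_self] at [y] this makes the sum of the values at [y] and [- y] nonpositive.
    Every smaller functional inherits that bound, so later stages cannot destroy it. *)
Lemma linearize_opp (q : X -> R) (y : X) : sublinear q -> linearize q y (vopp y) <= - q y.
Proof.
  intros Hq. pose proof (linearize_le q y (vopp y) 1 Hq Rle_0_1) as H.
  replace (vadd (vopp y) (vscal (RtoC 1) y)) with (vzero : X) in H by vec.
  rewrite (sublinear_zero q Hq) in H. lra.
Qed.

Lemma linearize_sublinear (q : X -> R) (y : X) : sublinear q -> sublinear (linearize q y).
Proof.
  intros Hq. split.
  - intros x x'.
    (* Each [cut] isolates one infimum on the right, which is then replaced by an arbitrary member
       of its set; the two parameters add up. *)
    cut (linearize q y (vadd x x') - linearize q y x' <= linearize q y x); [lra |].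
    apply linearize_ge. intros t Ht.
    cut (linearize q y (vadd x x') - (q (vadd x (vscal (RtoC t) y)) - t * q y)
      <= linearize q y x'); [lra |].
    apply linearize_ge. intros t' Ht'.
    pose proof (linearize_le q y (vadd x x') (t + t') Hq ltac:(lra)) as H.
    pose proof (proj1 Hq (vadd x (vscal (RtoC t) y)) (vadd x' (vscal (RtoC t') y))) as H1.
    replace (vadd (vadd x (vscal (RtoC t) y)) (vadd x' (vscal (RtoC t') y)))
      with (vadd (vadd x x') (vscal (RtoC (t + t')) y)) in H1 by vec.
    lra.
  - intros s x Hs. destruct (Req_dec s 0) as [-> | Hn].
    + replace (vscal (RtoC 0) x) with (vzero : X) by vec.
      pose proof (linearize_le_self q y (vzero : X) Hq) as H.
      rewrite (sublinear_zero q Hq) in H. lra.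
    + assert (Hi : 0 < / s) by (apply Rinv_0_lt_compat; lra).
      cut (/ s * linearize q y (vscal (RtoC s) x) <= linearize q y x).
      { intros H. apply (Rmult_le_compat_l s) in H; [| exact Hs].
        rewrite <- Rmult_assoc, Rinv_r, Rmult_1_l in H by exact Hn. exact H. }
      apply linearize_ge. intros t Ht.
      pose proof (linearize_le q y (vscal (RtoC s) x) (s * t) Hq ltac:(nra)) as H.
      replace (vadd (vscal (RtoC s) x) (vscal (RtoC (s * t)) y))
        with (vscal (RtoC s) (vadd x (vscal (RtoC t) y))) in H by vec.
      rewrite (sublinear_scal q s _ Hq Hs) in H.
      apply (Rmult_le_compat_l (/ s)) in H; [| lra].
      eapply Rle_trans; [exact H |]. right. field. exact Hn.
Qed.

(** [p] is straightened along [x0] and then along every term of a dense sequence. The infimum of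
    these decreasing functionals is sublinear and odd on the dense set; domination by the norm
    extends oddness to the whole space, and an odd sublinear functional is linear. Treating [x0] at
    stage zero preserves the value [p x0]. *)
Lemma hahn_banach (Xsep : separable X) (p : X -> R) (x0 : X) :
  sublinear p -> (forall x, p x <= norm x) ->
  exists u : X -> R,
    (forall x y : X, u (vadd x y) = u x + u y) /\
    (forall (t : R) (x : X), u (vscal (RtoC t) x) = t * u x) /\
    (forall x, u x <= p x) /\ u x0 = p x0.
Proof.
  intros Hp Hpn. destruct Xsep as [e He].
  set (Q := fix Q n := match n with
    | O => linearize p x0
    | S m => linearize (Q m) (e m) end).
  assert (HQ : forall n, sublinear (Q n)).
  { induction n; simpl; apply linearize_sublinear; assumption. }
  assert (Hmono : forall n k x, Q (n + k)%nat x <= Q n x).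
  { intros n k x. induction k as [| k IH].
    - rewrite Nat.add_0_r. lra.
    - rewrite Nat.add_succ_r. simpl. eapply Rle_trans; [| exact IH].
      apply linearize_le_self, HQ. }
  assert (Hmono' : forall n m x, (n <= m)%nat -> Q m x <= Q n x).
  { intros n m x Hnm. replace m with (n + (m - n))%nat by lia. apply Hmono. }
  assert (Hlow : forall n x, - Q O (vopp x) <= Q n x).
  { intros n x. pose proof (sublinear_opp (Q n) x (HQ n)).
    pose proof (Hmono' O n (vopp x) ltac:(lia)). lra. }
  set (u := fun x => real (Glb_Rbar (fun v => exists n, v = Q n x))).
  assert (Hu : forall n x, u x <= Q n x).
  { intros n x. apply Glb_lower with (- Q O (vopp x)).
    - intros w [k ->]. apply Hlow.
    - exists n; reflexivity. }
  assert (Hug : forall x m, (forall n, m <= Q n x) -> m <= u x).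
  { intros x m H. apply Glb_greatest with (Q O x).
    - intros w [k ->]. apply H.
    - exists O; reflexivity. }
  assert (Hsub : sublinear u).
  { split.
    - intros x y. cut (u (vadd x y) - u y <= u x); [lra |].
      apply Hug; intros n. cut (u (vadd x y) - Q n x <= u y); [lra |].
      apply Hug; intros m.
      pose proof (Hu (Nat.max n m) (vadd x y)).
      pose proof (proj1 (HQ (Nat.max n m)) x y).
      pose proof (Hmono' n (Nat.max n m) x ltac:(lia)).
      pose proof (Hmono' m (Nat.max n m) y ltac:(lia)). lra.
    - intros t x Ht. destruct (Req_dec t 0) as [-> | Hn].
      + replace (vscal (RtoC 0) x) with (vzero : X) by vec.
        pose proof (Hu O (vzero : X)) as H. rewrite (sublinear_zero _ (HQ O)) in H. lra.
      + assert (Hi : 0 < / t) by (apply Rinv_0_lt_compat; lra).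
        cut (/ t * u (vscal (RtoC t) x) <= u x).
        { intros H. apply (Rmult_le_compat_l t) in H; [| exact Ht].
          rewrite <- Rmult_assoc, Rinv_r, Rmult_1_l in H by exact Hn. exact H. }
        apply Hug; intros n. pose proof (Hu n (vscal (RtoC t) x)) as H.
        rewrite (sublinear_scal _ t x (HQ n) Ht) in H.
        apply (Rmult_le_compat_l (/ t)) in H; [| lra].
        eapply Rle_trans; [exact H |]. right. field. exact Hn. }
  assert (Hle : forall x, u x <= p x).
  { intros x. eapply Rle_trans; [apply (Hu O) |]. simpl.
    apply linearize_le_self, Hp. }
  (* The point [x] differs from some [e n] by at most [eps / 2] in norm, and [u] is already odd at
     [e n]; each of the two increments costs [eps / 2]. *)
  assert (Hodd : forall x, u (vopp x) = - u x).
  { intros x. pose proof (sublinear_opp u x Hsub).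
    apply Rle_antisym; [| lra].
    apply le_epsilon. intros eps Heps.
    destruct (He x (eps / 2) ltac:(lra)) as (d & (n & ->) & Hd).
    assert (H1 : u (e n) + u (vopp (e n)) <= 0).
    { pose proof (Hu (S n) (e n)) as h1. pose proof (Hu (S n) (vopp (e n))) as h2.
      pose proof (Hmono' n (S n) (e n) ltac:(lia)) as h3.
      pose proof (linearize_opp (Q n) (e n) (HQ n)) as h4.
      change (Q (S n) (vopp (e n)) <= - Q n (e n)) in h4. lra. }
    pose proof (proj1 Hsub (e n) (vsub x (e n))) as h5.
    replace (vadd (e n) (vsub x (e n))) with x in h5 by vec.
    pose proof (proj1 Hsub (vopp (e n)) (vsub (e n) x)) as h6.
    replace (vadd (vopp (e n)) (vsub (e n) x)) with (vopp x) in h6 by vec.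
    pose proof (Hle (vsub x (e n))). pose proof (Hpn (vsub x (e n))).
    pose proof (Hle (vsub (e n) x)). pose proof (Hpn (vsub (e n) x)).
    rewrite (norm_minus_sym (e n) x) in *. lra. }
  assert (Hadd : forall x y : X, u (vadd x y) = u x + u y).
  { intros x y. apply Rle_antisym; [apply Hsub |].
    pose proof (proj1 Hsub (vopp x) (vopp y)) as H.
    replace (vadd (vopp x) (vopp y)) with (vopp (vadd x y)) in H by vec.
    rewrite !Hodd in H. lra. }
  exists u. split; [exact Hadd | split; [| split; [exact Hle |]]].
  - intros t x. destruct (Rle_dec 0 t) as [Ht | Ht].
    + apply sublinear_scal; assumption.
    + replace (vscal (RtoC t) x) with (vopp (vscal (RtoC (- t)) x)) by vec.
      rewrite Hodd, (sublinear_scal u (- t) x Hsub) by lra. lra.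
  - apply Rle_antisym; [apply Hle |].
    pose proof (Hu O (vopp x0)) as H. pose proof (linearize_opp p x0 Hp) as H1.
    change (Q O (vopp x0) <= - p x0) in H1. rewrite Hodd in H. lra.
Qed.

(** The usual complex functional with real part [u], namely u(x) - i u(i x). The constant 2 comes
    from bounding the two coordinates separately. *)
Lemma complexify (u : X -> R) :
  (forall x y : X, u (vadd x y) = u x + u y) ->
  (forall (t : R) (x : X), u (vscal (RtoC t) x) = t * u x) ->
  (forall x, u x <= norm x) ->
  let phi x := (u x, - u (vscal Ci x)) in
  in_dual X phi /\ forall x, Cmod (phi x) <= 2 * norm x.
Proof.
  intros Ha Hs Hn phi.
  assert (Hb : forall x, Rabs (u x) <= norm x).
  { intros x. apply Rabs_le. split; [| apply Hn].
    pose proof (Hn (vscal (RtoC (-1)) x)) as H. rewrite Hs in H.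
    pose proof (norm_scal_C (RtoC (-1)) x) as H1.
    rewrite Cmod_R, Rabs_left in H1 by lra. lra. }
  assert (HC : forall x, Cmod (phi x) <= 2 * norm x).
  { intros x. unfold phi.
    replace (u x, - u (vscal Ci x)) with (RtoC (u x) - Ci * RtoC (u (vscal Ci x)))%C
      by (unfold RtoC, Ci; apply injective_projections; simpl; ring).
    eapply Rle_trans; [apply Cmod_triangle |].
    rewrite Cmod_opp, Cmod_mult, Cmod_Ci, !Cmod_R.
    pose proof (Hb x). pose proof (Hb (vscal Ci x)).
    pose proof (norm_scal_C Ci x) as H1. rewrite Cmod_Ci in H1. lra. }
  split; [| exact HC]. split.
  - intros x y. unfold phi.
    replace (vscal Ci (vadd x y)) with (vadd (vscal Ci x) (vscal Ci y)) by vec.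
    rewrite !Ha. apply injective_projections; simpl; ring_simplify; try ring; reflexivity.
  - intros k x. change (phi (vscal k x) = Cmult k (phi x)). unfold phi.
    assert (Hk : vscal k x = vadd (vscal (RtoC (fst k)) x) (vscal (RtoC (snd k)) (vscal Ci x))).
    { transitivity (vscal (RtoC (fst k) + RtoC (snd k) * Ci)%C x); [| vec].
      f_equal. destruct k; unfold RtoC, Ci; apply injective_projections; simpl; ring. }
    assert (Hk' : vscal Ci (vscal k x) =
      vsub (vscal (RtoC (fst k)) (vscal Ci x)) (vscal (RtoC (snd k)) x)).
    { transitivity (vscal (RtoC (fst k) * Ci - RtoC (snd k))%C x); [| vec].
      transitivity (vscal (Ci * k)%C x); [vec |].
      f_equal. destruct k; unfold RtoC, Ci; apply injective_projections; simpl; ring. }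
    rewrite Hk'.
    replace (vsub (vscal (RtoC (fst k)) (vscal Ci x)) (vscal (RtoC (snd k)) x))
      with (vadd (vscal (RtoC (fst k)) (vscal Ci x)) (vscal (RtoC (- snd k)) x)) by vec.
    rewrite Hk, !Ha, !Hs. destruct k as [a b].
    apply injective_projections; simpl; ring.
  - exists 2. split; [lra |]. intros x. exact (HC x).
Qed.

Lemma norming_functional (Xsep : separable X) (x0 : X) :
  exists phi : X -> C, in_dual X phi /\ (forall x, Cmod (phi x) <= 2 * norm x) /\
    fst (phi x0) = norm x0.
Proof.
  destruct (hahn_banach Xsep norm x0) as (u & Ha & Hs & Hle & H0).
  - split; [apply (@norm_triangle C_AbsRing X) |]. intros; apply norm_scal_pos; assumption.
  - intros; lra.
  - destruct (complexify u Ha Hs Hle) as [H1 H2].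
    eexists; split; [exact H1 | split; [exact H2 | exact H0]].
Qed.

(** Hahn-Banach applied to the distance to [Y], which is sublinear because [Y] is a subspace. A real
    functional below it is nonpositive on [Y], hence zero there, and its value at [x0] is at least
    [d]. *)
Lemma separating_functional (Xsep : separable X) (Y : X -> Prop) (x0 : X) (d : R) :
  Y (vzero : X) -> (forall x y : X, Y x -> Y y -> Y (vadd x y)) ->
  (forall (c : C) (x : X), Y x -> Y (vscal c x)) ->
  0 < d -> (forall y, Y y -> d <= norm (vsub x0 y)) ->
  exists phi : X -> C, in_dual X phi /\ (forall y, Y y -> phi y = RtoC 0) /\
    phi x0 <> RtoC 0.
Proof.
  intros Y0 Yp Ys Hd Hx0.
  set (p := fun x => real (Glb_Rbar (fun v => exists y, Y y /\ v = norm (vsub x y)))).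
  assert (Hpos : forall x w, (exists y, Y y /\ w = norm (vsub x y)) -> 0 <= w).
  { intros x w (y & _ & ->). apply (@norm_ge_0 C_AbsRing X). }
  assert (Hle : forall x y, Y y -> p x <= norm (vsub x y)).
  { intros x y Hy. apply Glb_lower with 0; [apply Hpos |]. exists y; auto. }
  assert (Hge : forall x m, (forall y, Y y -> m <= norm (vsub x y)) -> m <= p x).
  { intros x m H. apply Glb_greatest with (norm (vsub x (vzero : X))).
    - intros w (y & Hy & ->). auto.
    - exists (vzero : X); auto. }
  assert (Hn : forall x, p x <= norm x).
  { intros x. replace x with (vsub x (vzero : X)) at 2 by vec. auto. }
  destruct (hahn_banach Xsep p x0) as (u & Ha & Hs & Hup & H0).
  - split.
    + intros x y. cut (p (vadd x y) - p y <= p x); [lra |].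
      apply Hge; intros a Ya.
      cut (p (vadd x y) - norm (vsub x a) <= p y); [lra |].
      apply Hge; intros b Yb.
      pose proof (Hle (vadd x y) (vadd a b) (Yp _ _ Ya Yb)) as H.
      replace (vsub (vadd x y) (vadd a b)) with (vadd (vsub x a) (vsub y b)) in H by vec.
      pose proof (@norm_triangle C_AbsRing X (vsub x a) (vsub y b)). lra.
    + intros t x Ht. destruct (Req_dec t 0) as [-> | Hnz].
      * replace (vscal (RtoC 0) x) with (vzero : X) by vec.
        pose proof (Hn (vzero : X)) as H. rewrite (@norm_zero C_AbsRing X) in H. lra.
      * assert (Hi : 0 < / t) by (apply Rinv_0_lt_compat; lra).
        cut (/ t * p (vscal (RtoC t) x) <= p x).
        { intros H. apply (Rmult_le_compat_l t) in H; [| exact Ht].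
          rewrite <- Rmult_assoc, Rinv_r, Rmult_1_l in H by exact Hnz. exact H. }
        apply Hge; intros y Hy.
        pose proof (Hle (vscal (RtoC t) x) (vscal (RtoC t) y) (Ys _ _ Hy)) as H.
        replace (vsub (vscal (RtoC t) x) (vscal (RtoC t) y))
          with (vscal (RtoC t) (vsub x y)) in H by vec.
        pose proof (norm_scal_pos t (vsub x y) Ht) as H1.
        apply (fun h => Rle_trans _ _ _ h H1) in H.
        apply (Rmult_le_compat_l (/ t)) in H; [| lra].
        eapply Rle_trans; [exact H |]. right. field. exact Hnz.
  - exact Hn.
  - assert (Hun : forall x, u x <= norm x) by (intros x; eapply Rle_trans; auto).
    destruct (complexify u Ha Hs Hun) as [H1 H2].
    assert (HuY : forall y, Y y -> u y = 0).
    { intros y Hy.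
      assert (Hy' : forall z, Y z -> u z <= 0).
      { intros z Hz. pose proof (Hup z). pose proof (Hle z z Hz) as Hz0.
        replace (vsub z z) with (vzero : X) in Hz0 by vec.
        rewrite (@norm_zero C_AbsRing X) in Hz0. lra. }
      pose proof (Hy' _ Hy). pose proof (Hy' _ (Ys (RtoC (-1)) _ Hy)) as H3.
      rewrite Hs in H3. lra. }
    eexists; split; [exact H1 | split].
    + intros y Hy. cbv beta. rewrite (HuY y Hy), (HuY (vscal Ci y)) by auto.
      unfold RtoC; f_equal; ring.
    + intros H. apply (f_equal fst) in H. simpl in H.
      pose proof (Hge x0 d Hx0). lra.
Qed.

Lemma dual_add (phi : X -> C) (x y : X) :
  in_dual X phi -> phi (vadd x y) = (phi x + phi y)%C.
Proof. intros H. exact (linear_plus _ H x y). Qed.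

Lemma dual_scal (phi : X -> C) (c : C) (x : X) :
  in_dual X phi -> phi (vscal c x) = (c * phi x)%C.
Proof. intros H. exact (linear_scal _ H c x). Qed.

Lemma dual_sub (phi : X -> C) (x y : X) :
  in_dual X phi -> phi (vsub x y) = (phi x - phi y)%C.
Proof.
  intros H. replace (vsub x y) with (vadd x (vscal (- (1))%C y)) by vec.
  rewrite dual_add, dual_scal by exact H. ring.
Qed.

Lemma dual_separates (Xsep : separable X) (x y : X) :
  (forall phi, in_dual X phi -> phi x = phi y) -> x = y.
Proof.
  intros H. destruct (norming_functional Xsep (vsub x y)) as (phi & Hd & _ & Hn).
  apply minus_norm_eq_0. rewrite <- Hn, dual_sub, (H phi Hd) by exact Hd.
  simpl. lra.
Qed.

(* Gliding hump: with w k of norm at least 2 k 3^k, choose signs so that the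
   partial sum up to rank k of sum 3^-k u_k has size at least 3^-k |w k| at
   w k; the later terms only remove half of it. *)
Lemma weakly_bounded_bounded (Xsep : separable X) (v : nat -> X) :
  (forall phi, in_dual X phi -> exists B, forall n, Cmod (phi (v n)) <= B) ->
  exists B, forall n, norm (v n) <= B.
Proof.
  intros Hv. apply NNPP. intros Hno.
  assert (Hbig : forall k : nat, exists n, 2 * (INR k * 3 ^ k) < norm (v n)).
  { intros k. apply NNPP. intros Hk. apply Hno. exists (2 * (INR k * 3 ^ k)).
    intros n. apply Rnot_lt_le. intros H. apply Hk. exists n. exact H. }
  apply functional_choice in Hbig. destruct Hbig as [nk Hnk].
  set (w := fun k => v (nk k)).
  assert (Hu : forall k, exists u : X -> R,
    (forall x y : X, u (vadd x y) = u x + u y) /\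
    (forall (t : R) (x : X), u (vscal (RtoC t) x) = t * u x) /\
    (forall x, u x <= norm x) /\ u (w k) = norm (w k)).
  { intros k. apply hahn_banach; [exact Xsep | | intros; lra].
    split; [apply (@norm_triangle C_AbsRing X) |].
    intros; apply norm_scal_pos; assumption. }
  apply functional_choice in Hu. destruct Hu as [u Hu].
  set (c := fun k => (/ 3) ^ k).
  assert (Hc : forall k, 0 < c k) by (intros; apply pow_lt; lra).
  (* With this sign the two summands never cancel, so the new partial sum is at least as large as
     its last term. *)
  set (sgn := fun (a b : R) => if Rle_dec 0 (a * b) then 1 else -1).
  assert (Hsgn : forall a b, Rabs b <= Rabs (a + sgn a b * b)).
  { intros a b. unfold sgn. destruct (Rle_dec 0 (a * b)) as [h | h];
    apply Rsqr_le_abs_0; unfold Rsqr; nra. }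
  assert (Hsgn1 : forall a b, Rabs (sgn a b) = 1).
  { intros a b. unfold sgn. destruct Rle_dec; [apply Rabs_R1 | rewrite Rabs_left; lra]. }
  (* The k-th sign depends on the partial sum built so far, evaluated at [w k]; hence the recursion
     is on partial sums rather than on terms. *)
  set (psi := fix psi k := match k with
    | O => fun x => 0
    | S m => fun x => psi m x + sgn (psi m (w m)) (c m * u m (w m)) * (c m * u m x) end).
  set (e := fun k => sgn (psi k (w k)) (c k * u k (w k))).
  set (a := fun x k => e k * (c k * u k x)).
  assert (Hpsi : forall k x, psi (S k) x = sum_n (a x) k).
  { intros k x. induction k as [| k IH].
    - rewrite sum_O. simpl. unfold a, e. simpl. ring.
    - rewrite sum_Sn, <- IH. reflexivity. }
  assert (Hub : forall k x, Rabs (u k x) <= norm x).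
  { intros k x. destruct (Hu k) as (_ & Hs & Hn & _).
    apply Rabs_le. split; [| apply Hn].
    pose proof (Hn (vscal (RtoC (-1)) x)) as H. rewrite Hs in H.
    pose proof (norm_scal_C (RtoC (-1)) x) as H1.
    rewrite Cmod_R, Rabs_left in H1 by lra. lra. }
  assert (Ha : forall x k, Rabs (a x k) <= c k * norm x).
  { intros x k. unfold a, e. rewrite Rabs_mult, Hsgn1, Rmult_1_l, Rabs_mult.
    rewrite (Rabs_pos_eq (c k)) by (left; auto).
    apply Rmult_le_compat_l; [left; auto | auto]. }
  assert (Hgeom : ex_series c).
  { apply ex_series_geom. rewrite Rabs_pos_eq; lra. }
  assert (Hgeom' : forall x : X, ex_series (fun k => c k * norm x)).
  { intros x. exact (ex_series_scal_r (norm x) c Hgeom). }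
  assert (Hser : forall x : X, ex_series (fun k => Rabs (a x k))).
  { intros x. apply (@ex_series_le R_AbsRing R_CompleteNormedModule _ (fun k => c k * norm x)); [| apply Hgeom'].
    intros n. change (Rabs (Rabs (a x n)) <= c n * norm x). rewrite Rabs_Rabsolu. apply Ha. }
  set (U := fun x => Series (a x)).
  assert (HUp : forall x y : X, U (vadd x y) = U x + U y).
  { intros x y. unfold U. rewrite <- Series_plus by (apply ex_series_Rabs; auto).
    apply Series_ext. intros n. unfold a. rewrite (proj1 (Hu n)). ring. }
  assert (HUs : forall (t : R) (x : X), U (vscal (RtoC t) x) = t * U x).
  { intros t x. unfold U. rewrite <- Series_scal_l.
    apply Series_ext. intros n. unfold a. rewrite (proj1 (proj2 (Hu n))). ring. }
  assert (Hgs : Series c = 3 / 2).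
  { unfold c. rewrite Series_geom by (rewrite Rabs_pos_eq; lra). field. }
  assert (HUn : forall x : X, Rabs (U x) <= 3 / 2 * norm x).
  { intros x. unfold U. eapply Rle_trans; [apply Series_Rabs; auto |].
    rewrite <- Hgs, <- Series_scal_r. apply Series_le; auto.
    intros n; split; [apply Rabs_pos | apply Ha]. }
  assert (HUtail : forall (k : nat) (x : X), Rabs (U x - psi (S k) x) <= c k / 2 * norm x).
  { intros k x. rewrite Hpsi. unfold U.
    rewrite (Series_incr_n (a x) (S k)) by (try lia; apply ex_series_Rabs; auto).
    simpl pred. rewrite <- sum_n_Reals.
    replace (_ - _) with (Series (fun n => a x (S k + n)%nat)) by ring.
    assert (Hexr : ex_series (fun n => Rabs (a x (S k + n)%nat))).
    { apply (ex_series_incr_n (fun n => Rabs (a x n))). apply Hser. }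
    eapply Rle_trans; [apply Series_Rabs; exact Hexr |].
    assert (He : forall n, c (S k + n)%nat * norm x = c n * (/ 3 * c k * norm x)).
    { intros n. unfold c. rewrite pow_add. simpl. ring. }
    eapply Rle_trans; [apply (Series_le _ (fun n => c (S k + n)%nat * norm x)) |].
    - intros n; split; [apply Rabs_pos | apply Ha].
    - apply (ex_series_incr_n (fun n => c n * norm x)). apply Hgeom'.
    - rewrite (Series_ext _ _ He), Series_scal_r, Hgs. right. field. }
  (* The series has norm at most 3 / 2; halving it meets the bound by the norm that [complexify]
     requires. *)
  set (U' := fun x => / 2 * U x).
  destruct (complexify U') as [Hd _].
  - intros; unfold U'; rewrite HUp; ring.
  - intros; unfold U'; rewrite HUs; ring.
  - intros x. unfold U'. pose proof (Rle_abs (U x)). pose proof (HUn x).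
    pose proof (@norm_ge_0 C_AbsRing X x). lra.
  - destruct (Hv _ Hd) as [B HB].
    destruct (INR_unbounded (2 * B)) as [k Hk].
    pose proof (HB (nk k)) as H1. fold (w k) in H1.
    pose proof (re_le_Cmod (U' (w k), - U' (vscal Ci (w k)))) as H2. simpl in H2.
    assert (H3 : Rabs (U' (w k)) <= B) by lra.
    unfold U' in H3. rewrite Rabs_mult, (Rabs_pos_eq (/ 2)) in H3 by lra.
    pose proof (HUtail k (w k)) as H4.
    assert (H5 : c k * norm (w k) <= Rabs (psi (S k) (w k))).
    { destruct (Hu k) as (_ & _ & _ & Hw).
      eapply Rle_trans; [| simpl; apply Hsgn].
      rewrite Rabs_mult, Hw, (Rabs_pos_eq (c k)) by (left; auto).
      apply Rmult_le_compat_l; [left; auto | apply Rle_abs]. }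
    assert (H6 : INR k <= / 2 * (c k * norm (w k))).
    { pose proof (Hnk k) as H. fold (w k) in H.
      apply (Rmult_lt_compat_l (c k)) in H; auto.
      replace (c k * (2 * (INR k * 3 ^ k))) with (2 * INR k * (c k * 3 ^ k)) in H by ring.
      unfold c in H at 1. rewrite <- Rpow_mult_distr in H.
      replace (/ 3 * 3) with 1 in H by field. rewrite pow1 in H. lra. }
    pose proof (Rabs_triang_inv (psi (S k) (w k)) (psi (S k) (w k) - U (w k))) as H7.
    replace (psi (S k) (w k) - (psi (S k) (w k) - U (w k))) with (U (w k)) in H7 by ring.
    rewrite (Rabs_minus_sym (psi (S k) (w k))) in H7. lra.
Qed.

End HahnBanach.

(** * Complex differentiability *)

(** Continuity and differentiability are stated with discs, whereas the balls of the uniform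
    structure on [C] are squares. The bounds are non-strict and free of quotients, so that [w = z]
    needs no separate treatment. *)
Definition Ccont (F : C -> C) (z : C) : Prop :=
  forall eps, 0 < eps -> exists del, 0 < del /\
    forall w, Cmod (w - z) < del -> Cmod (F w - F z) <= eps.

Definition Cdiff (F : C -> C) (z : C) : Prop :=
  exists l : C, forall eps, 0 < eps -> exists del, 0 < del /\
    forall w, Cmod (w - z) < del ->
    Cmod (F w - F z - l * (w - z)) <= eps * Cmod (w - z).

Lemma Cmod_minus_sym (z w : C) : Cmod (z - w) = Cmod (w - z).
Proof. rewrite <- (Cmod_opp (w - z)). f_equal. ring. Qed.

Lemma Cmod_minus_triangle (x y z : C) : Cmod (x - z) <= Cmod (x - y) + Cmod (y - z).
Proof. replace (x - z)%C with ((x - y) + (y - z))%C by ring. apply Cmod_triangle. Qed.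

Lemma Cmod_le_Rabs (z : C) : Cmod z <= Rabs (fst z) + Rabs (snd z).
Proof.
  destruct z as [a b]; simpl.
  replace (a, b) with (RtoC a + Ci * RtoC b)%C
    by (unfold RtoC, Ci; apply injective_projections; simpl; ring).
  eapply Rle_trans; [apply Cmod_triangle |].
  rewrite Cmod_mult, Cmod_Ci, !Cmod_R. lra.
Qed.

Lemma Rabs_snd_le_Cmod (z : C) : Rabs (snd z) <= Cmod z.
Proof. eapply Rle_trans; [apply Rmax_r |]. apply Rmax_Cmod. Qed.

Lemma Rabs_fst_le_Cmod (z : C) : Rabs (fst z) <= Cmod z.
Proof. eapply Rle_trans; [apply Rmax_l |]. apply Rmax_Cmod. Qed.

Lemma Cmod_le_plus (x y : C) : Cmod x <= Cmod y + Cmod (x - y).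
Proof. replace x with (y + (x - y))%C at 1 by ring. apply Cmod_triangle. Qed.

Lemma Cmod_small_eq_0 (z : C) : (forall eps, 0 < eps -> Cmod z <= eps) -> z = RtoC 0.
Proof.
  intros H. apply Cmod_eq_0. apply Rle_antisym; [| apply Cmod_ge_0].
  apply le_epsilon. intros eps Heps. specialize (H eps Heps). lra.
Qed.

Lemma Cdiff_Ccont (F : C -> C) (z : C) : Cdiff F z -> Ccont F z.
Proof.
  intros [l Hl] eps Heps.
  destruct (Hl 1 Rlt_0_1) as (d & Hd & H).
  pose proof (Cmod_ge_0 l) as Hlp.
  exists (Rmin d (eps / (1 + Cmod l))). split.
  - apply Rmin_pos; [lra |]. apply Rdiv_lt_0_compat; lra.
  - intros w Hw.
    pose proof (H w (Rlt_le_trans _ _ _ Hw (Rmin_l _ _))) as H1.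
    pose proof (Rlt_le_trans _ _ _ Hw (Rmin_r _ _)) as H2.
    eapply Rle_trans; [apply (Cmod_le_plus _ (l * (w - z)))|].
    rewrite Cmod_mult.
    apply Rle_trans with ((1 + Cmod l) * Cmod (w - z)); [lra |].
    apply Rle_trans with ((1 + Cmod l) * (eps / (1 + Cmod l))).
    + apply Rmult_le_compat_l; lra.
    + right. field. lra.
Qed.

Lemma Cdiff_of_ex_derive (F : C -> C) (z : C) :
  @ex_derive C_AbsRing C_NormedModule F z -> Cdiff F z.
Proof.
  intros [l [_ Hl]]. exists l. intros eps Heps.
  specialize (Hl z (fun P H => H) (mkposreal eps Heps)).
  destruct Hl as [d Hd]. exists (pos d). split; [apply cond_pos |].
  intros w Hw.
  specialize (Hd w Hw).
  replace (l * (w - z))%C with ((w - z) * l)%C by ring.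
  exact Hd.
Qed.

Lemma Cdiff_const (c z : C) : Cdiff (fun _ => c) z.
Proof.
  exists (RtoC 0). intros eps Heps. exists 1. split; [lra |]. intros w _.
  replace (c - c - 0 * (w - z))%C with (RtoC 0) by ring. rewrite Cmod_0.
  pose proof (Cmod_ge_0 (w - z)). nra.
Qed.

Lemma Cdiff_affine (c d z : C) : Cdiff (fun w => c + d * w)%C z.
Proof.
  exists d. intros eps Heps. exists 1. split; [lra |]. intros w _.
  replace (c + d * w - (c + d * z) - d * (w - z))%C with (RtoC 0) by ring. rewrite Cmod_0.
  pose proof (Cmod_ge_0 (w - z)). nra.
Qed.

Lemma Cdiff_comp_affine (F : C -> C) (c d z : C) :
  Cdiff F (c + d * z) -> Cdiff (fun w => F (c + d * w)%C) z.
Proof.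
  intros [l Hl]. exists (l * d)%C. intros eps Heps.
  pose proof (Cmod_ge_0 d) as Hdp.
  assert (He : 0 < eps / (1 + Cmod d)) by (apply Rdiv_lt_0_compat; lra).
  destruct (Hl _ He) as (r & Hr & H).
  exists (r / (1 + Cmod d)). split; [apply Rdiv_lt_0_compat; lra |].
  intros w Hw.
  assert (E : (c + d * w - (c + d * z) = d * (w - z))%C) by ring.
  pose proof (Cmod_ge_0 (w - z)) as Hp.
  assert (Hs : (1 + Cmod d) * Cmod (w - z) < r).
  { apply (Rmult_lt_compat_l (1 + Cmod d)) in Hw; [| lra].
    replace ((1 + Cmod d) * (r / (1 + Cmod d))) with r in Hw by (field; lra). exact Hw. }
  specialize (H (c + d * w)%C). rewrite E, Cmod_mult in H.
  replace (l * d * (w - z))%C with (l * (d * (w - z)))%C by ring.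
  eapply Rle_trans; [apply H; nra |].
  apply Rle_trans with (eps / (1 + Cmod d) * ((1 + Cmod d) * Cmod (w - z))).
  - apply Rmult_le_compat_l; [lra | nra].
  - right. field. lra.
Qed.

Lemma Cdiff_mult (F G : C -> C) (z : C) :
  Cdiff F z -> Cdiff G z -> Cdiff (fun w => F w * G w)%C z.
Proof.
  intros HF HG. pose proof (Cdiff_Ccont G z HG) as HGc.
  destruct HF as [l Hl]. destruct HG as [m Hm].
  exists (l * G z + F z * m)%C. intros eps Heps.
  set (A := 1 + Cmod (G z)). set (B := 1 + Cmod (F z)). set (L := 1 + Cmod l).
  pose proof (Cmod_ge_0 (G z)) as HGp. pose proof (Cmod_ge_0 (F z)) as HFp.
  pose proof (Cmod_ge_0 l) as Hlp.
  assert (HA : 0 < A) by (unfold A; lra). assert (HB : 0 < B) by (unfold B; lra).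
  assert (HL : 0 < L) by (unfold L; lra).
  destruct (Hl (eps / (3 * A))) as (d1 & Hd1 & H1); [apply Rdiv_lt_0_compat; lra |].
  destruct (Hm (eps / (3 * B))) as (d2 & Hd2 & H2); [apply Rdiv_lt_0_compat; lra |].
  destruct (HGc (eps / (3 * L))) as (d3 & Hd3 & H3); [apply Rdiv_lt_0_compat; lra |].
  destruct (HGc 1 Rlt_0_1) as (d4 & Hd4 & H4).
  exists (Rmin (Rmin d1 d2) (Rmin d3 d4)). split; [repeat apply Rmin_pos; lra |].
  intros w Hw.
  assert (Hw12 : Cmod (w - z) < Rmin d1 d2) by (eapply Rlt_le_trans; [exact Hw | apply Rmin_l]).
  assert (Hw34 : Cmod (w - z) < Rmin d3 d4) by (eapply Rlt_le_trans; [exact Hw | apply Rmin_r]).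
  specialize (H1 w (Rlt_le_trans _ _ _ Hw12 (Rmin_l _ _))).
  specialize (H2 w (Rlt_le_trans _ _ _ Hw12 (Rmin_r _ _))).
  specialize (H3 w (Rlt_le_trans _ _ _ Hw34 (Rmin_l _ _))).
  specialize (H4 w (Rlt_le_trans _ _ _ Hw34 (Rmin_r _ _))).
  set (x := Cmod (w - z)) in *. assert (Hx : 0 <= x) by apply Cmod_ge_0.
  replace (F w * G w - F z * G z - (l * G z + F z * m) * (w - z))%C with
    ((F w - F z - l * (w - z)) * G w + F z * (G w - G z - m * (w - z))
      + l * (w - z) * (G w - G z))%C by ring.
  eapply Rle_trans; [apply Cmod_triangle |].
  eapply Rle_trans; [apply Rplus_le_compat_r, Cmod_triangle |].
  rewrite !Cmod_mult. fold x.
  assert (HGw : Cmod (G w) <= A).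
  { eapply Rle_trans; [apply (Cmod_le_plus (G w) (G z)) |]. unfold A. lra. }
  assert (E1 : Cmod (F w - F z - l * (w - z)) * Cmod (G w) <= eps / (3 * A) * x * A).
  { apply Rmult_le_compat; auto using Cmod_ge_0. }
  assert (E2 : Cmod (F z) * Cmod (G w - G z - m * (w - z)) <= B * (eps / (3 * B) * x)).
  { apply Rmult_le_compat; auto using Cmod_ge_0. unfold B; lra. }
  assert (E3 : Cmod l * x * Cmod (G w - G z) <= L * x * (eps / (3 * L))).
  { apply Rmult_le_compat; auto using Cmod_ge_0. apply Rmult_le_pos; auto.
    apply Rmult_le_compat_r; auto. unfold L; lra. }
  replace (eps / (3 * A) * x * A) with (eps * x / 3) in E1 by (field; lra).
  replace (B * (eps / (3 * B) * x)) with (eps * x / 3) in E2 by (field; lra).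
  replace (L * x * (eps / (3 * L))) with (eps * x / 3) in E3 by (field; lra).
  lra.
Qed.

Lemma Cdiff_inv (z : C) : z <> RtoC 0 -> Cdiff (fun w => / w)%C z.
Proof.
  intros Hz. pose proof (proj1 (Cmod_gt_0 z) Hz) as Hp. set (r := Cmod z) in *.
  exists (- / (z * z))%C. intros eps Heps.
  exists (Rmin (r / 2) (eps * (r * r * r) / 2)).
  split.
  { apply Rmin_pos; [lra |]. assert (0 < r * r * r) by (repeat apply Rmult_lt_0_compat; lra). nra. }
  intros w Hw.
  pose proof (Rlt_le_trans _ _ _ Hw (Rmin_l _ _)) as Hw1.
  pose proof (Rlt_le_trans _ _ _ Hw (Rmin_r _ _)) as Hw2.
  assert (Hwr : r / 2 < Cmod w).
  { pose proof (Cmod_le_plus z w) as H. rewrite Cmod_minus_sym in H. fold r in H. lra. }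
  assert (Hw0 : w <> RtoC 0) by (apply Cmod_gt_0; lra).
  replace (/ w - / z - - / (z * z) * (w - z))%C with ((w - z) * (w - z) / (w * (z * z)))%C
    by (field; split; assumption).
  rewrite Cmod_div, !Cmod_mult by (repeat apply Cmult_neq_0; assumption). fold r.
  set (x := Cmod (w - z)) in *. assert (Hx : 0 <= x) by apply Cmod_ge_0.
  apply Rle_trans with (x * x / (r / 2 * (r * r))).
  - apply Rmult_le_compat_l; [nra |]. apply Rinv_le_contravar; [nra |].
    apply Rmult_le_compat_r; nra.
  - replace (x * x / (r / 2 * (r * r))) with (x * 2 / (r * r * r) * x) by (field; lra).
    apply Rmult_le_compat_r; [exact Hx |].
    assert (Hr3 : 0 < r * r * r) by (repeat apply Rmult_lt_0_compat; lra).
    apply Rmult_le_reg_r with (r * r * r); [exact Hr3 |].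
    unfold Rdiv. rewrite Rmult_assoc, Rinv_l, Rmult_1_r by lra. lra.
Qed.

(** * The complex exponential *)

Definition cexp (z : C) : C := (exp (fst z) * cos (snd z), exp (fst z) * sin (snd z)).

Lemma cexp_plus (z w : C) : cexp (z + w) = (cexp z * cexp w)%C.
Proof.
  unfold cexp; apply injective_projections; simpl; rewrite exp_plus;
    [rewrite cos_plus | rewrite sin_plus]; ring.
Qed.

Lemma cexp_0 : cexp 0 = RtoC 1.
Proof. unfold cexp, RtoC; simpl. rewrite exp_0, cos_0, sin_0. f_equal; ring. Qed.

Lemma Cmod_cexp (z : C) : Cmod (cexp z) = exp (fst z).
Proof.
  unfold cexp, Cmod; simpl.
  replace (_ + _) with (exp (fst z) * exp (fst z) * (Rsqr (sin (snd z)) + Rsqr (cos (snd z))))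
    by (unfold Rsqr; ring).
  rewrite sin2_cos2, Rmult_1_r. apply sqrt_square. left; apply exp_pos.
Qed.

Lemma derivable_pt_lim_bound (f : R -> R) (x l : R) : derivable_pt_lim f x l ->
  forall eps, 0 < eps -> exists del, 0 < del /\
    forall h, Rabs h < del -> Rabs (f (x + h) - f x - l * h) <= eps * Rabs h.
Proof.
  intros H eps Heps. destruct (H eps Heps) as [d Hd].
  exists d. split; [apply cond_pos |]. intros h Hh.
  destruct (Req_dec h 0) as [-> | Hn].
  - rewrite Rplus_0_r. replace (f x - f x - l * 0) with 0 by ring. rewrite Rabs_R0. lra.
  - specialize (Hd h Hn Hh).
    replace (f (x + h) - f x - l * h) with (((f (x + h) - f x) / h - l) * h) by (field; exact Hn).
    rewrite Rabs_mult. apply Rmult_le_compat_r; [apply Rabs_pos | lra].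
Qed.

(** At the origin the real derivatives of exp, cos and sin give the whole estimate; the functional
    equation then carries it to every point, so the Cauchy-Riemann equations never appear. *)
Lemma cexp_diff_0 (eps : R) : 0 < eps -> exists del, 0 < del /\
  forall h, Cmod h < del -> Cmod (cexp h - 1 - h) <= eps * Cmod h.
Proof.
  intros Heps.
  destruct (derivable_pt_lim_bound exp 0 (exp 0) (derivable_pt_lim_exp 0) (eps / 8))
    as (d1 & Hd1 & H1); [lra |].
  destruct (derivable_pt_lim_bound cos 0 (- sin 0) (derivable_pt_lim_cos 0) (eps / 16))
    as (d2 & Hd2 & H2); [lra |].
  destruct (derivable_pt_lim_bound sin 0 (cos 0) (derivable_pt_lim_sin 0) (eps / 8))
    as (d3 & Hd3 & H3); [lra |].
  destruct (derivable_pt_lim_bound exp 0 (exp 0) (derivable_pt_lim_exp 0) 1)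
    as (d4 & Hd4 & H4); [lra |].
  exists (Rmin (Rmin (Rmin d1 d2) (Rmin d3 d4)) (Rmin (1 / 4) (eps / 16))).
  split; [repeat apply Rmin_pos; lra |].
  intros [a b] Hh.
  assert (Ha : Rabs a <= Cmod (a, b)) by apply (Rabs_fst_le_Cmod (a, b)).
  assert (Hb : Rabs b <= Cmod (a, b)) by apply (Rabs_snd_le_Cmod (a, b)).
  set (x := Cmod (a, b)) in *.
  assert (Hx : x < Rmin (Rmin d1 d2) (Rmin d3 d4)) by (eapply Rlt_le_trans; [exact Hh | apply Rmin_l]).
  assert (Hx' : x < Rmin (1 / 4) (eps / 16)) by (eapply Rlt_le_trans; [exact Hh | apply Rmin_r]).
  assert (Hx12 : x < Rmin d1 d2) by (eapply Rlt_le_trans; [exact Hx | apply Rmin_l]).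
  assert (Hx34 : x < Rmin d3 d4) by (eapply Rlt_le_trans; [exact Hx | apply Rmin_r]).
  assert (x < d1) by (eapply Rlt_le_trans; [exact Hx12 | apply Rmin_l]).
  assert (x < d2) by (eapply Rlt_le_trans; [exact Hx12 | apply Rmin_r]).
  assert (x < d3) by (eapply Rlt_le_trans; [exact Hx34 | apply Rmin_l]).
  assert (x < d4) by (eapply Rlt_le_trans; [exact Hx34 | apply Rmin_r]).
  assert (x < 1 / 4) by (eapply Rlt_le_trans; [exact Hx' | apply Rmin_l]).
  assert (x < eps / 16) by (eapply Rlt_le_trans; [exact Hx' | apply Rmin_r]).
  specialize (H1 a ltac:(lra)). specialize (H2 b ltac:(lra)).
  specialize (H3 b ltac:(lra)). specialize (H4 a ltac:(lra)).
  rewrite exp_0 in *. rewrite sin_0, cos_0 in *. rewrite !Rplus_0_l in *.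
  assert (Hx0 : 0 <= x) by apply Cmod_ge_0.
  assert (He : Rabs (exp a - 1) <= 2 * x).
  { replace (exp a - 1) with ((exp a - 1 - 1 * a) + a) by ring.
    eapply Rle_trans; [apply Rabs_triang |]. lra. }
  assert (Hea : exp a <= 2).
  { apply Rabs_le_between in He. lra. }
  eapply Rle_trans; [apply Cmod_le_Rabs |]. simpl.
  replace (exp a * cos b + - (1) + - a) with
    ((exp a - 1 - 1 * a) + exp a * (cos b - 1 - - 0 * b)) by ring.
  replace (exp a * sin b + - 0 + - b) with
    ((exp a - 1) * sin b + (sin b - 0 - 1 * b)) by ring.
  assert (Hsin : Rabs (sin b) <= 1) by (apply Rabs_le; pose proof (SIN_bound b); lra).
  assert (Hs2 : Rabs (sin b) <= (1 + eps / 8) * x).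
  { replace (sin b) with ((sin b - 0 - 1 * b) + b) by ring.
    eapply Rle_trans; [apply Rabs_triang |]. nra. }
  assert (Hs3 : Rabs ((exp a - 1) * sin b) <= eps / 4 * x).
  { rewrite Rabs_mult.
    apply Rle_trans with (2 * x * ((1 + eps / 8) * x)).
    - apply Rmult_le_compat; auto using Rabs_pos.
    - assert (2 * x * (1 + eps / 8) <= eps / 4) by nra. nra. }
  assert (Hc3 : Rabs (exp a * (cos b - 1 - - 0 * b)) <= eps / 8 * x).
  { rewrite Rabs_mult, (Rabs_pos_eq (exp a)) by (left; apply exp_pos).
    apply Rle_trans with (2 * (eps / 16 * Rabs b)).
    - apply Rmult_le_compat; auto using Rabs_pos. left; apply exp_pos.
    - nra. }
  pose proof (Rabs_triang (exp a - 1 - 1 * a) (exp a * (cos b - 1 - - 0 * b))).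
  pose proof (Rabs_triang ((exp a - 1) * sin b) (sin b - 0 - 1 * b)).
  assert (eps / 8 * Rabs a <= eps / 8 * x) by nra.
  assert (eps / 8 * Rabs b <= eps / 8 * x) by nra.
  assert (0 <= eps * x) by nra. lra.
Qed.

Lemma Cdiff_cexp (z : C) : Cdiff cexp z.
Proof.
  exists (cexp z). intros eps Heps.
  assert (Hp : 0 < Cmod (cexp z)) by (rewrite Cmod_cexp; apply exp_pos).
  destruct (cexp_diff_0 (eps / Cmod (cexp z))) as (d & Hd & H);
    [apply Rdiv_lt_0_compat; lra |].
  exists d. split; [exact Hd |]. intros w Hw. specialize (H _ Hw).
  replace (cexp w) with (cexp z * cexp (w - z))%C
    by (rewrite <- cexp_plus; f_equal; ring).
  replace (cexp z * cexp (w - z) - cexp z - cexp z * (w - z))%C with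
    (cexp z * (cexp (w - z) - 1 - (w - z)))%C by ring.
  rewrite Cmod_mult. apply (Rmult_le_compat_l (Cmod (cexp z))) in H; [| lra].
  eapply Rle_trans; [exact H |]. right. field. lra.
Qed.

(** * Path integrals and Goursat's theorem *)

Definition Rcont (g : R -> C) (t : R) : Prop :=
  forall eps, 0 < eps -> exists del, 0 < del /\
    forall s, Rabs (s - t) < del -> Cmod (g s - g t) <= eps.

Definition cont01 (g : R -> C) : Prop := forall t, 0 <= t <= 1 -> Rcont g t.

(** Integrating the coordinates apart reduces everything to real integration; the price is the
    constant 2 in [I01_bound]. *)
Definition I01 (g : R -> C) : C :=
  (RInt (fun t => fst (g t)) 0 1, RInt (fun t => snd (g t)) 0 1).

Lemma continuous_R_intro (f : R -> R) (t : R) :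
  (forall eps, 0 < eps -> exists del, 0 < del /\
    forall s, Rabs (s - t) < del -> Rabs (f s - f t) <= eps) ->
  continuous f t.
Proof.
  intros H P [e He]. destruct (H (e / 2)) as (d & Hd & H1).
  { pose proof (cond_pos e). lra. }
  exists (mkposreal d Hd). intros s Hs. apply He.
  specialize (H1 s Hs). change (Rabs (f s - f t) < e).
  pose proof (cond_pos e). lra.
Qed.

Lemma cont01_ex_RInt_fst (g : R -> C) (a b : R) : 0 <= a <= 1 -> 0 <= b <= 1 ->
  cont01 g -> ex_RInt (fun t => fst (g t)) a b.
Proof.
  intros Ha Hb H. apply (@ex_RInt_continuous R_CompleteNormedModule). intros z Hz.
  assert (Hz' : 0 <= z <= 1).
  { revert Hz. unfold Rmin, Rmax. destruct Rle_dec; lra. }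
  apply continuous_R_intro. intros eps Heps.
  destruct (H z Hz' eps Heps) as (d & Hd & H1). exists d. split; [exact Hd |].
  intros s Hs. eapply Rle_trans; [apply (Rabs_fst_le_Cmod (g s - g z)%C) | auto].
Qed.

Lemma cont01_ex_RInt_snd (g : R -> C) (a b : R) : 0 <= a <= 1 -> 0 <= b <= 1 ->
  cont01 g -> ex_RInt (fun t => snd (g t)) a b.
Proof.
  intros Ha Hb H. apply (@ex_RInt_continuous R_CompleteNormedModule). intros z Hz.
  assert (Hz' : 0 <= z <= 1).
  { revert Hz. unfold Rmin, Rmax. destruct Rle_dec; lra. }
  apply continuous_R_intro. intros eps Heps.
  destruct (H z Hz' eps Heps) as (d & Hd & H1). exists d. split; [exact Hd |].
  intros s Hs. eapply Rle_trans; [apply (Rabs_snd_le_Cmod (g s - g z)%C) | auto].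
Qed.

Lemma I01_ext (f g : R -> C) : (forall t, 0 <= t <= 1 -> f t = g t) -> I01 f = I01 g.
Proof.
  intros H. unfold I01. apply injective_projections; simpl; apply RInt_ext;
    rewrite Rmin_left, Rmax_right by lra; intros t Ht; rewrite H by lra; reflexivity.
Qed.

Lemma I01_plus (f g : R -> C) : cont01 f -> cont01 g ->
  I01 (fun t => f t + g t)%C = (I01 f + I01 g)%C.
Proof.
  intros Hf Hg. unfold I01. apply injective_projections; simpl.
  - apply (@RInt_plus R_CompleteNormedModule (fun t => fst (f t)) (fun t => fst (g t)));
      apply cont01_ex_RInt_fst; auto; lra.
  - apply (@RInt_plus R_CompleteNormedModule (fun t => snd (f t)) (fun t => snd (g t)));
      apply cont01_ex_RInt_snd; auto; lra.
Qed.

Lemma I01_scal (c : C) (f : R -> C) : cont01 f ->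
  I01 (fun t => c * f t)%C = (c * I01 f)%C.
Proof.
  intros Hf.
  assert (H1 : ex_RInt (fun t => fst (f t)) 0 1) by (apply cont01_ex_RInt_fst; auto; lra).
  assert (H2 : ex_RInt (fun t => snd (f t)) 0 1) by (apply cont01_ex_RInt_snd; auto; lra).
  destruct c as [a b]. unfold I01. apply injective_projections; simpl.
  - apply is_RInt_unique.
    apply (@is_RInt_minus R_NormedModule (fun t => a * fst (f t)) (fun t => b * snd (f t)));
      apply (@is_RInt_scal R_NormedModule); apply (@RInt_correct R_CompleteNormedModule); assumption.
  - apply is_RInt_unique.
    apply (@is_RInt_plus R_NormedModule (fun t => a * snd (f t)) (fun t => b * fst (f t)));
      apply (@is_RInt_scal R_NormedModule); apply (@RInt_correct R_CompleteNormedModule); assumption.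
Qed.

Lemma I01_bound (f : R -> C) (M : R) : cont01 f ->
  (forall t, 0 <= t <= 1 -> Cmod (f t) <= M) -> Cmod (I01 f) <= 2 * M.
Proof.
  intros Hf HM.
  assert (H1 : Rabs (RInt (fun t => fst (f t)) 0 1) <= (1 - 0) * M).
  { apply (@norm_RInt_le_const R_NormedModule (fun t => fst (f t)) 0 1); [lra | |].
    - intros t Ht. eapply Rle_trans; [apply (Rabs_fst_le_Cmod (f t)) | auto].
    - apply (@RInt_correct R_CompleteNormedModule), cont01_ex_RInt_fst; auto; lra. }
  assert (H2 : Rabs (RInt (fun t => snd (f t)) 0 1) <= (1 - 0) * M).
  { apply (@norm_RInt_le_const R_NormedModule (fun t => snd (f t)) 0 1); [lra | |].
    - intros t Ht. eapply Rle_trans; [apply (Rabs_snd_le_Cmod (f t)) | auto].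
    - apply (@RInt_correct R_CompleteNormedModule), cont01_ex_RInt_snd; auto; lra. }
  eapply Rle_trans; [apply Cmod_le_Rabs |]. unfold I01; simpl. lra.
Qed.

Lemma is_RInt_subst (f : R -> R) (u v l : R) : u <> 0 ->
  is_RInt f (u * 0 + v) (u * 1 + v) l -> is_RInt (fun t => f (u * t + v)) 0 1 (/ u * l).
Proof.
  intros Hu H. apply (@is_RInt_comp_lin R_NormedModule) in H.
  apply (@is_RInt_scal R_NormedModule _ _ _ (/ u)) in H.
  revert H. apply is_RInt_ext. intros t _.
  change (/ u * (u * f (u * t + v)) = f (u * t + v)). field. exact Hu.
Qed.

Lemma RInt_reverse (f : R -> R) : ex_RInt f 0 1 -> RInt (fun t => f (1 - t)) 0 1 = RInt f 0 1.
Proof.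
  intros Hf. apply is_RInt_unique.
  assert (H : is_RInt f (-1 * 0 + 1) (-1 * 1 + 1) (- RInt f 0 1)).
  { replace (-1 * 0 + 1) with 1 by ring. replace (-1 * 1 + 1) with 0 by ring.
    apply (@is_RInt_swap R_NormedModule), (@RInt_correct R_CompleteNormedModule), Hf. }
  apply is_RInt_subst in H; [| lra].
  assert (E : forall x : R, / -1 * - x = x) by (intros; field). rewrite E in H.
  revert H. apply is_RInt_ext. intros t _. f_equal. ring.
Qed.

Lemma RInt_halves (f : R -> R) : ex_RInt f 0 1 ->
  RInt f 0 1 = / 2 * RInt (fun t => f (/ 2 * t + 0)) 0 1 + / 2 * RInt (fun t => f (/ 2 * t + / 2)) 0 1.
Proof.
  intros Hf.
  assert (H1 : ex_RInt f 0 (/ 2)) by (apply (@ex_RInt_Chasles_1 R_CompleteNormedModule f 0 (/ 2) 1); [lra | exact Hf]).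
  assert (H2 : ex_RInt f (/ 2) 1) by (apply (@ex_RInt_Chasles_2 R_CompleteNormedModule f 0 (/ 2) 1); [lra | exact Hf]).
  rewrite <- (@RInt_Chasles R_CompleteNormedModule f 0 (/ 2) 1 H1 H2).
  apply (@RInt_correct R_CompleteNormedModule) in H1.
  apply (@RInt_correct R_CompleteNormedModule) in H2.
  rewrite (is_RInt_unique (fun t => f (/ 2 * t + 0)) 0 1 (/ / 2 * RInt f 0 (/ 2))).
  2: { apply is_RInt_subst; [lra |].
       replace (/ 2 * 0 + 0) with 0 by ring. replace (/ 2 * 1 + 0) with (/ 2) by ring. exact H1. }
  rewrite (is_RInt_unique (fun t => f (/ 2 * t + / 2)) 0 1 (/ / 2 * RInt f (/ 2) 1)).
  2: { apply is_RInt_subst; [lra |].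
       replace (/ 2 * 0 + / 2) with (/ 2) by ring. replace (/ 2 * 1 + / 2) with 1 by field. exact H2. }
  assert (E : forall x y : R, x + y = / 2 * (/ / 2 * x) + / 2 * (/ / 2 * y)) by (intros; field).
  apply E.
Qed.

Lemma I01_reverse (f : R -> C) : cont01 f -> I01 (fun t => f (1 - t)) = I01 f.
Proof.
  intros Hf. unfold I01. apply injective_projections; simpl.
  - apply (RInt_reverse (fun t => fst (f t))). apply cont01_ex_RInt_fst; auto; lra.
  - apply (RInt_reverse (fun t => snd (f t))). apply cont01_ex_RInt_snd; auto; lra.
Qed.

Lemma I01_halves (f : R -> C) : cont01 f ->
  I01 f = (/ 2 * I01 (fun t => f (/ 2 * t + 0)%R) + / 2 * I01 (fun t => f (/ 2 * t + / 2)%R))%C.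
Proof.
  intros Hf. replace (/ 2)%C with (RtoC (/ 2)) by (rewrite RtoC_inv by lra; reflexivity).
  unfold I01. apply injective_projections; simpl.
  - rewrite (RInt_halves (fun t => fst (f t))) by (apply cont01_ex_RInt_fst; auto; lra). ring.
  - rewrite (RInt_halves (fun t => snd (f t))) by (apply cont01_ex_RInt_snd; auto; lra). ring.
Qed.

Lemma I01_affine (a b : C) : I01 (fun t => a + RtoC t * b)%C = (a + RtoC (/ 2) * b)%C.
Proof.
  assert (H : forall x y : R, is_RInt (fun t => x + t * y) 0 1 (x + / 2 * y)).
  { intros x y.
    pose proof (@is_RInt_derive R_CompleteNormedModule (fun t => x * t + t * t * (y / 2)) (fun t => x + t * y) 0 1) as H.
    replace (minus _ _) with (x + / 2 * y) in H; [apply H |].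
    - intros t _. auto_derive; [trivial | field].
    - intros t _. apply (@ex_derive_continuous R_AbsRing R_NormedModule). auto_derive. trivial.
    - unfold minus, plus, opp; simpl. field. }
  destruct a as [a1 a2], b as [b1 b2]. unfold I01. apply injective_projections; simpl.
  - assert (E : forall t : R, a1 + (t * b1 - 0 * b2) = a1 + t * b1) by (intros; ring).
    rewrite (RInt_ext _ _ _ _ (fun t _ => E t)), (is_RInt_unique _ _ _ _ (H a1 b1)). ring.
  - assert (E : forall t : R, a2 + (t * b2 + 0 * b1) = a2 + t * b2) by (intros; ring).
    rewrite (RInt_ext _ _ _ _ (fun t _ => E t)), (is_RInt_unique _ _ _ _ (H a2 b2)). ring.
Qed.

Lemma Rcont_mult_const (f : R -> C) (c : C) (t : R) : Rcont f t -> Rcont (fun s => f s * c)%C t.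
Proof.
  intros Hf eps Heps. pose proof (Cmod_ge_0 c) as Hc.
  destruct (Hf (eps / (1 + Cmod c))) as (d & Hd & H); [apply Rdiv_lt_0_compat; lra |].
  exists d. split; [exact Hd |]. intros s Hs. specialize (H s Hs).
  replace (f s * c - f t * c)%C with ((f s - f t) * c)%C by ring. rewrite Cmod_mult.
  apply Rle_trans with (eps / (1 + Cmod c) * (1 + Cmod c)).
  - apply Rmult_le_compat; auto using Cmod_ge_0. lra.
  - right; field; lra.
Qed.

Lemma Rcont_line (F : C -> C) (a b : C) (t : R) :
  Ccont F (a + RtoC t * b) -> Rcont (fun s => F (a + RtoC s * b)%C) t.
Proof.
  intros HF eps Heps. destruct (HF eps Heps) as (d & Hd & H).
  pose proof (Cmod_ge_0 b) as Hb.
  exists (d / (1 + Cmod b)). split; [apply Rdiv_lt_0_compat; lra |].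
  intros s Hs. apply H.
  replace (a + s * b - (a + t * b))%C with (RtoC (s - t) * b)%C by (rewrite RtoC_minus; ring).
  rewrite Cmod_mult, Cmod_R.
  apply (Rmult_lt_compat_r (1 + Cmod b)) in Hs; [| lra].
  replace (d / (1 + Cmod b) * (1 + Cmod b)) with d in Hs by (field; lra).
  pose proof (Rabs_pos (s - t)). nra.
Qed.

Definition seg (F : C -> C) (a b : C) : C :=
  I01 (fun t => F (a + RtoC t * (b - a)) * (b - a))%C.

Definition convexC (D : C -> Prop) : Prop :=
  forall a b t, D a -> D b -> 0 <= t <= 1 -> D (a + RtoC t * (b - a))%C.

Lemma seg_cont01 (D : C -> Prop) (F : C -> C) (a b : C) :
  convexC D -> (forall z, D z -> Ccont F z) -> D a -> D b ->
  cont01 (fun t => F (a + RtoC t * (b - a)) * (b - a))%C.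
Proof.
  intros HD HF Ha Hb t Ht. apply (Rcont_mult_const (fun s => F (a + RtoC s * (b - a))%C)).
  apply Rcont_line. auto.
Qed.

Lemma seg_swap (D : C -> Prop) (F : C -> C) (a b : C) :
  convexC D -> (forall z, D z -> Ccont F z) -> D a -> D b -> seg F b a = (- seg F a b)%C.
Proof.
  intros HD HF Ha Hb. pose proof (seg_cont01 D F a b HD HF Ha Hb) as Hc.
  unfold seg at 1. rewrite <- (I01_reverse _ (seg_cont01 D F b a HD HF Hb Ha)).
  transitivity (- (1) * seg F a b)%C; [| ring].
  unfold seg. rewrite <- I01_scal by exact Hc.
  apply I01_ext. intros t Ht. rewrite RtoC_minus.
  replace (b + (1 - t) * (a - b))%C with (a + t * (b - a))%C by ring. ring.
Qed.

Lemma seg_mid (D : C -> Prop) (F : C -> C) (a b : C) :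
  convexC D -> (forall z, D z -> Ccont F z) -> D a -> D b ->
  seg F a b = (seg F a (a + RtoC (/ 2) * (b - a)) + seg F (a + RtoC (/ 2) * (b - a)) b)%C.
Proof.
  intros HD HF Ha Hb.
  set (m := (a + RtoC (/ 2) * (b - a))%C).
  assert (Hm : D m) by (apply HD; auto; lra).
  assert (E2 : (/ 2)%C = RtoC (/ 2)) by (rewrite RtoC_inv by lra; reflexivity).
  (* For [ring], the scalar [RtoC (/ 2)] is an atom; this identity is therefore rewritten by hand
     wherever two halves recombine. *)
  assert (Em : (RtoC (/ 2) + RtoC (/ 2) = 1)%C) by (rewrite <- RtoC_plus; f_equal; field).
  pose proof (seg_cont01 D F a b HD HF Ha Hb) as Hc.
  pose proof (seg_cont01 D F a m HD HF Ha Hm) as Hc1.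
  pose proof (seg_cont01 D F m b HD HF Hm Hb) as Hc2.
  assert (Em1 : (m - a = RtoC (/ 2) * (b - a))%C) by (unfold m; ring).
  assert (Em2 : (b - m = RtoC (/ 2) * (b - a))%C).
  { unfold m. replace (b - (a + RtoC (/ 2) * (b - a)))%C with (1 * (b - a) - RtoC (/ 2) * (b - a))%C by ring.
    rewrite <- Em. ring. }
  unfold seg at 1. rewrite I01_halves by exact Hc. rewrite E2. f_equal.
  - set (J := I01 _). transitivity (RtoC (/ 2) * (2 * seg F a m))%C.
    + f_equal. unfold J, seg. rewrite <- I01_scal by exact Hc1.
      apply I01_ext. intros t Ht. rewrite Em1, RtoC_plus, RtoC_mult.
      replace (a + (RtoC (/ 2) * t + 0) * (b - a))%C with (a + t * (RtoC (/ 2) * (b - a)))%C by ring.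
      replace (b - a)%C with (1 * (b - a))%C at 2 by ring. rewrite <- Em. ring.
    + replace (RtoC (/ 2) * (2 * seg F a m))%C with ((RtoC (/ 2) + RtoC (/ 2)) * seg F a m)%C by ring.
      rewrite Em. ring.
  - set (J := I01 _). transitivity (RtoC (/ 2) * (2 * seg F m b))%C.
    + f_equal. unfold J, seg. rewrite <- I01_scal by exact Hc2.
      apply I01_ext. intros t Ht. rewrite Em2, RtoC_plus, RtoC_mult.
      replace (m + t * (RtoC (/ 2) * (b - a)))%C with (a + (RtoC (/ 2) * t + RtoC (/ 2)) * (b - a))%C
        by (unfold m; ring).
      replace (b - a)%C with (1 * (b - a))%C at 2 by ring. rewrite <- Em. ring.
    + replace (RtoC (/ 2) * (2 * seg F m b))%C with ((RtoC (/ 2) + RtoC (/ 2)) * seg F m b)%C by ring.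
      rewrite Em. ring.
Qed.

(** An affine function has a primitive, so its integrals along the sides of a triangle telescope to
    zero. This removes the linear part in the proof of [goursat]. *)
Lemma seg_affine (A B a b : C) :
  seg (fun z => A + B * z)%C a b = (A * (b - a) + RtoC (/ 2) * (B * (b * b - a * a)))%C.
Proof.
  unfold seg.
  rewrite (I01_ext _ (fun t => ((A + B * a) * (b - a)) + RtoC t * (B * (b - a) * (b - a)))%C)
    by (intros; ring).
  rewrite I01_affine.
  replace ((A + B * a) * (b - a))%C with (A * (b - a) + 1 * (B * a * (b - a)))%C by ring.
  replace (RtoC 1) with (RtoC (/ 2) + RtoC (/ 2))%C by (rewrite <- RtoC_plus; f_equal; field).
  ring.
Qed.

Lemma seg_bound (D : C -> Prop) (F : C -> C) (a b : C) (M : R) :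
  convexC D -> (forall z, D z -> Ccont F z) -> D a -> D b ->
  (forall t, 0 <= t <= 1 -> Cmod (F (a + RtoC t * (b - a))%C) <= M) ->
  Cmod (seg F a b) <= 2 * (M * Cmod (b - a)).
Proof.
  intros HD HF Ha Hb HM. apply I01_bound; [exact (seg_cont01 D F a b HD HF Ha Hb) |].
  intros t Ht. rewrite Cmod_mult. apply Rmult_le_compat_r; [apply Cmod_ge_0 | auto].
Qed.

Lemma Ccont_plus (F G : C -> C) (z : C) :
  Ccont F z -> Ccont G z -> Ccont (fun w => F w + G w)%C z.
Proof.
  intros HF HG eps Heps.
  destruct (HF (eps / 2)) as (d1 & Hd1 & H1); [lra |].
  destruct (HG (eps / 2)) as (d2 & Hd2 & H2); [lra |].
  exists (Rmin d1 d2). split; [apply Rmin_pos; lra |]. intros w Hw.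
  specialize (H1 w (Rlt_le_trans _ _ _ Hw (Rmin_l _ _))).
  specialize (H2 w (Rlt_le_trans _ _ _ Hw (Rmin_r _ _))).
  replace (F w + G w - (F z + G z))%C with ((F w - F z) + (G w - G z))%C by ring.
  eapply Rle_trans; [apply Cmod_triangle |]. lra.
Qed.

Lemma Ccont_affine (c d z : C) : Ccont (fun w => c + d * w)%C z.
Proof. apply Cdiff_Ccont, Cdiff_affine. Qed.

Lemma seg_plus (D : C -> Prop) (F G : C -> C) (a b : C) :
  convexC D -> (forall z, D z -> Ccont F z) -> (forall z, D z -> Ccont G z) -> D a -> D b ->
  seg (fun z => F z + G z)%C a b = (seg F a b + seg G a b)%C.
Proof.
  intros HD HF HG Ha Hb. unfold seg. rewrite <- I01_plus.
  - apply I01_ext. intros; ring.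
  - exact (seg_cont01 D F a b HD HF Ha Hb).
  - exact (seg_cont01 D G a b HD HG Ha Hb).
Qed.

Lemma seg_ext (F G : C -> C) (a b : C) : (forall z, F z = G z) -> seg F a b = seg G a b.
Proof. intros H. apply I01_ext. intros. rewrite H. reflexivity. Qed.

Definition tri (F : C -> C) (a b c : C) : C := (seg F a b + seg F b c + seg F c a)%C.

Definition perimeter (a b c : C) : R := Cmod (b - a) + Cmod (c - b) + Cmod (a - c).

(** The intervals of radius 2 d / 2^n around [x n] are nested, and the supremum of their lower ends
    lies in all of them. *)
Lemma geometric_limit_R (x : nat -> R) (d : R) :
  (forall n, Rabs (x (S n) - x n) <= d * (/ 2) ^ n) ->
  exists l, forall n, Rabs (x n - l) <= 2 * d * (/ 2) ^ n.
Proof.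
  intros H.
  assert (Hd : 0 <= d).
  { pose proof (H O) as h. simpl in h. pose proof (Rabs_pos (x 1%nat - x O)). lra. }
  set (lo := fun n => x n - 2 * d * (/ 2) ^ n). set (hi := fun n => x n + 2 * d * (/ 2) ^ n).
  assert (Hlo : forall n, lo n <= lo (S n)).
  { intros n. pose proof (H n) as h. apply Rabs_le_between in h. unfold lo. simpl. lra. }
  assert (Hhi : forall n, hi (S n) <= hi n).
  { intros n. pose proof (H n) as h. apply Rabs_le_between in h. unfold hi. simpl. lra. }
  assert (Hlo' : forall n k, lo n <= lo (n + k)%nat).
  { intros n k. induction k; [rewrite Nat.add_0_r; lra |]. rewrite Nat.add_succ_r.
    eapply Rle_trans; [exact IHk | apply Hlo]. }
  assert (Hhi' : forall n k, hi (n + k)%nat <= hi n).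
  { intros n k. induction k; [rewrite Nat.add_0_r; lra |]. rewrite Nat.add_succ_r.
    eapply Rle_trans; [apply Hhi | exact IHk]. }
  assert (Hlh : forall n, lo n <= hi n).
  { intros n. unfold lo, hi. assert (0 < (/ 2) ^ n) by (apply pow_lt; lra). nra. }
  assert (Hm : forall n m, lo n <= hi m).
  { intros n m. eapply Rle_trans; [apply (Hlo' n m) |].
    eapply Rle_trans; [apply Hlh |]. rewrite Nat.add_comm. apply Hhi'. }
  destruct (completeness (fun v => exists n, v = lo n)) as [l [Hl1 Hl2]].
  - exists (hi O). intros v [n ->]. apply Hm.
  - exists (lo O), O. reflexivity.
  - exists l. intros n. apply Rabs_le.
    pose proof (Hl1 (lo n) (ex_intro _ n eq_refl)) as h1.
    assert (h2 : l <= hi n) by (apply Hl2; intros v [k ->]; apply Hm).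
    unfold lo, hi in *. lra.
Qed.

Lemma geometric_limit (z : nat -> C) (d : R) :
  (forall n, Cmod (z (S n) - z n) <= d * (/ 2) ^ n) ->
  exists l, forall n, Cmod (z n - l) <= 4 * d * (/ 2) ^ n.
Proof.
  intros H.
  destruct (geometric_limit_R (fun n => fst (z n)) d) as [l1 H1].
  { intros n. eapply Rle_trans; [apply (Rabs_fst_le_Cmod (z (S n) - z n)%C) | apply H]. }
  destruct (geometric_limit_R (fun n => snd (z n)) d) as [l2 H2].
  { intros n. eapply Rle_trans; [apply (Rabs_snd_le_Cmod (z (S n) - z n)%C) | apply H]. }
  exists (l1, l2). intros n. eapply Rle_trans; [apply Cmod_le_Rabs |].
  specialize (H1 n). specialize (H2 n). simpl in *. unfold Rminus in *. lra.
Qed.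

Lemma Cmod_half (z : C) : Cmod (RtoC (/ 2) * z) = Cmod z / 2.
Proof. rewrite Cmod_mult, Cmod_R, Rabs_pos_eq by lra. field. Qed.

Section Goursat.
Context (D : C -> Prop) (F : C -> C).
Context (HD : convexC D) (Hc : forall z, D z -> Ccont F z).

(** The midpoints cut the triangle into four whose integrals add up, the inner sides cancelling; if
    three of them carry less than a quarter of the total, the fourth carries more. The bound on
    [a' - a] makes the first vertices of iterated triangles converge. *)
Lemma tri_bisect (a b c : C) : D a -> D b -> D c ->
  exists a' b' c', D a' /\ D b' /\ D c' /\
    Cmod (tri F a b c) <= 4 * Cmod (tri F a' b' c') /\
    perimeter a' b' c' = perimeter a b c / 2 /\
    Cmod (a' - a) <= perimeter a b c.
Proof.
  intros Ha Hb Hcc.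
  set (h := RtoC (/ 2)).
  set (ab := (a + h * (b - a))%C). set (bc := (b + h * (c - b))%C). set (ca := (c + h * (a - c))%C).
  assert (Dab : D ab) by (apply HD; auto; lra).
  assert (Dbc : D bc) by (apply HD; auto; lra).
  assert (Dca : D ca) by (apply HD; auto; lra).
  assert (Eh : (h + h = 1)%C) by (unfold h; rewrite <- RtoC_plus; f_equal; field).
  assert (Etri : (tri F a b c = tri F a ab ca + tri F ab b bc + tri F ca bc c + tri F bc ca ab)%C).
  { unfold tri. rewrite (seg_mid D F a b), (seg_mid D F b c), (seg_mid D F c a) by auto.
    fold h ab bc ca.
    rewrite (seg_swap D F ab ca), (seg_swap D F ab bc), (seg_swap D F bc ca) by auto. ring. }
  assert (P : forall x y, Cmod (h * (x - y)) = Cmod (x - y) / 2) by (intros; apply Cmod_half).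
  assert (E1 : (ab - a = h * (b - a))%C) by (unfold ab; ring).
  assert (E2 : (b - ab = h * (b - a))%C).
  { transitivity (1 * (b - a) - h * (b - a))%C; [unfold ab; ring | rewrite <- Eh; ring]. }
  assert (E3 : (bc - b = h * (c - b))%C) by (unfold bc; ring).
  assert (E4 : (c - bc = h * (c - b))%C).
  { transitivity (1 * (c - b) - h * (c - b))%C; [unfold bc; ring | rewrite <- Eh; ring]. }
  assert (E5 : (ca - c = h * (a - c))%C) by (unfold ca; ring).
  assert (E6 : (a - ca = h * (a - c))%C).
  { transitivity (1 * (a - c) - h * (a - c))%C; [unfold ca; ring | rewrite <- Eh; ring]. }
  assert (E7 : (ca - ab = h * (c - b))%C).
  { transitivity ((c - a) + h * (a - c) - h * (b - a))%C; [unfold ca, ab; ring |].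
    transitivity (1 * (c - a) + h * (a - c) - h * (b - a))%C; [ring | rewrite <- Eh; ring]. }
  assert (E8 : (ab - bc = h * (a - c))%C).
  { transitivity ((a - b) + h * (b - a) - h * (c - b))%C; [unfold bc, ab; ring |].
    transitivity (1 * (a - b) + h * (b - a) - h * (c - b))%C; [ring | rewrite <- Eh; ring]. }
  assert (E9 : (bc - ca = h * (b - a))%C).
  { transitivity ((b - c) + h * (c - b) - h * (a - c))%C; [unfold bc, ca; ring |].
    transitivity (1 * (b - c) + h * (c - b) - h * (a - c))%C; [ring | rewrite <- Eh; ring]. }
  assert (M : forall x y, Cmod (x - y) = Cmod (y - x)) by (intros; apply Cmod_minus_sym).
  pose proof (Cmod_ge_0 (b - a)). pose proof (Cmod_ge_0 (c - b)). pose proof (Cmod_ge_0 (a - c)).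
  destruct (Rle_dec (Cmod (tri F a b c)) (4 * Cmod (tri F a ab ca))) as [h1 | h1].
  { exists a, ab, ca. repeat split; auto; unfold perimeter.
    - rewrite E1, E7, E6, !P. field.
    - replace (a - a)%C with (RtoC 0) by ring. rewrite Cmod_0. lra. }
  destruct (Rle_dec (Cmod (tri F a b c)) (4 * Cmod (tri F ab b bc))) as [h2 | h2].
  { exists ab, b, bc. repeat split; auto; unfold perimeter.
    - rewrite E2, E3, E8, !P. field.
    - rewrite E1, P. lra. }
  destruct (Rle_dec (Cmod (tri F a b c)) (4 * Cmod (tri F ca bc c))) as [h3 | h3].
  { exists ca, bc, c. repeat split; auto; unfold perimeter.
    - rewrite E9, E4, E5, !P. field.
    - rewrite M, E6, P. lra. }
  exists bc, ca, ab. repeat split; auto; unfold perimeter.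
  - rewrite Etri in *.
    pose proof (Cmod_triangle (tri F a ab ca + tri F ab b bc + tri F ca bc c) (tri F bc ca ab)).
    pose proof (Cmod_triangle (tri F a ab ca + tri F ab b bc) (tri F ca bc c)).
    pose proof (Cmod_triangle (tri F a ab ca) (tri F ab b bc)). lra.
  - rewrite (M ca bc), E9, (M ab ca), E7, (M bc ab), E8, !P. field.
  - replace (bc - a)%C with ((bc - b) + (b - a))%C by ring.
    eapply Rle_trans; [apply Cmod_triangle |]. rewrite E3, P. lra.
Qed.

(** Near the limit point of the nested triangles [F] is affine up to a relative error e. The affine
    part integrates to zero, and the rest is of order e times the squared perimeter, that is e /
    4^n, which balances the factor 4^n lost in n bisections. Closedness of [D] puts the limit point
    in [D]. *)
Theorem goursat (a b c : C) :
  (forall p, (forall eps, 0 < eps -> exists z, D z /\ Cmod (z - p) < eps) -> D p) ->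
  (forall z, D z -> Cdiff F z) ->
  D a -> D b -> D c -> tri F a b c = RtoC 0.
Proof.
  intros Hclosed Hdiff Ha Hb Hcc.
  set (good := fun T : C * C * C => D (fst (fst T)) /\ D (snd (fst T)) /\ D (snd T)).
  set (trT := fun T : C * C * C => tri F (fst (fst T)) (snd (fst T)) (snd T)).
  set (per := fun T : C * C * C => perimeter (fst (fst T)) (snd (fst T)) (snd T)).
  (* The condition [good T] stands under the existential so that choice yields a total map on
     triples; triples outside [D] are left unchanged. *)
  assert (Hnext : forall T, exists T', good T -> good T' /\
    Cmod (trT T) <= 4 * Cmod (trT T') /\ per T' = per T / 2 /\
    Cmod (fst (fst T') - fst (fst T)) <= per T).
  { intros [[x y] z]. destruct (classic (good (x, y, z))) as [(Hx & Hy & Hz) | Hn].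
    - destruct (tri_bisect x y z Hx Hy Hz) as (x' & y' & z' & h1 & h2 & h3 & h4 & h5 & h6).
      exists (x', y', z'). intros _. unfold good, trT, per; simpl. auto.
    - exists (x, y, z). tauto. }
  apply functional_choice in Hnext. destruct Hnext as [next Hnext].
  set (T := fix T n := match n with O => (a, b, c) | S m => next (T m) end).
  assert (HT : forall n, good (T n)).
  { induction n; [unfold good; simpl; auto | apply Hnext; exact IHn]. }
  set (d := perimeter a b c).
  assert (Hper : forall n, per (T n) = d * (/ 2) ^ n).
  { induction n; [unfold per, d; simpl; ring |].
    simpl. destruct (Hnext _ (HT n)) as (_ & _ & -> & _). rewrite IHn. field. }
  assert (Htri : forall n, Cmod (tri F a b c) <= 4 ^ n * Cmod (trT (T n))).
  { induction n; [unfold trT; simpl; lra |].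
    destruct (Hnext _ (HT n)) as (_ & h & _). simpl T. simpl pow.
    assert (0 < 4 ^ n) by (apply pow_lt; lra).
    apply Rle_trans with (4 ^ n * Cmod (trT (T n))); [exact IHn |].
    replace (4 * 4 ^ n * Cmod (trT (next (T n)))) with (4 ^ n * (4 * Cmod (trT (next (T n))))) by ring.
    apply Rmult_le_compat_l; lra. }
  destruct (geometric_limit (fun n => fst (fst (T n))) d) as [p Hp].
  { intros n. destruct (Hnext _ (HT n)) as (_ & _ & _ & h).
    rewrite <- Hper. exact h. }
  assert (Hd0 : 0 <= d).
  { unfold d, perimeter. pose proof (Cmod_ge_0 (b - a)). pose proof (Cmod_ge_0 (c - b)).
    pose proof (Cmod_ge_0 (a - c)). lra. }
  (* Five is 4 + 1: the first vertex is within 4 d / 2^n of the limit, and the perimeter is d /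
     2^n. *)
  assert (Hsmall : forall eps, 0 < eps -> exists n, 5 * d * (/ 2) ^ n < eps).
  { intros eps Heps.
    destruct (pow_lt_1_zero (/ 2) ltac:(rewrite Rabs_pos_eq; lra) (eps / (5 * d + 1))) as [n Hn].
    { apply Rdiv_lt_0_compat; lra. }
    exists n. specialize (Hn n ltac:(lia)).
    rewrite Rabs_pos_eq in Hn by (apply pow_le; lra).
    apply (Rmult_lt_compat_l (5 * d + 1)) in Hn; [| lra].
    replace ((5 * d + 1) * (eps / (5 * d + 1))) with eps in Hn by (field; lra).
    assert (0 < (/ 2) ^ n) by (apply pow_lt; lra). lra. }
  assert (Dp : D p).
  { apply Hclosed. intros eps Heps. destruct (Hsmall eps Heps) as [n Hn].
    exists (fst (fst (T n))). split; [apply HT |].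
    eapply Rle_lt_trans; [apply Hp |].
    assert (0 < (/ 2) ^ n) by (apply pow_lt; lra). nra. }
  destruct (Hdiff p Dp) as [l Hl].
  apply Cmod_small_eq_0. intros eps Heps.
  (* The sides contribute 2 * 5 = 10, the 2 being that of [seg_bound] and the 5 the distance to [p];
     the added 1 keeps the denominator positive when the triangle degenerates. *)
  assert (He' : 0 < eps / (10 * d * d + 1)) by (apply Rdiv_lt_0_compat; nra).
  set (e := eps / (10 * d * d + 1)) in *.
  destruct (Hl e He') as (del & Hdel & H).
  destruct (Hsmall del Hdel) as [n Hn].
  eapply Rle_trans; [apply (Htri n) |].
  pose proof (Hper n) as Hpn. pose proof (Hp n) as Hpp. destruct (HT n) as (Dx & Dy & Dz).
  unfold trT, per in *. destruct (T n) as [[x y] z]. simpl in *.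
  set (h := (/ 2) ^ n) in *. assert (Hh : 0 < h) by (apply pow_lt; lra).
  set (A := (F p - l * p)%C).
  set (Rm := fun w => (F w + (- A + - l * w))%C).
  assert (HRc : forall w, D w -> Ccont Rm w).
  { intros w Hw. apply Ccont_plus; [auto | apply Ccont_affine]. }
  assert (Eseg : forall u v, D u -> D v ->
    seg F u v = (seg Rm u v + (A * (v - u) + RtoC (/ 2) * (l * (v * v - u * u))))%C).
  { intros u v Hu Hv. rewrite <- seg_affine.
    rewrite <- (seg_plus D Rm (fun w => A + l * w)%C)
      by (auto; intros; apply Ccont_affine).
    apply seg_ext. intros w. unfold Rm. ring. }
  assert (Eseg' : tri F x y z = tri Rm x y z).
  { unfold tri. rewrite (Eseg x y), (Eseg y z), (Eseg z x) by auto. ring. }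
  rewrite Eseg'.
  unfold perimeter in Hpn.
  pose proof (Cmod_ge_0 (y - x)). pose proof (Cmod_ge_0 (z - y)). pose proof (Cmod_ge_0 (x - z)).
  assert (Hnear : forall u v t, 0 <= t <= 1 -> Cmod (u - x) + Cmod (v - u) <= d * h ->
    Cmod (Rm (u + RtoC t * (v - u))%C) <= e * (5 * d * h)).
  { intros u v t Ht Huv. set (w := (u + RtoC t * (v - u))%C).
    assert (Hw : Cmod (w - p) <= 5 * d * h).
    { replace (w - p)%C with ((RtoC t * (v - u) + (u - x)) + (x - p))%C by (unfold w; ring).
      eapply Rle_trans; [apply Cmod_triangle |].
      pose proof (Cmod_triangle (RtoC t * (v - u)) (u - x)) as h1.
      rewrite Cmod_mult, Cmod_R, Rabs_pos_eq in h1 by lra.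
      pose proof (Cmod_ge_0 (v - u)). nra. }
    replace (Rm w) with (F w - F p - l * (w - p))%C by (unfold Rm, A; ring).
    eapply Rle_trans; [apply H; lra |]. apply Rmult_le_compat_l; lra. }
  assert (S1 : Cmod (seg Rm x y) <= 2 * (e * (5 * d * h) * Cmod (y - x))).
  { apply (seg_bound D); auto. intros t Ht. apply Hnear; auto.
    replace (x - x)%C with (RtoC 0) by ring. rewrite Cmod_0. lra. }
  assert (S2 : Cmod (seg Rm y z) <= 2 * (e * (5 * d * h) * Cmod (z - y))).
  { apply (seg_bound D); auto. intros t Ht. apply Hnear; auto. lra. }
  assert (S3 : Cmod (seg Rm z x) <= 2 * (e * (5 * d * h) * Cmod (x - z))).
  { apply (seg_bound D); auto. intros t Ht. apply Hnear; auto.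
    rewrite (Cmod_minus_sym z x).
    pose proof (Cmod_minus_triangle x y z) as h1.
    rewrite (Cmod_minus_sym x y), (Cmod_minus_sym y z) in h1. lra. }
  apply Rle_trans with (4 ^ n * (10 * e * d * h * (d * h))).
  { apply Rmult_le_compat_l; [left; apply pow_lt; lra |].
    unfold tri. eapply Rle_trans; [apply Cmod_triangle |].
    eapply Rle_trans; [apply Rplus_le_compat_r, Cmod_triangle |].
    rewrite <- Hpn. lra. }
  assert (E4 : 4 ^ n * (h * h) = 1).
  { unfold h. rewrite <- !Rpow_mult_distr. replace (4 * (/ 2 * / 2)) with 1 by field. apply pow1. }
  replace (4 ^ n * (10 * e * d * h * (d * h))) with (10 * e * d * d * (4 ^ n * (h * h))) by ring.
  rewrite E4.
  apply Rle_trans with (e * (10 * d * d + 1)); [nra |].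
  unfold e. right. field. nra.
Qed.

End Goursat.

(** * The identity theorem *)

Lemma Ci_sqr : (Ci * Ci = - (1))%C.
Proof. unfold Ci, RtoC; apply injective_projections; simpl; ring. Qed.

Lemma convex_half_disc (s r : R) : convexC (fun z => s <= fst z /\ Cmod z <= r).
Proof.
  intros a b t [Ha1 Ha2] [Hb1 Hb2] Ht. split.
  - destruct a, b; simpl in *. nra.
  - replace (a + t * (b - a))%C with (RtoC (1 - t) * a + RtoC t * b)%C
      by (rewrite RtoC_minus; ring).
    eapply Rle_trans; [apply Cmod_triangle |].
    rewrite !Cmod_mult, !Cmod_R, !Rabs_pos_eq by lra. nra.
Qed.

Lemma closed_half_disc (s r : R) (p : C) :
  (forall eps, 0 < eps -> exists z, (s <= fst z /\ Cmod z <= r) /\ Cmod (z - p) < eps) ->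
  s <= fst p /\ Cmod p <= r.
Proof.
  intros H. split.
  - apply le_epsilon. intros eps Heps. destruct (H eps Heps) as (z & [Hz _] & Hzp).
    pose proof (Rabs_fst_le_Cmod (z - p)%C) as h.
    assert (h2 : Rabs (fst z - fst p) < eps) by (unfold Rminus; eapply Rle_lt_trans; [exact h | exact Hzp]).
    apply Rabs_lt_between in h2. lra.
  - apply le_epsilon. intros eps Heps. destruct (H eps Heps) as (z & [_ Hz] & Hzp).
    pose proof (Cmod_le_plus p z) as h. rewrite Cmod_minus_sym in h. lra.
Qed.

(* The product of the four rotations of g vanishes on the whole boundary of the
   square |Re|, |Im| <= 1, so Cauchy's formula kills it at the center.  By
   rotation invariance the formula only involves one side of the square. *)
Lemma vanish_square_center (g : C -> C) :
  (forall z, Cmod z <= 2 -> Cdiff g z) ->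
  (forall t, -1 <= t <= 1 -> g (1, t) = RtoC 0) -> g (RtoC 0) = RtoC 0.
Proof.
  intros Hg Hv.
  set (P := fun z => ((g z * g (Ci * z)) * (g (- z) * g (- (Ci * z))))%C).
  assert (HProt : forall z, P (Ci * z)%C = P z).
  { intros z. unfold P.
    replace (Ci * (Ci * z))%C with (- z)%C.
    2: { transitivity ((Ci * Ci) * z)%C; [rewrite Ci_sqr; ring | ring]. }
    replace (- - z)%C with z by ring. ring. }
  assert (HPd : forall z, Cmod z <= 2 -> Cdiff P z).
  { intros z Hz. unfold P.
    assert (G : forall c, Cmod c = 1 -> Cdiff (fun w => g (0 + c * w)%C) z).
    { intros c Hc'. apply Cdiff_comp_affine. apply Hg.
      replace (0 + c * z)%C with (c * z)%C by ring. rewrite Cmod_mult, Hc'. lra. }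
    assert (E : forall (F G : C -> C), (forall w, F w = G w) -> Cdiff F z -> Cdiff G z).
    { intros F G' HE [l Hl]. exists l. intros eps Heps. destruct (Hl eps Heps) as (d & Hd & H).
      exists d. split; [exact Hd |]. intros w Hw. rewrite <- !HE. auto. }
    apply Cdiff_mult; apply Cdiff_mult.
    - auto.
    - apply (E (fun w => g (0 + Ci * w)%C)); [intros; f_equal; ring | apply G, Cmod_Ci].
    - apply (E (fun w => g (0 + (- (1)) * w)%C)); [intros; f_equal; ring | apply G].
      rewrite Cmod_opp. apply Cmod_1.
    - apply (E (fun w => g (0 + (- Ci) * w)%C)); [intros; f_equal; ring | apply G].
      rewrite Cmod_opp. apply Cmod_Ci. }
  set (F := fun z => (P z * / z)%C).
  set (A := (1, -1) : C). set (B := (1, 1) : C).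
  assert (HBA : B = (Ci * A)%C) by (unfold A, B, Ci; apply injective_projections; simpl; ring).
  (* The side [A B] and its copy scaled by [s] bound a trapezoid, cut by a diagonal into two
     triangles on which Goursat applies. Its slanted sides are quarter-turn images of each other,
     and P(z) dz / z is invariant under the quarter turn, so they cancel; the far side contributes
     zero. *)
  assert (Hside : forall s, 0 < s < 1 -> seg F (RtoC s * A)%C (RtoC s * B)%C = RtoC 0).
  { intros s Hs.
    set (D := fun z : C => s <= fst z /\ Cmod z <= 2).
    assert (HDc : convexC D) by apply convex_half_disc.
    assert (HD0 : forall z, D z -> z <> RtoC 0).
    { intros z [Hz _] ->. simpl in Hz. lra. }
    assert (HFd : forall z, D z -> Cdiff F z).
    { intros z Hz. apply Cdiff_mult; [apply HPd, Hz | apply Cdiff_inv; auto]. }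
    assert (HFc : forall z, D z -> Ccont F z) by (intros; apply Cdiff_Ccont; auto).
    assert (HDt : forall t x y, s <= t <= 1 -> (x, y) = A \/ (x, y) = B -> D (RtoC t * (x, y))%C).
    { intros t x y Ht Hxy. assert (Hx : x = 1 /\ Rabs y = 1).
      { destruct Hxy as [E | E]; injection E; intros -> ->; split; auto;
          [rewrite Rabs_left; lra | rewrite Rabs_pos_eq; lra]. }
      destruct Hx as [-> Hy]. split; [simpl; lra |].
      rewrite Cmod_mult, Cmod_R, Rabs_pos_eq by lra.
      pose proof (Cmod_le_Rabs (1, y)) as h. simpl in h. rewrite Hy, Rabs_R1 in h.
      pose proof (Cmod_ge_0 (1, y)). nra. }
    assert (D1 : D (RtoC s * A)%C) by (apply HDt; [lra | left; reflexivity]).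
    assert (D2 : D (RtoC s * B)%C) by (apply HDt; [lra | right; reflexivity]).
    assert (D3 : D A) by (replace A with (RtoC 1 * A)%C by ring; apply HDt; [lra | left; reflexivity]).
    assert (D4 : D B) by (replace B with (RtoC 1 * B)%C by ring; apply HDt; [lra | right; reflexivity]).
    set (a := (RtoC s * A)%C) in *. set (b := (RtoC s * B)%C) in *.
    assert (T1 : tri F a A B = RtoC 0).
    { apply (goursat D); auto. intros p. apply closed_half_disc. }
    assert (T2 : tri F a B b = RtoC 0).
    { apply (goursat D); auto. intros p. apply closed_half_disc. }
    assert (Hrot : seg F a A = seg F b B).
    { unfold seg. apply I01_ext. intros t Ht.
      replace (b + t * (B - b))%C with (Ci * (a + t * (A - a)))%C.
      2: { unfold a, b. rewrite HBA. ring. }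
      replace (B - b)%C with (Ci * (A - a))%C by (unfold a, b; rewrite HBA; ring).
      unfold F. rewrite HProt.
      assert (Hz : (a + t * (A - a))%C <> RtoC 0) by (apply HD0, HDc; auto).
      assert (HCi : Ci <> RtoC 0).
      { intros E. pose proof Cmod_Ci as h. rewrite E, Cmod_0 in h. lra. }
      field. split; assumption. }
    assert (Hfar : seg F A B = RtoC 0).
    { unfold seg. rewrite (I01_ext _ (fun t => 0 + RtoC t * 0)%C).
      - rewrite I01_affine. ring.
      - intros t Ht. replace (A + t * (B - A))%C with ((1, 2 * t - 1) : C)
          by (unfold A, B; apply injective_projections; simpl; ring).
        unfold F, P. rewrite Hv by lra. ring. }
    unfold tri in T1, T2. rewrite Hfar in T1.
    rewrite (seg_swap D F a B) in T1 by auto.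
    rewrite (seg_swap D F a b), (seg_swap D F b B) in T2 by auto. rewrite Hrot in T1.
    replace (seg F a b) with ((seg F b B + 0 + - seg F a B) - (seg F a B + - seg F b B + - seg F a b)
       - 2 * seg F b B + 2 * seg F a B)%C by ring.
    rewrite T1, T2.
    assert (E : (seg F a B = seg F b B)%C).
    { replace (seg F a B) with (seg F b B - (seg F b B + 0 + - seg F a B))%C by ring.
      rewrite T1. ring. }
    rewrite E. ring. }
  set (e := fun t : R => (A + RtoC t * (B - A))%C).
  assert (He : forall t, e t = (1, 2 * t - 1)).
  { intros t. unfold e, A, B; apply injective_projections; simpl; ring. }
  assert (He0 : forall t, e t <> RtoC 0).
  { intros t. rewrite He. intros E. injection E. intros. lra. }
  assert (He1 : forall t, 1 <= Cmod (e t)).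
  { intros t. rewrite He. pose proof (Rabs_fst_le_Cmod (1, 2 * t - 1)) as h. simpl in h.
    rewrite Rabs_R1 in h. exact h. }
  assert (He2 : forall t, 0 <= t <= 1 -> Cmod (e t) <= 2).
  { intros t Ht. rewrite He. eapply Rle_trans; [apply Cmod_le_Rabs |]. simpl.
    rewrite Rabs_R1. assert (Rabs (2 * t - 1) <= 1) by (apply Rabs_le; lra). lra. }
  set (k := fun t : R => (/ e t * (B - A))%C).
  assert (Hkc : cont01 k).
  { intros t _. apply (Rcont_mult_const (fun s => / e s)%C).
    apply (Rcont_line (fun z => / z)%C). apply Cdiff_Ccont, Cdiff_inv. apply He0. }
  assert (HBA2 : Cmod (B - A) <= 2).
  { eapply Rle_trans; [apply Cmod_le_Rabs |]. unfold A, B; simpl.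
    replace (1 + - (1)) with 0 by ring. replace (1 + - -1) with 2 by ring.
    rewrite Rabs_R0, Rabs_pos_eq; lra. }
  assert (Hkb : forall t, Cmod (k t) <= 2).
  { intros t. unfold k. rewrite Cmod_mult, Cmod_inv by auto.
    assert (/ Cmod (e t) <= 1).
    { rewrite <- Rinv_1. apply Rinv_le_contravar; [lra | apply He1]. }
    assert (0 < / Cmod (e t)) by (apply Rinv_0_lt_compat; pose proof (He1 t); lra).
    pose proof (Cmod_ge_0 (B - A)). nra. }
  (* The integral of dz / z along one side of the square is i pi / 2; a lower bound for its
     imaginary part is enough to make it nonzero. *)
  assert (HI : 1 <= snd (I01 k)).
  { change (1 <= RInt (fun t => snd (k t)) 0 1). replace 1 with (RInt (fun _ : R => 1) 0 1) at 1.
    2: { rewrite RInt_const. unfold scal; simpl; unfold mult; simpl. ring. }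
    apply RInt_le; [lra | apply ex_RInt_const | apply cont01_ex_RInt_snd; auto; lra |].
    intros t Ht. unfold k. rewrite He. unfold A, B. simpl.
    replace (1 + - -1) with 2 by ring. replace (1 + - (1)) with 0 by ring.
    rewrite !Rmult_1_r, Rmult_0_r, Rplus_0_r.
    assert (0 < 1 * 1 + (2 * t - 1) * (2 * t - 1) <= 2) by nra.
    match goal with |- 1 <= 1 / ?D * 2 =>
      apply Rle_trans with (1 / 2 * 2); [lra |]; apply Rmult_le_compat_r; [lra |];
      unfold Rdiv; rewrite !Rmult_1_l; apply Rinv_le_contravar; nra end. }
  (* The limit of [Hside] as [s] tends to 0: the factor [s] drops out of dz / z, and P tends to its
     value at the center. *)
  assert (Hprod : (P 0 * I01 k = 0)%C).
  { apply Cmod_small_eq_0. intros eps Heps.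
    destruct (Cdiff_Ccont P 0 (HPd 0 ltac:(rewrite Cmod_0; lra)) (eps / 4)) as (d & Hd & Hcont); [lra |].
    set (s := Rmin (1 / 2) (d / 4)).
    assert (Hs : 0 < s < 1).
    { unfold s. split; [apply Rmin_pos; lra |]. eapply Rle_lt_trans; [apply Rmin_l | lra]. }
    assert (Hsd : s <= d / 4) by apply Rmin_r.
    pose proof (Hside s Hs) as H0.
    assert (HPk : cont01 (fun t => P (RtoC s * e t) * k t)%C).
    { intros t Ht. unfold k.
      intros ep Hep.
      assert (HQ : Cdiff (fun z => P (0 + RtoC s * z) * / z)%C (e t)).
      { apply Cdiff_mult; [apply Cdiff_comp_affine, HPd | apply Cdiff_inv, He0].
        replace (0 + s * e t)%C with (s * e t)%C by ring.
        rewrite Cmod_mult, Cmod_R, Rabs_pos_eq by lra. pose proof (He2 t Ht).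
        pose proof (Cmod_ge_0 (e t)). nra. }
      pose proof (Rcont_mult_const _ (B - A) t (Rcont_line _ A (B - A) t (Cdiff_Ccont _ _ HQ))) as HR.
      destruct (HR ep Hep) as (dl & Hdl & HH). exists dl. split; [exact Hdl |].
      intros u Hu. specialize (HH u Hu). unfold e in *.
      replace (0 + s * (A + u * (B - A)))%C with (s * (A + u * (B - A)))%C in HH by ring.
      replace (0 + s * (A + t * (B - A)))%C with (s * (A + t * (B - A)))%C in HH by ring.
      rewrite !Cmult_assoc. exact HH. }
    assert (H1 : I01 (fun t => P (RtoC s * e t) * k t)%C = RtoC 0).
    { rewrite <- H0. unfold seg. apply I01_ext. intros t Ht. unfold F, k.
      replace (s * A + t * (s * B - s * A))%C with (RtoC s * e t)%C by (unfold e; ring).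
      assert (Hs0 : RtoC s <> RtoC 0) by (intros E; apply RtoC_inj in E; lra).
      pose proof (He0 t). field. split; assumption. }
    assert (HPkc : cont01 (fun t => P 0 * k t)%C).
    { intros t Ht. intros ep Hep.
      destruct (Rcont_mult_const k (P 0) t (Hkc t Ht) ep Hep) as (dl & Hdl & HH).
      exists dl. split; [exact Hdl |]. intros u Hu.
      rewrite !(Cmult_comm (P 0)). auto. }
    assert (Hm1 : cont01 (fun t => - (1) * (P (RtoC s * e t) * k t))%C).
    { intros t Ht ep Hep. destruct (Rcont_mult_const _ (- (1))%C t (HPk t Ht) ep Hep) as (dl & Hdl & HH).
      exists dl. split; [exact Hdl |]. intros u Hu.
      rewrite !(Cmult_comm (- (1))). auto. }
    replace (P 0 * I01 k)%C with (P 0 * I01 k + - (1) * I01 (fun t => P (RtoC s * e t) * k t))%C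
      by (rewrite H1; ring).
    rewrite <- !I01_scal, <- I01_plus by auto.
    replace eps with (2 * (eps / 4 * 2)) by field.
    apply I01_bound.
    - intros t Ht ep Hep.
      destruct (HPkc t Ht (ep / 2)) as (d1 & Hd1 & h1); [lra |].
      destruct (Hm1 t Ht (ep / 2)) as (d2 & Hd2 & h2); [lra |].
      exists (Rmin d1 d2). split; [apply Rmin_pos; lra |]. intros u Hu.
      specialize (h1 u (Rlt_le_trans _ _ _ Hu (Rmin_l _ _))).
      specialize (h2 u (Rlt_le_trans _ _ _ Hu (Rmin_r _ _))).
      match goal with |- Cmod (?x + ?y - (?z + ?w)) <= _ =>
        replace (x + y - (z + w))%C with ((x - z) + (y - w))%C by ring end.
      eapply Rle_trans; [apply Cmod_triangle |]. lra.
    - intros t Ht.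
      replace (P 0 * k t + - (1) * (P (s * e t) * k t))%C with ((P 0 - P (s * e t)) * k t)%C by ring.
      rewrite Cmod_mult. apply Rmult_le_compat; auto using Cmod_ge_0.
      rewrite Cmod_minus_sym. apply Hcont.
      replace (s * e t - 0)%C with (s * e t)%C by ring.
      rewrite Cmod_mult, Cmod_R, Rabs_pos_eq by lra. pose proof (He2 t Ht).
      pose proof (Cmod_ge_0 (e t)). nra. }
  assert (HI0 : I01 k <> RtoC 0).
  { intros E. rewrite E in HI. simpl in HI. lra. }
  destruct (Ceq_dec (g 0) 0) as [E | E]; [exact E |]. exfalso.
  revert Hprod. apply Cmult_neq_0; [| exact HI0]. unfold P.
  replace (Ci * 0)%C with (RtoC 0) by ring. replace (- 0)%C with (RtoC 0) by ring.
  repeat apply Cmult_neq_0; exact E.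
Qed.

(** The standard square moved to center [z], with [p] the mirror image of [z] in the side of zeros;
    the disc of radius 2 becomes that of radius |p - z|. In its two uses [p] is the center of a disc
    of zeros and the reflection of [z] in the imaginary axis. *)
Lemma vanish_square (h : C -> C) (z p : C) :
  (forall w, Cmod (w - z) <= Cmod (p - z) -> Cdiff h w) ->
  (forall t, -1 <= t <= 1 -> h (z + (p - z) * (1, t) * RtoC (/ 2))%C = RtoC 0) ->
  h z = RtoC 0.
Proof.
  intros Hd Hv.
  pose proof (vanish_square_center (fun x => h (z + ((p - z) * RtoC (/ 2)) * x)%C)) as H.
  replace z with (z + ((p - z) * RtoC (/ 2)) * 0)%C by ring. apply H.
  - intros x Hx. apply Cdiff_comp_affine, Hd.
    replace (z + (p - z) * RtoC (/ 2) * x - z)%C with ((p - z) * RtoC (/ 2) * x)%C by ring.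
    rewrite !Cmod_mult, Cmod_R, Rabs_pos_eq by lra.
    pose proof (Cmod_ge_0 (p - z)). nra.
  - intros t Ht. rewrite <- (Hv t Ht). f_equal. ring.
Qed.

Section Identity.
Context (U : C -> Prop) (h : C -> C).
Context (Hd : forall z, U z -> Cdiff h z).

(* If h vanishes on the disc of radius s about p, it vanishes at the center of
   every square having a side in that disc, hence on the disc of radius 1.4 s. *)
Lemma vanish_disc_grow (p : C) (r s : R) :
  (forall z, Cmod (z - p) < r -> U z) ->
  (forall z, Cmod (z - p) < s -> h z = RtoC 0) ->
  forall z, 3 * Cmod (z - p) < r -> Cmod (z - p) < 1.4 * s -> h z = RtoC 0.
Proof.
  intros HU H0 z Hz Hzs. apply (vanish_square h z p).
  - intros w Hw. apply Hd, HU.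
    pose proof (Cmod_minus_triangle w z p). rewrite (Cmod_minus_sym p z) in Hw.
    pose proof (Cmod_ge_0 (z - p)). lra.
  - intros t Ht. apply H0.
    replace (z + (p - z) * (1, t) * RtoC (/ 2) - p)%C with ((z - p) * (1 / 2, - t / 2)%R)%C.
    2: { destruct z, p. unfold RtoC; apply injective_projections; simpl; field. }
    rewrite Cmod_mult.
    (* The side reaches distance at most sqrt 2 / 2 times |z - p| from [p], and 0.71 * 1.4 < 1
       leaves it in the disc of radius [s]. *)
    assert (Hm : Cmod (1 / 2, - t / 2)%R <= 0.71).
    { unfold Cmod; simpl. replace 0.71 with (sqrt (0.71 * 0.71)) by (apply sqrt_square; lra).
      apply sqrt_le_1_alt. nra. }
    pose proof (Cmod_ge_0 (z - p)). pose proof (Cmod_ge_0 (1 / 2, - t / 2)%R). nra.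
Qed.

Lemma vanish_disc_extend (p : C) (r s : R) : 0 < s ->
  (forall z, Cmod (z - p) < r -> U z) ->
  (forall z, Cmod (z - p) < s -> h z = RtoC 0) ->
  forall z, 3 * Cmod (z - p) < r -> h z = RtoC 0.
Proof.
  intros Hs HU H0.
  assert (H : forall n z, 3 * Cmod (z - p) < r -> Cmod (z - p) < s * 1.4 ^ n -> h z = RtoC 0).
  { induction n as [| n IH]; intros z Hz Hzs.
    - apply H0. simpl in Hzs. lra.
    - apply (vanish_disc_grow p r (Rmin (s * 1.4 ^ n) (r / 3))); auto.
      + intros w Hw. apply IH.
        * pose proof (Rlt_le_trans _ _ _ Hw (Rmin_r _ _)). lra.
        * exact (Rlt_le_trans _ _ _ Hw (Rmin_l _ _)).
      + unfold Rmin. pose proof (Cmod_ge_0 (z - p)). simpl in Hzs. destruct Rle_dec; lra. }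
  intros z Hz.
  destruct (Pow_x_infinity 1.4 ltac:(rewrite Rabs_pos_eq; lra) (Cmod (z - p) / s + 1)) as [n Hn].
  specialize (Hn n (le_n n)). rewrite Rabs_pos_eq in Hn by (apply pow_le; lra).
  apply (H n); auto.
  apply Rmult_lt_reg_l with (/ s); [apply Rinv_0_lt_compat; exact Hs |].
  replace (/ s * (s * 1.4 ^ n)) with (1.4 ^ n) by (field; lra).
  unfold Rdiv in Hn. rewrite Rmult_comm in Hn. lra.
Qed.

Lemma open_Cmod_intro (V : C -> Prop) :
  (forall z, V z -> exists r, 0 < r /\ forall w, Cmod (w - z) < r -> V w) ->
  @open C_UniformSpace V.
Proof.
  intros H z Hz. destruct (H z Hz) as (r & Hr & Hw).
  assert (H2 : 0 < sqrt 2) by (apply sqrt_lt_R0; lra).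
  exists (mkposreal (r / sqrt 2) (Rdiv_lt_0_compat _ _ Hr H2)).
  intros w Hb. apply Hw.
  apply C_NormedModule_mixin_compat2 in Hb. simpl in Hb.
  replace (sqrt 2 * (r / sqrt 2)) with r in Hb by (field; lra). exact Hb.
Qed.

Lemma open_Cmod_elim (V : C -> Prop) (z : C) : @open C_UniformSpace V -> V z ->
  exists r, 0 < r /\ forall w, Cmod (w - z) < r -> V w.
Proof.
  intros H Hz. destruct (H z Hz) as [r Hr]. exists (pos r). split; [apply cond_pos |].
  intros w Hw. apply Hr. apply C_NormedModule_mixin_compat1. exact Hw.
Qed.

(** Connectedness is applied to the interior [V] of the zero set and the interior [W] of the
    complement of [V], both open by construction. A point of [U] outside [W] has points of [V]
    arbitrarily near, and spreading zeros from one of these reaches it. *)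
Lemma identity_theorem (theta r : R) :
  @open C_UniformSpace U -> @connected C_UniformSpace U ->
  U (Ci * RtoC theta)%C -> 0 < r ->
  (forall s, Rabs (s - theta) < r -> h (Ci * RtoC s)%C = RtoC 0) ->
  forall z, U z -> h z = RtoC 0.
Proof.
  intros Uo Uc Ut Hr H0 z1 Hz1.
  set (V := fun z : C => exists s, 0 < s /\ forall w, Cmod (w - z) < s -> h w = RtoC 0).
  set (W := fun z : C => exists s, 0 < s /\ forall w, Cmod (w - z) < s -> ~ V w).
  assert (Vo : @open C_UniformSpace V).
  { apply open_Cmod_intro. intros z (s & Hs & H). exists (s / 2). split; [lra |].
    intros w Hw. exists (s / 2). split; [lra |]. intros x Hx. apply H.
    pose proof (Cmod_minus_triangle x w z). lra. }
  assert (Wo : @open C_UniformSpace W).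
  { apply open_Cmod_intro. intros z (s & Hs & H). exists (s / 2). split; [lra |].
    intros w Hw. exists (s / 2). split; [lra |]. intros x Hx. apply H.
    pose proof (Cmod_minus_triangle x w z). lra. }
  apply NNPP. intros Hnz.
  assert (Hcover : forall z, U z -> V z \/ W z).
  { intros z Hz. destruct (classic (W z)) as [Hw | Hw]; [right; exact Hw | left].
    destruct (open_Cmod_elim U z Uo Hz) as (rho & Hrho & HU).
    assert (Hp : exists p, Cmod (p - z) < rho / 10 /\ V p).
    { apply NNPP. intros Hn. apply Hw. exists (rho / 10). split; [lra |].
      intros w Hw' HV. apply Hn. exists w. auto. }
    destruct Hp as (p & Hp & s & Hs & Hps).
    (* The disc of radius 9 rho / 10 about [p] lies in [U]; a third of that radius exceeds rho / 5,
       which bounds the distance from [p] to every [w] within rho / 10 of [z]. *)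
    exists (rho / 10). split; [lra |]. intros w Hw'.
    apply (vanish_disc_extend p (rho * 9 / 10) s); auto.
    - intros x Hx. apply HU. pose proof (Cmod_minus_triangle x p z). lra.
    - pose proof (Cmod_minus_triangle w z p). rewrite (Cmod_minus_sym z p) in H. lra. }
  (* Every point near the axis is the center of a square with one side on the axis, possibly
     degenerate, so zeros on the axis fill a disc. *)
  assert (HV : V (Ci * RtoC theta)%C).
  { destruct (open_Cmod_elim U _ Uo Ut) as (rho & Hrho & HU).
    exists (Rmin (r / 4) (rho / 4)). split; [apply Rmin_pos; lra |].
    intros w Hw.
    pose proof (Rlt_le_trans _ _ _ Hw (Rmin_l _ _)) as Hw1.
    pose proof (Rlt_le_trans _ _ _ Hw (Rmin_r _ _)) as Hw2.
    destruct w as [x y].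
    pose proof (Rabs_fst_le_Cmod ((x, y) - Ci * RtoC theta)%C) as h1.
    pose proof (Rabs_snd_le_Cmod ((x, y) - Ci * RtoC theta)%C) as h2.
    simpl in h1, h2.
    replace (x + - (0 * theta - 1 * 0)) with x in h1 by ring.
    replace (y + - (0 * 0 + 1 * theta)) with (y - theta) in h2 by ring.
    apply (vanish_square h (x, y) (- x, y)).
    - intros v Hv. apply Hd, HU.
      assert (Hx2 : Cmod ((- x, y)%R - (x, y)) <= 2 * Rabs x).
      { eapply Rle_trans; [apply Cmod_le_Rabs |]. simpl.
        replace (- x + - x) with (- (2 * x)) by ring. replace (y + - y) with 0 by ring.
        rewrite Rabs_R0, Rabs_Ropp, Rabs_mult, (Rabs_pos_eq 2) by lra. lra. }
      pose proof (Cmod_minus_triangle v (x, y) (Ci * RtoC theta)). lra.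
    - intros t Ht.
      replace ((x, y) + ((- x, y)%R - (x, y)) * (1, t) * RtoC (/ 2))%C with (Ci * RtoC (y - x * t))%C
        by (unfold Ci, RtoC; apply injective_projections; simpl; field).
      apply H0. replace (y - x * t - theta) with ((y - theta) + (- (x * t))) by ring.
      eapply Rle_lt_trans; [apply Rabs_triang |]. rewrite Rabs_Ropp, Rabs_mult.
      assert (Rabs t <= 1) by (apply Rabs_le; lra).
      pose proof (Rabs_pos x). pose proof (Rabs_pos t). nra. }
  destruct (Hcover z1 Hz1) as [(s & Hs & Hv) | Hw].
  - apply Hnz, Hv. replace (z1 - z1)%C with (RtoC 0) by ring. rewrite Cmod_0. exact Hs.
  - destruct (Uc V W Vo Wo Hcover) as (z & _ & Hv & (s & Hs & Hn)).
    + eexists; split; [exact Ut | exact HV].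
    + exists z1; auto.
    + apply (Hn z); auto. replace (z - z)%C with (RtoC 0) by ring. rewrite Cmod_0. exact Hs.
Qed.

End Identity.

(** * Vector-valued integrals and weak differentiability *)

Lemma Riemann_sum_linear {V : NormedModule R_AbsRing} (L : V -> R) (f : R -> V) ptd :
  @is_linear R_AbsRing V R_NormedModule L ->
  L (Riemann_sum f ptd) = Riemann_sum (fun t => L (f t)) ptd.
Proof.
  intros HL.
  revert ptd. apply SF_cons_ind.
  - intros x0. apply (linear_zero L HL).
  - intros h s IH. rewrite !Riemann_sum_cons, (linear_plus L HL), (linear_scal L HL), IH.
    reflexivity.
Qed.

Lemma is_RInt_linear {V : NormedModule R_AbsRing} (L : V -> R) (f : R -> V) (a b : R) (v : V) :
  @is_linear R_AbsRing V R_NormedModule L ->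
  is_RInt f a b v -> is_RInt (fun t => L (f t)) a b (L v).
Proof.
  intros HL H. unfold is_RInt.
  apply filterlim_ext with (fun ptd => L (scal (sign (b - a)) (Riemann_sum f ptd))).
  - intros ptd. rewrite (linear_scal L HL), (Riemann_sum_linear L f ptd HL). reflexivity.
  - apply (filterlim_comp _ _ _ _ L _ _ _ H). apply (linear_cont L v HL).
Qed.

(** * Restriction of scalars from C to R, for integrals with values in X *)

Section RealStructure.
Context (X : CompleteNormedModule C_AbsRing).
Add Ring sq0_ring_rs : (@sq0_ring X).

Lemma restr_mixin_ax1 (a b : R) (x : X) :
  vscal (RtoC a) (vscal (RtoC b) x) = vscal (RtoC (a * b)) x.
Proof. vec. Qed.

Lemma restr_mixin_ax2 (x : X) : vscal (RtoC 1) x = x.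
Proof. vec. Qed.

Lemma restr_mixin_ax3 (a : R) (x y : X) :
  vscal (RtoC a) (vadd x y) = vadd (vscal (RtoC a) x) (vscal (RtoC a) y).
Proof. vec. Qed.

Lemma restr_mixin_ax4 (a b : R) (x : X) :
  vscal (RtoC (a + b)) x = vadd (vscal (RtoC a) x) (vscal (RtoC b) x).
Proof. vec. Qed.

Definition restr_ModuleSpace_mixin :
  ModuleSpace.mixin_of R_Ring (NormedModule.AbelianGroup C_AbsRing X) :=
  ModuleSpace.Mixin R_Ring (NormedModule.AbelianGroup C_AbsRing X)
    (fun (t : R) (x : X) => vscal (RtoC t) x)
    restr_mixin_ax1 restr_mixin_ax2 restr_mixin_ax3 restr_mixin_ax4.

Definition restr_NormedModuleAux_class : NormedModuleAux.class_of R_AbsRing X :=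
  NormedModuleAux.Class R_AbsRing X
    (ModuleSpace.Class R_Ring X (AbelianGroup.class (NormedModule.AbelianGroup C_AbsRing X))
      restr_ModuleSpace_mixin)
    (UniformSpace.class (NormedModule.UniformSpace C_AbsRing X)).

Definition restr_NormedModuleAux : NormedModuleAux R_AbsRing :=
  NormedModuleAux.Pack R_AbsRing X restr_NormedModuleAux_class X.

Lemma restr_norm_scal (l : R) (x : X) : norm (vscal (RtoC l) x) <= Rabs l * norm x.
Proof. rewrite <- Cmod_R. apply norm_scal_C. Qed.

Definition restr_NormedModule_mixin : NormedModule.mixin_of R_AbsRing restr_NormedModuleAux :=
  NormedModule.Mixin R_AbsRing restr_NormedModuleAux
    (fun x : X => norm x) (@norm_factor C_AbsRing X)
    (@norm_triangle C_AbsRing X) restr_norm_scal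
    (@norm_compat1 C_AbsRing X) (@norm_compat2 C_AbsRing X) (@norm_eq_zero C_AbsRing X).

Definition restr_CompleteNormedModule : CompleteNormedModule R_AbsRing :=
  CompleteNormedModule.Pack R_AbsRing X
    (CompleteNormedModule.Class R_AbsRing X
      (NormedModule.Class R_AbsRing X restr_NormedModuleAux_class restr_NormedModule_mixin)
      (CompleteNormedModule.mixin C_AbsRing X (CompleteNormedModule.class C_AbsRing X))) X.

Lemma restr_linear_fst (phi : X -> C) : in_dual X phi ->
  @is_linear R_AbsRing restr_CompleteNormedModule R_NormedModule (fun x => fst (phi x)).
Proof.
  intros H. split.
  - intros x y. exact (f_equal fst (dual_add phi x y H)).
  - intros t x. etransitivity; [exact (f_equal fst (dual_scal phi (RtoC t) x H)) |].
    change (t * fst (phi x) - 0 * snd (phi x) = t * fst (phi x)). ring.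
  - destruct (linear_norm _ H) as (M & HM & Hb). exists M. split; [exact HM |].
    intros x. exact (Rle_trans _ _ _ (Rabs_fst_le_Cmod (phi x)) (Hb x)).
Qed.

Lemma restr_linear_snd (phi : X -> C) : in_dual X phi ->
  @is_linear R_AbsRing restr_CompleteNormedModule R_NormedModule (fun x => snd (phi x)).
Proof.
  intros H. split.
  - intros x y. exact (f_equal snd (dual_add phi x y H)).
  - intros t x. etransitivity; [exact (f_equal snd (dual_scal phi (RtoC t) x H)) |].
    change (t * snd (phi x) + 0 * fst (phi x) = t * snd (phi x)). ring.
  - destruct (linear_norm _ H) as (M & HM & Hb). exists M. split; [exact HM |].
    intros x. exact (Rle_trans _ _ _ (Rabs_snd_le_Cmod (phi x)) (Hb x)).
Qed.

(** Completeness gives the integral over the real structure. Its values under functionals are all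
    that is recorded, since in a separable space [dual_separates] recovers every identity from
    them. *)
Lemma vector_integral (G : R -> X) :
  (forall t, 0 <= t <= 1 -> forall eps, 0 < eps -> exists del, 0 < del /\
    forall s, Rabs (s - t) < del -> norm (vsub (G s) (G t)) < eps) ->
  exists v : X, forall phi, in_dual X phi -> phi v = I01 (fun t => phi (G t)).
Proof.
  intros HG.
  assert (Hex : @ex_RInt restr_CompleteNormedModule G 0 1).
  { apply ex_RInt_continuous. rewrite Rmin_left, Rmax_right by lra. intros z Hz.
    apply (proj2 (@filterlim_locally_ball_norm R_AbsRing R restr_CompleteNormedModule (locally z) _ G (G z))).
    intros eps. destruct (HG z Hz eps (cond_pos eps)) as (d & Hd & H).
    exists (mkposreal d Hd). intros s Hs. exact (H s Hs). }
  destruct Hex as [v Hv]. exists v. intros phi Hphi. unfold I01.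
  apply injective_projections; simpl; symmetry.
  - exact (is_RInt_unique _ _ _ _ (@is_RInt_linear restr_CompleteNormedModule _ G 0 1 v (restr_linear_fst phi Hphi) Hv)).
  - exact (is_RInt_unique _ _ _ _ (@is_RInt_linear restr_CompleteNormedModule _ G 0 1 v (restr_linear_snd phi Hphi) Hv)).
Qed.

End RealStructure.

Lemma finite_prefix_bounded (a : nat -> R) (N : nat) :
  exists B, forall n, (n < N)%nat -> a n <= B.
Proof.
  induction N as [| N [B HB]].
  - exists 0. lia.
  - exists (Rmax B (a N)). intros n Hn. destruct (Nat.eq_dec n N) as [-> | Hne].
    + apply Rmax_r.
    + eapply Rle_trans; [apply HB; lia | apply Rmax_l].
Qed.

Section Strong.
Context {X : NormedModule C_AbsRing}.
Add Ring sq0_ring_st : (@sq0_ring X).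

(* The difference quotients of f at z are weakly bounded, hence bounded. *)
Lemma weakly_differentiable_continuous (Xsep : separable X) (f : C -> X) (z : C) :
  (forall phi, in_dual X phi -> Cdiff (fun w => phi (f w)) z) ->
  forall eps, 0 < eps -> exists del, 0 < del /\
    forall w, Cmod (w - z) < del -> norm (vsub (f w) (f z)) < eps.
Proof.
  intros Hf eps Heps. apply NNPP. intros Hno.
  assert (Hw : forall n : nat, exists w, Cmod (w - z) < / INR (S n) /\
    eps <= norm (vsub (f w) (f z))).
  { intros n. apply NNPP. intros H. apply Hno. exists (/ INR (S n)).
    split; [apply Rinv_0_lt_compat, lt_0_INR; lia |].
    intros w Hw. apply Rnot_le_lt. intros H1. apply H. exists w. auto. }
  apply functional_choice in Hw. destruct Hw as [w Hw].
  assert (Hn0 : forall n, (w n - z)%C <> RtoC 0).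
  { intros n E. destruct (Hw n) as [_ H]. assert (E' : w n = z).
    { replace (w n) with (w n - z + z)%C by ring. rewrite E. ring. }
    rewrite E' in H.
    replace (vsub (f z) (f z)) with (vzero : X) in H by vec.
    rewrite (@norm_zero C_AbsRing X) in H. lra. }
  destruct (weakly_bounded_bounded Xsep
    (fun n => vscal (/ (w n - z))%C (vsub (f (w n)) (f z)))) as [B HB].
  { intros phi Hphi. destruct (Hf phi Hphi) as [l Hl].
    destruct (Hl 1 Rlt_0_1) as (d & Hd & H).
    destruct (archimed_cor1 d Hd) as (N & HN & HN0).
    destruct (finite_prefix_bounded (fun n => Cmod (phi (vscal (/ (w n - z))%C (vsub (f (w n)) (f z))))) N)
      as [B0 HB0].
    exists (Rmax B0 (1 + Cmod l)). intros n.
    destruct (Nat.lt_ge_cases n N) as [Hn | Hn].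
    { eapply Rle_trans; [apply HB0; exact Hn | apply Rmax_l]. }
    eapply Rle_trans; [| apply Rmax_r].
    rewrite dual_scal, dual_sub by exact Hphi.
    assert (Hsm : Cmod (w n - z) < d).
    { eapply Rlt_trans; [apply Hw |]. eapply Rle_lt_trans; [| exact HN].
      apply Rinv_le_contravar; [apply lt_0_INR; lia | apply le_INR; lia]. }
    specialize (H (w n) Hsm).
    pose proof (Cmod_le_plus (phi (f (w n)) - phi (f z)) (l * (w n - z))) as h.
    rewrite Cmod_mult in h. rewrite Cmod_mult, Cmod_inv by apply Hn0.
    assert (Hp : 0 < Cmod (w n - z)) by (apply Cmod_gt_0, Hn0).
    apply Rmult_le_reg_l with (Cmod (w n - z)); [exact Hp |].
    rewrite <- Rmult_assoc, Rinv_r, Rmult_1_l by lra. lra. }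
  destruct (archimed_cor1 (eps / (Rabs B + 1))) as (N & HN & HN0).
  { apply Rdiv_lt_0_compat; [lra |]. pose proof (Rabs_pos B). lra. }
  destruct (Hw N) as [H1 H2]. specialize (HB N). simpl in HB.
  assert (H3 : vsub (f (w N)) (f z) =
    vscal (w N - z)%C (vscal (/ (w N - z))%C (vsub (f (w N)) (f z)))).
  { transitivity (vscal (RtoC 1) (vsub (f (w N)) (f z))); [vec |].
    replace (RtoC 1) with ((w N - z) * / (w N - z))%C by (field; apply Hn0). vec. }
  rewrite H3 in H2.
  pose proof (norm_scal_C (w N - z)%C (vscal (/ (w N - z))%C (vsub (f (w N)) (f z)))) as H4.
  pose proof (Rle_abs B). pose proof (Rabs_pos B).
  assert (H5 : Cmod (w N - z) < eps / (Rabs B + 1)).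
  { eapply Rlt_trans; [exact H1 |]. eapply Rle_lt_trans; [| exact HN].
    apply Rinv_le_contravar; [apply lt_0_INR; lia | apply le_INR; lia]. }
  apply (Rmult_lt_compat_r (Rabs B + 1)) in H5; [| lra].
  replace (eps / (Rabs B + 1) * (Rabs B + 1)) with eps in H5 by (field; lra).
  pose proof (Cmod_ge_0 (w N - z)).
  set (q := norm (vscal (/ (w N - z))%C (vsub (f (w N)) (f z)))) in *.
  assert (Cmod (w N - z) * q <= Cmod (w N - z) * (Rabs B + 1)) by (apply Rmult_le_compat_l; lra).
  lra.
Qed.

End Strong.

(** A mean value inequality for right derivatives, which are all that the generator provides. At the
    supremum of the good initial intervals the left condition carries the bound to the endpoint, and
    the right condition carries it past. *)
Lemma right_derivative_bound (r : R -> R) (eps b : R) :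
  0 < eps -> 0 <= b -> r 0 = 0 ->
  (forall t eta, 0 < t -> 0 < eta -> exists del, 0 < del /\
    forall s, 0 <= s -> t - del < s < t -> r t <= r s + eta) ->
  (forall t, 0 <= t -> exists del, 0 < del /\
    forall h, 0 <= h < del -> r (t + h) <= r t + eps * h) ->
  r b <= eps * b.
Proof.
  intros Heps Hb H0 Hleft Hright.
  destruct (completeness (fun c => 0 <= c <= b /\ forall s, 0 <= s <= c -> r s <= eps * s))
    as [c [Hc1 Hc2]].
  - exists b. intros c [Hc _]. lra.
  - exists 0. split; [lra |]. intros s Hs. replace s with 0 by lra. rewrite H0. lra.
  - assert (Hc0 : 0 <= c).
    { apply Hc1. split; [lra |]. intros s Hs. replace s with 0 by lra. rewrite H0. lra. }
    assert (Hcb : c <= b) by (apply Hc2; intros x [Hx _]; lra).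
    assert (Hlt : forall s, 0 <= s < c -> r s <= eps * s).
    { intros s Hs. apply NNPP. intros Hn.
      assert (c <= s); [| lra].
      apply Hc2. intros x [Hx Hxs]. apply Rnot_lt_le. intros Hsx. apply Hn, Hxs. lra. }
    assert (Hrc : r c <= eps * c).
    { destruct (Req_dec c 0) as [-> | Hcn]; [rewrite H0; lra |].
      apply le_epsilon. intros eta Heta.
      destruct (Hleft c eta) as (d & Hd & H); [lra | lra |].
      set (s := Rmax 0 (c - d / 2)).
      assert (Hs : 0 <= s < c) by (unfold s, Rmax; destruct Rle_dec; lra).
      assert (Hs2 : c - d < s) by (unfold s, Rmax; destruct Rle_dec; lra).
      specialize (H s (proj1 Hs) (conj Hs2 (proj2 Hs))).
      pose proof (Hlt s Hs). nra. }
    destruct (Rle_lt_or_eq_dec c b Hcb) as [Hltb | ->]; [| exact Hrc].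
    destruct (Hright c Hc0) as (d & Hd & H).
    set (c' := Rmin b (c + d / 2)).
    assert (Hc' : c < c' <= b) by (unfold c', Rmin; destruct Rle_dec; lra).
    assert (Hc'd : c' <= c + d / 2) by apply Rmin_r.
    assert (c' <= c); [| lra].
    apply Hc1. split; [lra |]. intros s Hs.
    destruct (Rlt_le_dec s c) as [h | h]; [apply Hlt; lra |].
    replace s with (c + (s - c)) by ring.
    eapply Rle_trans; [apply H; lra |]. lra.
Qed.

(** * Homoclinic orbits *)

Section Semigroup.
Context {X : NormedModule C_AbsRing} (T : R -> X -> X) (HT : C0_semigroup X T).
Add Ring sq0_ring_sg : (@sq0_ring X).

Lemma scal_continuous_pt (c : C) (v : X) (eps : R) : 0 < eps ->
  exists rho, 0 < rho /\ forall c' v', Cmod (c' - c) <= rho -> norm (vsub v' v) <= rho ->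
    norm (vsub (vscal c' v') (vscal c v)) < eps.
Proof.
  intros Heps. set (L := Cmod c + 1 + norm v).
  assert (Hc : 0 <= Cmod c) by apply Cmod_ge_0.
  assert (Hv : 0 <= norm v) by apply (@norm_ge_0 C_AbsRing X).
  assert (HL : 0 < L) by (unfold L; lra).
  exists (Rmin 1 (eps / (2 * L))).
  assert (He : 0 < eps / (2 * L)) by (apply Rdiv_lt_0_compat; lra).
  split; [apply Rmin_pos; lra |]. intros c' v' H1 H2.
  set (rho := Rmin 1 (eps / (2 * L))) in *.
  assert (Hr1 : rho <= 1) by apply Rmin_l.
  assert (Hr2 : rho <= eps / (2 * L)) by apply Rmin_r.
  assert (Hr0 : 0 < rho) by (apply Rmin_pos; lra).
  replace (vsub (vscal c' v') (vscal c v)) with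
    (vadd (vscal c' (vsub v' v)) (vscal (c' - c)%C v)) by vec.
  eapply Rle_lt_trans; [apply (@norm_triangle C_AbsRing X) |].
  pose proof (norm_scal_C c' (vsub v' v)) as h1. pose proof (norm_scal_C (c' - c)%C v) as h2.
  pose proof (Cmod_le_plus c' c) as h3. pose proof (Cmod_ge_0 c').
  pose proof (@norm_ge_0 C_AbsRing X (vsub v' v)).
  assert (h4 : Cmod c' * norm (vsub v' v) <= (Cmod c + 1) * rho).
  { apply Rmult_le_compat; lra. }
  assert (h5 : Cmod (c' - c) * norm v <= rho * norm v) by (apply Rmult_le_compat_r; lra).
  assert (h6 : rho * L <= eps / (2 * L) * L) by (apply Rmult_le_compat_r; lra).
  replace (eps / (2 * L) * L) with (eps / 2) in h6 by (field; lra).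
  unfold L in h6. lra.
Qed.

Lemma sg_add (t : R) (x y : X) : 0 <= t -> T t (vadd x y) = vadd (T t x) (T t y).
Proof. intros Ht. exact (linear_plus _ (C0_bounded_linear HT Ht) x y). Qed.

Lemma sg_scal (t : R) (c : C) (x : X) : 0 <= t -> T t (vscal c x) = vscal c (T t x).
Proof. intros Ht. exact (linear_scal _ (C0_bounded_linear HT Ht) c x). Qed.

Lemma sg_sub (t : R) (x y : X) : 0 <= t -> T t (vsub x y) = vsub (T t x) (T t y).
Proof.
  intros Ht. replace (vsub x y) with (vadd x (vscal (- (1))%C y)) by vec.
  rewrite sg_add, sg_scal by exact Ht. vec.
Qed.

Lemma sg_continuous (x : X) (t eps : R) : 0 <= t -> 0 < eps -> exists del, 0 < del /\
  forall s, 0 <= s -> Rabs (s - t) < del -> norm (vsub (T s x) (T t x)) < eps.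
Proof.
  intros Ht Heps. pose proof (C0_continuous HT x Ht) as H.
  destruct (proj1 (@filterlim_locally_ball_norm C_AbsRing R X _ _ (fun s => T s x) (T t x)) H
    (mkposreal eps Heps)) as [d Hd].
  exists (pos d). split; [apply cond_pos |]. intros s Hs Hst. exact (Hd s Hst Hs).
Qed.

Lemma generator_bound (x y : X) (eps : R) : generator X T x y -> 0 < eps ->
  exists del, 0 < del /\ forall h, 0 < h < del ->
    norm (vsub (vsub (T h x) x) (vscal (RtoC h) y)) <= eps * h.
Proof.
  intros H Heps.
  destruct (proj1 (@filterlim_locally_ball_norm C_AbsRing R X _ _ _ y) H
    (mkposreal eps Heps)) as [d Hd].
  exists (pos d). split; [apply cond_pos |]. intros h Hh.
  assert (Hb : ball 0 d h).
  { change (Rabs (h - 0) < d). rewrite Rminus_0_r, Rabs_pos_eq; lra. }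
  specialize (Hd h Hb (proj1 Hh)). unfold ball_norm in Hd. simpl in Hd.
  set (w := vscal (RtoC (/ h)) (vsub (T h x) x)).
  change (norm (vsub w y) < eps) in Hd.
  replace (vsub (T h x) x) with (vscal (RtoC h) w).
  - replace (vsub (vscal (RtoC h) w) (vscal (RtoC h) y)) with (vscal (RtoC h) (vsub w y)) by vec.
    eapply Rle_trans; [apply norm_scal_pos; lra |]. nra.
  - unfold w. transitivity (vscal (RtoC h * RtoC (/ h))%C (vsub (T h x) x)); [vec |].
    rewrite <- RtoC_mult, Rinv_r by lra. vec.
Qed.

(* The function t |-> e^(-t l) T_t x has right derivative zero. *)
Lemma eigen_orbit (l : C) (x : X) (b : R) : ker_shift X T l x -> 0 <= b ->
  T b x = vscal (cexp (RtoC b * l)) x.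
Proof.
  intros (y & Hgen & Hy) Hb.
  assert (Ey : y = vscal l x).
  { replace y with (vsub (vscal l x) (vsub (vscal l x) y)) by vec.
    change (vsub (vscal l x) y = vzero) in Hy. rewrite Hy. vec. }
  subst y. clear Hy.
  (* The summand 0 gives the exponent the affine shape on which [Rcont_line] works. *)
  set (e := fun t : R => cexp (0 + RtoC t * (- l))).
  set (g := fun t : R => vscal (e t) (T t x)).
  assert (Hg : g b = x).
  { apply minus_norm_eq_0. apply le_epsilon. intros eta Heta.
    assert (He : 0 < eta / (b + 1)) by (apply Rdiv_lt_0_compat; lra).
    set (eps := eta / (b + 1)) in *.
    apply Rle_trans with (eps * b).
    2: { replace (0 + eta) with (eps * (b + 1)) by (unfold eps; field; lra). lra. }
    apply (right_derivative_bound (fun t => norm (vsub (g t) x))); auto.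
    - unfold g, e. rewrite (C0_zero HT).
      replace (0 + RtoC 0 * - l)%C with (RtoC 0) by ring. rewrite cexp_0.
      replace (vsub (vscal (RtoC 1) x) x) with (vzero : X) by vec. apply (@norm_zero C_AbsRing X).
    - intros t et Ht Het.
      destruct (scal_continuous_pt (e t) (T t x) et Het) as (rho & Hrho & H).
      destruct (Rcont_line cexp 0 (- l) t (Cdiff_Ccont _ _ (Cdiff_cexp _)) rho Hrho) as (d1 & Hd1 & H1).
      destruct (sg_continuous x t rho ltac:(lra) Hrho) as (d2 & Hd2 & H2).
      exists (Rmin d1 d2). split; [apply Rmin_pos; lra |]. intros s Hs Hst.
      assert (Habs : Rabs (s - t) < Rmin d1 d2) by (rewrite Rabs_left; lra).
      assert (Hgs : norm (vsub (g s) (g t)) < et).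
      { apply H; [apply H1 | left; apply H2; auto];
          eapply Rlt_le_trans; eauto using Rmin_l, Rmin_r. }
      pose proof (norm_minus_triangle (g t) (g s) x) as h.
      rewrite (norm_minus_sym (g t) (g s)) in h. lra.
    - intros t Ht.
      destruct (linear_norm _ (C0_bounded_linear HT Ht)) as (M & HM & HMb).
      set (K := (Cmod (e t) + 1) * M).
      pose proof (Cmod_ge_0 (e t)) as Het. pose proof (Cmod_ge_0 l) as Hlp.
      pose proof (@norm_ge_0 C_AbsRing X x) as Hxp.
      assert (HK : 0 < K) by (unfold K; nra).
      set (L := (1 + Cmod l) * (1 + norm x)).
      assert (HL : 0 < L) by (unfold L; nra).
      destruct (generator_bound x (vscal l x) (eps / (2 * K)) Hgen) as (d1 & Hd1 & H1);
        [apply Rdiv_lt_0_compat; lra |].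
      destruct (cexp_diff_0 (eps / (2 * K * L))) as (d2 & Hd2 & H2);
        [apply Rdiv_lt_0_compat; nra |].
      destruct (Rcont_line cexp 0 (- l) t (Cdiff_Ccont _ _ (Cdiff_cexp _)) 1 Rlt_0_1) as (d3 & Hd3 & H3).
      exists (Rmin (Rmin d1 d3) (d2 / (1 + Cmod l))).
      split; [repeat apply Rmin_pos; try lra; apply Rdiv_lt_0_compat; lra |].
      intros h [Hh0 Hh].
      destruct (Rle_lt_or_eq_dec 0 h Hh0) as [Hhp | <-]; [| rewrite Rplus_0_r; lra].
      assert (Hh13 : h < Rmin d1 d3) by (eapply Rlt_le_trans; [exact Hh | apply Rmin_l]).
      assert (Hh1 : h < d1) by (eapply Rlt_le_trans; [exact Hh13 | apply Rmin_l]).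
      assert (Hh3 : h < d3) by (eapply Rlt_le_trans; [exact Hh13 | apply Rmin_r]).
      assert (Hh2 : h * (1 + Cmod l) < d2).
      { apply Rlt_le_trans with (d2 / (1 + Cmod l) * (1 + Cmod l)).
        - apply Rmult_lt_compat_r; [lra |]. eapply Rlt_le_trans; [exact Hh | apply Rmin_r].
        - right; field; lra. }
      assert (Hhl : Cmod (RtoC h * l) = h * Cmod l)
        by (rewrite Cmod_mult, Cmod_R, Rabs_pos_eq by lra; reflexivity).
      specialize (H1 h (conj Hhp Hh1)).
      specialize (H2 (RtoC h * l)%C ltac:(rewrite Hhl; nra)). rewrite Hhl in H2.
      specialize (H3 (t + h) ltac:(replace (t + h - t) with h by ring; rewrite Rabs_pos_eq; lra)).
      fold (e t) (e (t + h)) in H3.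
      assert (Heb : Cmod (e (t + h)) <= Cmod (e t) + 1).
      { pose proof (Cmod_le_plus (e (t + h)) (e t)). lra. }
      (* The increment at [t] is the image under T_t of one at time 0, where the generator and the
         exponential have the same linear part; the factors in front are absorbed by [K]. *)
      assert (Hdec : vsub (g (t + h)) (g t) =
        vscal (e (t + h)%R) (T t (vsub (T h x) (vscal (cexp (RtoC h * l)) x)))).
      { unfold g. rewrite sg_sub, sg_scal, (C0_add HT) by lra.
        replace (e t) with (e (t + h)%R * cexp (RtoC h * l))%C.
        - vec.
        - unfold e. rewrite <- cexp_plus. f_equal. rewrite RtoC_plus. ring. }
      set (w := vsub (T h x) (vscal (cexp (RtoC h * l)) x)) in *.
      assert (Hw : norm w <= eps / K * h).
      { replace w with (vsub (vsub (vsub (T h x) x) (vscal (RtoC h) (vscal l x)))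
          (vscal (cexp (RtoC h * l) - 1 - RtoC h * l)%C x)) by (unfold w; vec).
        eapply Rle_trans; [apply norm_minus_le |].
        pose proof (norm_scal_C (cexp (RtoC h * l) - 1 - RtoC h * l)%C x) as h4.
        assert (h5 : Cmod (cexp (RtoC h * l) - 1 - RtoC h * l) * norm x
          <= eps / (2 * K * L) * (h * Cmod l) * norm x) by (apply Rmult_le_compat_r; lra).
        assert (h6 : eps / (2 * K * L) * (h * Cmod l) * norm x <= eps / (2 * K * L) * h * L).
        { assert (h9 : Cmod l * norm x <= L) by (unfold L; nra).
          assert (0 < eps / (2 * K * L)) by (apply Rdiv_lt_0_compat; nra).
          replace (eps / (2 * K * L) * (h * Cmod l) * norm x) with
            (eps / (2 * K * L) * h * (Cmod l * norm x)) by ring.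
          apply Rmult_le_compat_l; [nra | exact h9]. }
        replace (eps / (2 * K * L) * h * L) with (eps / (2 * K) * h) in h6 by (field; lra).
        replace (eps / K * h) with (eps / (2 * K) * h + eps / (2 * K) * h) by (field; lra). lra. }
      assert (Hfin : norm (vsub (g (t + h)) (g t)) <= eps * h).
      { rewrite Hdec. eapply Rle_trans; [apply norm_scal_C |].
        assert (h7 : norm (T t w) <= M * (eps / K * h)).
        { eapply Rle_trans; [exact (HMb w) |]. apply Rmult_le_compat_l; lra. }
        assert (h8 : Cmod (e (t + h)) * norm (T t w) <= (Cmod (e t) + 1) * (M * (eps / K * h))).
        { apply Rmult_le_compat; auto using Cmod_ge_0. apply (@norm_ge_0 C_AbsRing X). }
        eapply Rle_trans; [exact h8 |]. right.
        replace ((Cmod (e t) + 1) * (M * (eps / K * h))) with (K * (eps / K * h)) by (unfold K; ring).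
        field. lra. }
      pose proof (norm_minus_triangle (g (t + h)) (g t) x). lra. }
  transitivity (vscal (cexp (RtoC b * l)) (g b)); [| rewrite Hg; reflexivity].
  unfold g. transitivity (vscal (cexp (RtoC b * l) * e b)%C (T b x)); [| vec].
  unfold e. rewrite <- cexp_plus. replace (RtoC b * l + (0 + RtoC b * - l))%C with (RtoC 0) by ring.
  rewrite cexp_0. vec.
Qed.

Definition homoclinic (m : R) (eta : R -> X) : Prop :=
  (forall s t, 0 <= s -> T s (eta t) = eta (s + t)) /\
  (forall t, norm (eta t) <= m / (1 + t * t)).

Lemma homoclinic_zero (m : R) : 0 <= m -> homoclinic m (fun _ => (vzero : X)).
Proof.
  intros Hm. split.
  - intros s t Hs. replace (vzero : X) with (vscal (RtoC 0) (vzero : X)) at 1 by vec.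
    rewrite sg_scal by exact Hs. vec.
  - intros t. rewrite (@norm_zero C_AbsRing X). apply Rmult_le_pos; [exact Hm |].
    left. apply Rinv_0_lt_compat. nra.
Qed.

Lemma homoclinic_add (m m' : R) (eta eta' : R -> X) :
  homoclinic m eta -> homoclinic m' eta' ->
  homoclinic (m + m') (fun t => vadd (eta t) (eta' t)).
Proof.
  intros [H1 H2] [H1' H2']. split.
  - intros s t Hs. rewrite sg_add, H1, H1' by exact Hs. reflexivity.
  - intros t. eapply Rle_trans; [apply (@norm_triangle C_AbsRing X) |].
    specialize (H2 t). specialize (H2' t).
    replace ((m + m') / (1 + t * t)) with (m / (1 + t * t) + m' / (1 + t * t)) by (field; nra). lra.
Qed.

Lemma homoclinic_scal (c : C) (m : R) (eta : R -> X) :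
  homoclinic m eta -> homoclinic (Cmod c * m) (fun t => vscal c (eta t)).
Proof.
  intros [H1 H2]. split.
  - intros s t Hs. rewrite sg_scal, H1 by exact Hs. reflexivity.
  - intros t. eapply Rle_trans; [apply norm_scal_C |].
    replace (Cmod c * m / (1 + t * t)) with (Cmod c * (m / (1 + t * t))) by (field; nra).
    apply Rmult_le_compat_l; [apply Cmod_ge_0 | apply H2].
Qed.

Lemma homoclinic_mono (m m' : R) (eta : R -> X) :
  m <= m' -> homoclinic m eta -> homoclinic m' eta.
Proof.
  intros Hm [H1 H2]. split; [exact H1 |]. intros t. eapply Rle_trans; [apply H2 |].
  apply Rmult_le_compat_r; [left; apply Rinv_0_lt_compat; nra | exact Hm].
Qed.

End Semigroup.

(** * Homoclinic orbits from arcs of eigenvectors *)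

Lemma convex_disc (m : C) (d : R) : convexC (fun z => Cmod (z - m) <= d).
Proof.
  intros a b t Ha Hb Ht.
  replace (a + t * (b - a) - m)%C with (RtoC (1 - t) * (a - m) + RtoC t * (b - m))%C
    by (rewrite RtoC_minus; ring).
  eapply Rle_trans; [apply Cmod_triangle |].
  rewrite !Cmod_mult, !Cmod_R, !Rabs_pos_eq by lra. nra.
Qed.

Lemma closed_disc (m p : C) (d : R) :
  (forall eps, 0 < eps -> exists z, Cmod (z - m) <= d /\ Cmod (z - p) < eps) ->
  Cmod (p - m) <= d.
Proof.
  intros H. apply le_epsilon. intros eps Heps. destruct (H eps Heps) as (z & Hz & Hzp).
  pose proof (Cmod_minus_triangle p z m). rewrite (Cmod_minus_sym p z) in *. lra.
Qed.

(** With v = |t| d u one has t^2 u^2 = v^2 / d^2, and v^2 e^(-v) never exceeds 4. The factor u^2 is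
    thus what makes the decay in [t] uniform in [u] down to 0. *)
Lemma corner_decay (d t u : R) : 0 < d -> 0 <= u <= 1 ->
  u * u * exp (- (Rabs t * d * u)) <= (1 + 4 / (d * d)) / (1 + t * t).
Proof.
  intros Hd Hu. set (v := Rabs t * d * u).
  assert (Hv : 0 <= v) by (unfold v; pose proof (Rabs_pos t); assert (0 <= Rabs t * d) by nra; nra).
  assert (H1 : exp (- v) <= 1).
  { rewrite <- exp_0. destruct Hv as [Hv | <-]; [left; apply exp_increasing; lra | rewrite Ropp_0; lra]. }
  assert (H2 : v * v * exp (- v) <= 4).
  { assert (H : 1 + v / 2 <= exp (v / 2)) by apply exp_ineq1_le.
    assert (Hvv : v * v <= 4 * exp v).
    { replace v with (v / 2 + v / 2) at 3 by field. rewrite exp_plus. nra. }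
    apply (Rmult_le_compat_r (exp (- v))) in Hvv; [| left; apply exp_pos].
    assert (E : exp v * exp (- v) = 1).
    { rewrite <- exp_plus. replace (v + - v) with 0 by ring. apply exp_0. }
    rewrite (Rmult_assoc 4), E in Hvv. lra. }
  pose proof (exp_pos (- v)) as H3.
  apply Rmult_le_reg_r with (1 + t * t); [nra |].
  replace ((1 + 4 / (d * d)) / (1 + t * t) * (1 + t * t)) with (1 + 4 / (d * d)) by (field; nra).
  assert (Et : t * t * (u * u) = v * v / (d * d)).
  { unfold v. rewrite <- (Rabs_pos_eq (t * t)) by nra. rewrite Rabs_mult. field. lra. }
  replace (u * u * exp (- v) * (1 + t * t)) with
    (u * u * exp (- v) + t * t * (u * u) * exp (- v)) by ring.
  rewrite Et.
  apply Rplus_le_compat.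
  - nra.
  - replace (v * v / (d * d) * exp (- v)) with (v * v * exp (- v) * / (d * d)) by (field; lra).
    apply Rmult_le_compat_r; [left; apply Rinv_0_lt_compat; nra | exact H2].
Qed.

Lemma dual_comp_linear {X : NormedModule C_AbsRing} (phi : X -> C) (L : X -> X) :
  in_dual X phi -> is_linear L -> in_dual X (fun x => phi (L x)).
Proof. intros Hphi HL. exact (is_linear_comp L phi HL Hphi). Qed.

Section Density.
Context {X : CompleteNormedModule C_AbsRing} (T : R -> X -> X) (HT : C0_semigroup X T).
Context (Xsep : separable X).
Add Ring sq0_ring_de : (@sq0_ring X).

(* The orbit eta(t) is the integral of ((z - a)(z - b))^2 e^(tz) f(z) along the
   segment of the imaginary axis with ends a = i (mu - d), b = i (mu + d).  By
   Goursat the path may be moved to the left for t >= 0, to the right for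
   t <= 0; the double zeros at the ends give the decay. *)
Lemma homoclinic_arc (f : C -> X) (mu d M : R) : 0 < d ->
  (forall phi, in_dual X phi -> forall z, Cmod (z - Ci * RtoC mu) <= d ->
    Cdiff (fun w => phi (f w)) z) ->
  (forall z t, Cmod (z - Ci * RtoC mu) <= d -> 0 <= t ->
    T t (f z) = vscal (cexp (RtoC t * z)) (f z)) ->
  (forall z, Cmod (z - Ci * RtoC mu) <= d -> norm (f z) <= M) ->
  exists m eta, homoclinic T m eta /\
    forall phi, in_dual X phi -> phi (eta 0) =
      I01 (fun s => RtoC (16 * d ^ 4 * (s * (1 - s)) ^ 2) *
        phi (f (Ci * RtoC (mu - d + 2 * d * s))))%C.
Proof.
  intros Hd Hhol Heig HM.
  set (D := fun z : C => Cmod (z - Ci * RtoC mu) <= d).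
  assert (HDc : convexC D) by apply convex_disc.
  assert (HDcl : forall p, (forall eps, 0 < eps -> exists z, D z /\ Cmod (z - p) < eps) -> D p)
    by (intros p; apply closed_disc).
  set (a := (Ci * RtoC (mu - d))%C). set (b := (Ci * RtoC (mu + d))%C).
  assert (HDx : forall c, Cmod c <= d -> D (Ci * RtoC mu + c)%C).
  { intros c Hc. unfold D. replace (Ci * mu + c - Ci * mu)%C with c by ring. exact Hc. }
  assert (HCid : Cmod (Ci * RtoC d) = d) by (rewrite Cmod_mult, Cmod_Ci, Cmod_R, Rabs_pos_eq; lra).
  assert (Da : D a).
  { replace a with (Ci * mu + - (Ci * d))%C by (unfold a; rewrite RtoC_minus; ring).
    apply HDx. rewrite Cmod_opp, HCid. lra. }
  assert (Db : D b).
  { replace b with (Ci * mu + Ci * d)%C by (unfold b; rewrite RtoC_plus; ring).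
    apply HDx. rewrite HCid. lra. }
  set (q := fun z : C => ((- a + 1 * z) * (- b + 1 * z))%C).
  set (w := fun (t : R) (z : C) => (q z * q z * cexp (0 + RtoC t * z))%C).
  assert (Hwd : forall t z, Cdiff (w t) z).
  { intros t z. apply (Cdiff_mult (fun z => q z * q z)%C (fun z => cexp (0 + RtoC t * z))).
    - apply Cdiff_mult; apply Cdiff_mult; apply Cdiff_affine.
    - apply Cdiff_comp_affine, Cdiff_cexp. }
  set (gam := fun s : R => (a + RtoC s * (b - a))%C).
  assert (Dgam : forall s, 0 <= s <= 1 -> D (gam s)) by (intros; apply HDc; auto).
  assert (HG : forall t, exists v : X, forall phi, in_dual X phi ->
    phi v = I01 (fun s => phi (vscal (w t (gam s)) (f (gam s))))).
  { intros t. apply (vector_integral X). intros s Hs eps Heps.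
    destruct (scal_continuous_pt (w t (gam s)) (f (gam s)) eps Heps) as (rho & Hrho & H).
    destruct (Rcont_line (w t) a (b - a) s (Cdiff_Ccont _ _ (Hwd _ _)) rho Hrho) as (d1 & Hd1 & H1).
    destruct (weakly_differentiable_continuous Xsep f (gam s)
      (fun phi Hphi => Hhol phi Hphi _ (Dgam s Hs)) rho Hrho) as (d2 & Hd2 & H2).
    pose proof (Cmod_ge_0 (b - a)) as Hba.
    exists (Rmin d1 (d2 / (1 + Cmod (b - a)))).
    split; [apply Rmin_pos; [lra | apply Rdiv_lt_0_compat; lra] |]. intros s' Hs'.
    apply H.
    - apply H1. eapply Rlt_le_trans; [exact Hs' | apply Rmin_l].
    - left. apply H2. unfold gam.
      replace (a + s' * (b - a) - (a + s * (b - a)))%C with (RtoC (s' - s) * (b - a))%C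
        by (rewrite RtoC_minus; ring).
      rewrite Cmod_mult, Cmod_R.
      assert (Hs2 : Rabs (s' - s) < d2 / (1 + Cmod (b - a)))
        by (eapply Rlt_le_trans; [exact Hs' | apply Rmin_r]).
      apply (Rmult_lt_compat_r (1 + Cmod (b - a))) in Hs2; [| lra].
      replace (d2 / (1 + Cmod (b - a)) * (1 + Cmod (b - a))) with d2 in Hs2 by (field; lra).
      pose proof (Rabs_pos (s' - s)). nra. }
  apply functional_choice in HG. destruct HG as [eta Heta].
  assert (Hphi_eta : forall t phi, in_dual X phi ->
    phi (eta t) = I01 (fun s => w t (gam s) * phi (f (gam s)))%C).
  { intros t phi Hphi. rewrite (Heta t phi Hphi). apply I01_ext. intros s _.
    apply dual_scal, Hphi. }
  (* On the moved path the weight is at most (4 d^2 u)^2 and the functional at most 2 M, whence 32 M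
     d^4. The factor 4 below is the bound 8 d for the two sides divided by |b - a| = 2 d. *)
  set (K0 := 32 * M * d ^ 4 * (1 + 4 / (d * d))).
  assert (HM0 : 0 <= M).
  { eapply Rle_trans; [apply (@norm_ge_0 C_AbsRing X (f a)) | apply HM, Da]. }
  exists (4 * K0), eta. split; [split |].
  - intros s t Hs. apply (dual_separates Xsep). intros phi Hphi.
    rewrite (Hphi_eta (s + t) phi Hphi).
    (* The composite of [phi] with T_s is again a functional, so T_s passes under the integral and
       meets the eigenvector there. *)
    rewrite (Hphi_eta t _ (dual_comp_linear phi (T s) Hphi (C0_bounded_linear HT Hs))).
    apply I01_ext. intros u Hu. rewrite (Heig _ s (Dgam u Hu) Hs), dual_scal by exact Hphi.
    unfold w. replace (0 + RtoC (s + t) * gam u)%C with (RtoC s * gam u + (0 + RtoC t * gam u))%C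
      by (rewrite RtoC_plus; ring).
    rewrite (cexp_plus (RtoC s * gam u)%C). ring.
  - intros t.
    destruct (norming_functional Xsep (eta t)) as (phi & Hphi & Hphib & Hn).
    set (F := fun z => (w t z * phi (f z))%C).
    assert (HFd : forall z, D z -> Cdiff F z).
    { intros z Hz. apply Cdiff_mult; [apply Hwd | apply Hhol; assumption]. }
    assert (HFc : forall z, D z -> Ccont F z) by (intros; apply Cdiff_Ccont; auto).
    (* The path through [c] bulges to the side where the real part of t z is negative; at parameter
       [u] from either end that real part is - |t| d u. *)
    set (sg := if Rle_dec 0 t then -1 else 1).
    assert (Hsg : sg * t = - Rabs t).
    { unfold sg. destruct Rle_dec; [rewrite Rabs_pos_eq by lra | rewrite Rabs_left by lra]; ring. }
    assert (Hsg1 : Rabs sg = 1).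
    { unfold sg. destruct Rle_dec; [rewrite Rabs_left; lra | apply Rabs_R1]. }
    set (c := (Ci * RtoC mu + RtoC (sg * d))%C).
    assert (Dc : D c).
    { apply HDx. rewrite Cmod_R, Rabs_mult, Hsg1, Rabs_pos_eq; lra. }
    set (bnd := K0 / (1 + t * t)).
    assert (Hcorner : forall z u, D z -> 0 <= u <= 1 -> fst z = sg * d * u ->
      Cmod (z - a) * Cmod (z - b) <= 2 * d * u * (2 * d) -> Cmod (F z) <= bnd).
    { intros z u Dz Hu Hz Hab. unfold F, w. rewrite !Cmod_mult, Cmod_cexp.
      assert (Hq : Cmod (q z) <= 4 * d * d * u).
      { unfold q. replace (- a + 1 * z)%C with (z - a)%C by ring.
        replace (- b + 1 * z)%C with (z - b)%C by ring. rewrite Cmod_mult. lra. }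
      assert (Ee : fst (0 + RtoC t * z)%C = - (Rabs t * d * u)).
      { destruct z as [x y]. simpl in *. rewrite Hz. transitivity ((sg * t) * d * u); [ring |].
        rewrite Hsg. ring. }
      rewrite Ee.
      assert (Hf : Cmod (phi (f z)) <= 2 * M).
      { eapply Rle_trans; [apply Hphib |]. pose proof (HM z Dz). lra. }
      pose proof (corner_decay d t u Hd Hu) as Hcd.
      pose proof (Cmod_ge_0 (q z)). pose proof (exp_pos (- (Rabs t * d * u))).
      assert (Hqq : Cmod (q z) * Cmod (q z) <= (4 * d * d * u) * (4 * d * d * u))
        by (apply Rmult_le_compat; auto).
      apply Rle_trans with ((4 * d * d * u) * (4 * d * d * u) * exp (- (Rabs t * d * u)) * (2 * M)).
      - apply Rmult_le_compat; auto using Cmod_ge_0.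
        + apply Rmult_le_pos; [nra | lra].
        + apply Rmult_le_compat_r; [lra | exact Hqq].
      - replace ((4 * d * d * u) * (4 * d * d * u) * exp (- (Rabs t * d * u)) * (2 * M))
          with (32 * M * d ^ 4 * (u * u * exp (- (Rabs t * d * u)))) by ring.
        replace bnd with (32 * M * d ^ 4 * ((1 + 4 / (d * d)) / (1 + t * t)))
          by (unfold bnd, K0; field; split; nra).
        apply Rmult_le_compat_l; [| exact Hcd].
        apply Rmult_le_pos; [lra | apply pow_le; lra]. }
    assert (HT0 : tri F a b c = RtoC 0) by (apply (goursat D); auto).
    assert (Hac : forall s, 0 <= s <= 1 -> Cmod (F (a + RtoC s * (c - a))%C) <= bnd).
    { intros s Hs. apply (Hcorner _ s).
      - apply HDc; auto.
      - exact Hs.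
      - unfold a, c; simpl. ring.
      - assert (E1 : (a + s * (c - a) - a)%C = (s * (sg * d), s * d)%R)
          by (unfold a, c, Ci, RtoC; apply injective_projections; simpl; ring).
        assert (E2 : (a + s * (c - a) - b)%C = (s * (sg * d), s * d - 2 * d)%R)
          by (unfold a, b, c, Ci, RtoC; apply injective_projections; simpl; ring).
        rewrite E1, E2. apply Rmult_le_compat; try apply Cmod_ge_0.
        + eapply Rle_trans; [apply Cmod_le_Rabs |]. simpl.
          rewrite !Rabs_mult, Hsg1, !(Rabs_pos_eq s), !(Rabs_pos_eq d) by lra. lra.
        + eapply Rle_trans; [apply Cmod_le_Rabs |]. simpl.
          rewrite !Rabs_mult, Hsg1, !(Rabs_pos_eq s), !(Rabs_pos_eq d) by lra.
          rewrite Rabs_left1 by nra. lra. }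
    assert (Hcb : forall s, 0 <= s <= 1 -> Cmod (F (b + RtoC s * (c - b))%C) <= bnd).
    { intros s Hs. apply (Hcorner _ s).
      - apply HDc; auto.
      - exact Hs.
      - unfold b, c; simpl. ring.
      - assert (E1 : (b + s * (c - b) - b)%C = (s * (sg * d), - (s * d))%R)
          by (unfold b, c, Ci, RtoC; apply injective_projections; simpl; ring).
        assert (E2 : (b + s * (c - b) - a)%C = (s * (sg * d), 2 * d - s * d)%R)
          by (unfold a, b, c, Ci, RtoC; apply injective_projections; simpl; ring).
        rewrite E1, E2, Rmult_comm. apply Rmult_le_compat; try apply Cmod_ge_0.
        + eapply Rle_trans; [apply Cmod_le_Rabs |]. simpl.
          rewrite Rabs_Ropp, !Rabs_mult, Hsg1, !(Rabs_pos_eq s), !(Rabs_pos_eq d) by lra. lra.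
        + eapply Rle_trans; [apply Cmod_le_Rabs |]. simpl.
          rewrite !Rabs_mult, Hsg1, !(Rabs_pos_eq s), !(Rabs_pos_eq d) by lra.
          rewrite Rabs_pos_eq by nra. lra. }
    pose proof (seg_bound D F a c bnd HDc HFc Da Dc Hac) as S1.
    pose proof (seg_bound D F b c bnd HDc HFc Db Dc Hcb) as S2.
    assert (Eca : Cmod (c - a) <= 2 * d).
    { replace (c - a)%C with ((sg * d, d)%R : C)
        by (unfold a, c, Ci, RtoC; apply injective_projections; simpl; ring).
      eapply Rle_trans; [apply Cmod_le_Rabs |]. simpl.
      rewrite Rabs_mult, Hsg1, !(Rabs_pos_eq d) by lra. lra. }
    assert (Ecb : Cmod (c - b) <= 2 * d).
    { replace (c - b)%C with ((sg * d, - d)%R : C)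
        by (unfold b, c, Ci, RtoC; apply injective_projections; simpl; ring).
      eapply Rle_trans; [apply Cmod_le_Rabs |]. simpl.
      rewrite Rabs_Ropp, Rabs_mult, Hsg1, !(Rabs_pos_eq d) by lra. lra. }
    assert (Hseg : Cmod (seg F a b) <= 8 * d * bnd).
    { unfold tri in HT0. rewrite (seg_swap D F a c) in HT0 by auto.
      replace (seg F a b) with ((seg F a b + seg F b c + - seg F a c) + (seg F a c + - seg F b c))%C by ring.
      rewrite HT0. replace (0 + (seg F a c + - seg F b c))%C with (seg F a c + - seg F b c)%C by ring.
      eapply Rle_trans; [apply Cmod_triangle |]. rewrite Cmod_opp.
      assert (Hb0 : 0 <= bnd).
      { eapply Rle_trans; [apply Cmod_ge_0 | apply (Hac 0); lra]. }
      assert (bnd * Cmod (c - a) <= bnd * (2 * d)) by (apply Rmult_le_compat_l; lra).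
      assert (bnd * Cmod (c - b) <= bnd * (2 * d)) by (apply Rmult_le_compat_l; lra). lra. }
    assert (Eseg : seg F a b = ((b - a) * phi (eta t))%C).
    { rewrite (Hphi_eta t phi Hphi), <- I01_scal.
      - apply I01_ext. intros s _. unfold F, gam. ring.
      - intros s Hs. apply (Rcont_line F). apply HFc, Dgam, Hs. }
    assert (Eba : Cmod (b - a) = 2 * d).
    { replace (b - a)%C with (Ci * RtoC (2 * d))%C
        by (unfold a, b, Ci, RtoC; apply injective_projections; simpl; ring).
      rewrite Cmod_mult, Cmod_Ci, Cmod_R, Rabs_pos_eq; lra. }
    rewrite Eseg, Cmod_mult, Eba in Hseg.
    rewrite <- Hn.
    pose proof (Rabs_fst_le_Cmod (phi (eta t))). pose proof (Rle_abs (fst (phi (eta t)))).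
    replace (4 * K0 / (1 + t * t)) with (4 * bnd) by (unfold bnd; field; nra). nra.
  (* On the segment z - a = 2 i d s and z - b = - 2 i d (1 - s), so q(z) = 4 d^2 s (1 - s), a real
     number whose square is the stated weight. *)
  - intros phi Hphi. rewrite (Hphi_eta 0 phi Hphi). apply I01_ext. intros s _.
    assert (Eg : gam s = (Ci * RtoC (mu - d + 2 * d * s))%C).
    { unfold gam, a, b, Ci, RtoC; apply injective_projections; simpl; ring. }
    rewrite Eg. f_equal.
    unfold w, q. replace (0 + RtoC 0 * _)%C with (RtoC 0) by ring. rewrite cexp_0.
    unfold a, b, Ci, RtoC; apply injective_projections; simpl; ring.
Qed.

(** If [h] had a nonzero value v at a point, then on a short segment around it [h] would stay within
    |v| / 2 of v. There the real part of conj(v) h is positive, and so is its integral against a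
    positive weight. *)
Lemma bump_integral_zero (h : C -> C) (theta rho : R) : 0 < rho ->
  (forall s, Rabs (s - theta) < rho -> Ccont h (Ci * RtoC s)) ->
  (forall mu d, 0 < d -> Rabs (mu - theta) + d < rho ->
    I01 (fun s => RtoC (16 * d ^ 4 * (s * (1 - s)) ^ 2) *
        h (Ci * RtoC (mu - d + 2 * d * s)))%C = RtoC 0) ->
  forall s, Rabs (s - theta) < rho -> h (Ci * RtoC s)%C = RtoC 0.
Proof.
  intros Hrho Hc Hint mu Hmu. apply NNPP. intros Hne.
  set (v := h (Ci * RtoC mu)%C) in *.
  pose proof (proj1 (Cmod_gt_0 v) Hne) as Hvp.
  destruct (Hc mu Hmu (Cmod v / 2)) as (del & Hdel & Hclose); [lra |].
  set (d := Rmin (del / 2) ((rho - Rabs (mu - theta)) / 2)).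
  assert (Hd : 0 < d) by (apply Rmin_pos; lra).
  assert (Hd1 : d <= del / 2) by apply Rmin_l.
  assert (Hd2 : d <= (rho - Rabs (mu - theta)) / 2) by apply Rmin_r.
  specialize (Hint mu d Hd ltac:(lra)).
  set (p := fun s : R => 16 * d ^ 4 * (s * (1 - s)) ^ 2) in *.
  set (k := fun s => h (Ci * RtoC (mu - d + 2 * d * s))%C) in *.
  assert (Hin : forall s, 0 <= s <= 1 -> Rabs (mu - d + 2 * d * s - mu) <= d)
    by (intros; apply Rabs_le; nra).
  assert (Hkc : forall s, 0 <= s <= 1 -> Rcont k s).
  { intros s Hs.
    assert (Hc' : Ccont h ((Ci * RtoC (mu - d)) + RtoC s * (Ci * RtoC (2 * d)))%C).
    { replace ((Ci * RtoC (mu - d)) + RtoC s * (Ci * RtoC (2 * d)))%C with (Ci * RtoC (mu - d + 2 * d * s))%C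
        by (rewrite RtoC_plus, (RtoC_mult (2 * d)); ring).
      apply Hc. replace (mu - d + 2 * d * s - theta) with ((mu - d + 2 * d * s - mu) + (mu - theta)) by ring.
      eapply Rle_lt_trans; [apply Rabs_triang |]. pose proof (Hin s Hs). lra. }
    intros eps Heps. destruct (Rcont_line h _ _ s Hc' eps Heps) as (d' & Hd' & H).
    exists d'. split; [exact Hd' |]. intros u Hu. unfold k.
    replace (Ci * RtoC (mu - d + 2 * d * u))%C with ((Ci * RtoC (mu - d)) + RtoC u * (Ci * RtoC (2 * d)))%C
      by (rewrite RtoC_plus, (RtoC_mult (2 * d)); ring).
    replace (Ci * RtoC (mu - d + 2 * d * s))%C with ((Ci * RtoC (mu - d)) + RtoC s * (Ci * RtoC (2 * d)))%C
      by (rewrite RtoC_plus, (RtoC_mult (2 * d)); ring).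
    auto. }
  assert (Hre : forall s, 0 <= s <= 1 -> 0 < fst v * fst (k s) + snd v * snd (k s)).
  { intros s Hs.
    assert (Hks : Cmod (k s - v) <= Cmod v / 2).
    { apply Hclose. replace (Ci * (mu - d + 2 * d * s)%R - Ci * mu)%C
        with (Ci * RtoC (mu - d + 2 * d * s - mu))%C
        by (rewrite (RtoC_minus (mu - d + 2 * d * s)); ring).
      rewrite Cmod_mult, Cmod_Ci, Cmod_R. pose proof (Hin s Hs). lra. }
    pose proof (Cmod2_alt v) as E1. pose proof (Cmod2_alt (k s - v)%C) as E2.
    assert (E3 : Cmod (k s - v) ^ 2 <= (Cmod v / 2) ^ 2).
    { apply pow_incr. split; [apply Cmod_ge_0 | exact Hks]. }
    destruct v as [v1 v2]. destruct (k s) as [k1 k2]. unfold Re, Im in *. simpl in *. nra. }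
  assert (Hpc : forall s, 0 <= s <= 1 -> Rcont (fun s => RtoC (p s) * k s)%C s).
  { intros s Hs eps Heps.
    assert (Hp : Ccont (fun z => (RtoC (16 * d ^ 4) * ((z * (1 + - (1) * z)) * (z * (1 + - (1) * z))))%C) (0 + RtoC s * 1)).
    { apply Cdiff_Ccont. apply (Cdiff_mult (fun _ => RtoC (16 * d ^ 4))); [apply Cdiff_const |].
      assert (Hz : Cdiff (fun z => z * (1 + - (1) * z))%C (0 + RtoC s * 1)%C).
      { apply (Cdiff_mult (fun z => z) (fun z => 1 + - (1) * z)%C); [| apply Cdiff_affine].
        exists (RtoC 1). intros e He. exists 1. split; [lra |]. intros z _.
        match goal with |- Cmod ?x <= _ => replace x with (RtoC 0) by ring end.
        rewrite Cmod_0. apply Rmult_le_pos; [lra | apply Cmod_ge_0]. }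
      apply Cdiff_mult; exact Hz. }
    assert (Hk2 := Hkc s Hs).
    set (Q := fun z => (RtoC (16 * d ^ 4) * ((z * (1 + - (1) * z)) * (z * (1 + - (1) * z))))%C) in *.
    assert (EQ : forall u, RtoC (p u) = Q (0 + RtoC u * 1)%C).
    { intros u. unfold p, Q. unfold RtoC; apply injective_projections; simpl; ring. }
    destruct (@scal_continuous_pt (AbsRing_NormedModule C_AbsRing) (RtoC (p s)) (k s) eps Heps) as (r & Hr & H).
    destruct (Rcont_line Q 0 1 s Hp r Hr) as (e1 & He1 & H1).
    destruct (Hk2 r Hr) as (e2 & He2 & H2).
    exists (Rmin e1 e2). split; [apply Rmin_pos; lra |]. intros u Hu.
    left. apply (H (RtoC (p u)) (k u)).
    - rewrite !EQ. apply H1. eapply Rlt_le_trans; [exact Hu | apply Rmin_l].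
    - apply H2. eapply Rlt_le_trans; [exact Hu | apply Rmin_r]. }
  set (r := fun s => p s * (fst v * fst (k s) + snd v * snd (k s))).
  assert (Hpos : 0 < RInt r 0 1).
  { apply RInt_gt_0; [lra | |].
    - intros s Hs. unfold r. apply Rmult_lt_0_compat; [| apply Hre; lra].
      unfold p. assert (0 < d ^ 4) by (apply pow_lt; lra).
      assert (0 < (s * (1 - s)) ^ 2) by (apply pow_lt; nra). nra.
    - intros s Hs. apply continuous_R_intro. intros eps Heps.
      destruct (Rcont_mult_const _ (Cconj v) s (Hpc s Hs) eps Heps) as (e & He & H).
      exists e. split; [exact He |]. intros u Hu.
      eapply Rle_trans; [| exact (H u Hu)].
      eapply Rle_trans; [| apply Rabs_fst_le_Cmod].
      right. f_equal. unfold r. destruct v as [v1 v2].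
      unfold Cconj, RtoC. simpl. destruct (k u), (k s). simpl. ring. }
  pose proof (I01_scal (Cconj v) _ Hpc) as Hs.
  change (I01 (fun s => RtoC (p s) * k s)%C = RtoC 0) in Hint. rewrite Hint in Hs.
  apply (f_equal fst) in Hs.
  assert (Er : forall s, fst (Cconj v * (RtoC (p s) * k s))%C = r s).
  { intros s. unfold r. destruct v as [v1 v2]. unfold Cconj, RtoC. simpl.
    destruct (k s). simpl. ring. }
  change (RInt (fun s => fst (Cconj v * (RtoC (p s) * k s))%C) 0 1 = fst (Cconj v * 0)%C) in Hs.
  rewrite (RInt_ext _ r 0 1 (fun s _ => Er s)) in Hs.
  replace (Cconj v * 0)%C with (RtoC 0) in Hs by ring. simpl in Hs. lra.
Qed.

End Density.

Section HomoclinicDense.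
Context {X : CompleteNormedModule C_AbsRing} (T : R -> X -> X) (HT : C0_semigroup X T).
Context (Xsep : separable X).
Add Ring sq0_ring_hd : (@sq0_ring X).

Lemma homoclinic_dense (J : Type) (U : C -> Prop) (f : J -> C -> X) :
  @open C_UniformSpace U -> @connected C_UniformSpace U ->
  (forall j : J, weakly_holomorphic X U (f j)) ->
  (exists theta : R, U (Ci * RtoC theta)%C) ->
  (forall (j : J) (lambda : C), U lambda -> ker_shift X T lambda (f j lambda)) ->
  (forall phi : X -> C, in_dual X phi ->
    (forall (j : J) (lambda : C), U lambda -> phi (f j lambda) = RtoC 0) ->
    forall x : X, phi x = RtoC 0) ->
  forall (x : X) (eps : R), 0 < eps -> exists m eta,
    homoclinic T m eta /\ norm (vsub x (eta 0)) < eps.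
Proof.
  intros Uo Uc Hhol [theta Hth] Hker Htot x0 eps Heps. apply NNPP. intros Hno.
  destruct (separating_functional Xsep (fun y => exists m eta, homoclinic T m eta /\ y = eta 0) x0 eps)
    as (phi & Hphi & HY & Hne); auto.
  - exists 0, (fun _ => (vzero : X)). split; [apply (homoclinic_zero T HT); lra | reflexivity].
  - intros y y' (m & eta & H & ->) (m' & eta' & H' & ->).
    exists (m + m'), (fun t => vadd (eta t) (eta' t)). split; [apply homoclinic_add; auto | reflexivity].
  - intros c y (m & eta & H & ->). exists (Cmod c * m), (fun t => vscal c (eta t)).
    split; [apply homoclinic_scal; auto | reflexivity].
  - intros y (m & eta & H & ->). apply Rnot_lt_le. intros Hlt. apply Hno. exists m, eta. auto.
  - apply Hne, (Htot phi Hphi). intros j.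
    assert (Hd : forall psi, in_dual X psi -> forall z, U z -> Cdiff (fun w => psi (f j w)) z).
    { intros psi Hpsi z Hz. apply Cdiff_of_ex_derive, Hhol; assumption. }
    destruct (open_Cmod_elim U _ Uo Hth) as (r1 & Hr1 & HU).
    (* Norm continuity at one point of the axis bounds [f j] on a disc, as [homoclinic_arc]
       requires. *)
    destruct (weakly_differentiable_continuous Xsep (f j) (Ci * RtoC theta)%C
      (fun psi Hpsi => Hd psi Hpsi _ Hth) 1 Rlt_0_1) as (r2 & Hr2 & Hf).
    set (rho := Rmin r1 r2). assert (Hrho : 0 < rho) by (apply Rmin_pos; lra).
    assert (Hrho1 : rho <= r1) by apply Rmin_l. assert (Hrho2 : rho <= r2) by apply Rmin_r.
    assert (Hdist : forall s s', Cmod (Ci * RtoC s - Ci * RtoC s') = Rabs (s - s')).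
    { intros s s'. replace (Ci * s - Ci * s')%C with (Ci * RtoC (s - s'))%C by (rewrite RtoC_minus; ring).
      rewrite Cmod_mult, Cmod_Ci, Cmod_R. ring. }
    apply (identity_theorem U (fun z => phi (f j z)) (Hd phi Hphi) theta rho Uo Uc Hth Hrho).
    apply (bump_integral_zero (fun z => phi (f j z)) theta rho Hrho).
    + intros s Hs. apply Cdiff_Ccont, Hd; [exact Hphi |]. apply HU. rewrite Hdist. lra.
    + intros mu d Hdp Hmud.
      assert (Hnear : forall z, Cmod (z - Ci * RtoC mu) <= d -> Cmod (z - Ci * RtoC theta) < rho).
      { intros z Hz. pose proof (Cmod_minus_triangle z (Ci * RtoC mu) (Ci * RtoC theta)) as h.
        rewrite Hdist in h. lra. }
      destruct (homoclinic_arc T HT Xsep (f j) mu d (norm (f j (Ci * RtoC theta)%C) + 1) Hdp)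
        as (m & eta & Heta & Hval).
      * intros psi Hpsi z Hz. apply Hd; [exact Hpsi |]. apply HU. pose proof (Hnear z Hz). lra.
      * intros z t Hz Ht. apply (eigen_orbit T HT); [| exact Ht].
        apply Hker, HU. pose proof (Hnear z Hz). lra.
      * intros z Hz. pose proof (Hf z ltac:(pose proof (Hnear z Hz); lra)) as h.
        pose proof (norm_le_minus (f j z) (f j (Ci * RtoC theta)%C)). lra.
      * rewrite <- (Hval phi Hphi). apply HY. exists m, eta. auto.
Qed.

End HomoclinicDense.

(** * Coding by sequences of homoclinic orbits *)

Section Sums.
Context {X : NormedModule C_AbsRing}.
Add Ring sq0_ring_su : (@sq0_ring X).

Fixpoint psum (a : nat -> X) (n : nat) : X :=
  match n with O => vzero | S m => vadd (psum a m) (a m) end.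

(** The pairing makes the n-th partial sum run over - n <= k < n, so a shift of the index changes it
    by two boundary terms only. *)
Definition zpair (u : Z -> X) (n : nat) : X :=
  vadd (u (Z.of_nat n)) (u (- Z.of_nat n - 1)%Z).

Definition zlim (u : Z -> X) (x : X) : Prop :=
  forall eps, 0 < eps -> exists N : nat, forall n, (N <= n)%nat ->
    norm (vsub (psum (zpair u) n) x) <= eps.

Lemma zlim_ext (u v : Z -> X) (x : X) : (forall k, u k = v k) -> zlim u x -> zlim v x.
Proof.
  intros E H eps Heps. destruct (H eps Heps) as [N HN]. exists N. intros n Hn.
  replace (psum (zpair v) n) with (psum (zpair u) n); [auto |].
  clear Hn. induction n as [| n IH]; simpl; [reflexivity |].
  rewrite IH. unfold zpair. rewrite !E. reflexivity.
Qed.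

Lemma zlim_unique (u : Z -> X) (x y : X) : zlim u x -> zlim u y -> x = y.
Proof.
  intros Hx Hy. apply minus_norm_eq_0. apply le_epsilon. intros eps Heps.
  destruct (Hx (eps / 2)) as [N1 H1]; [lra |]. destruct (Hy (eps / 2)) as [N2 H2]; [lra |].
  specialize (H1 (N1 + N2)%nat ltac:(lia)). specialize (H2 (N1 + N2)%nat ltac:(lia)).
  pose proof (norm_minus_triangle x (psum (zpair u) (N1 + N2)) y) as h.
  rewrite (norm_minus_sym x (psum _ _)) in h. lra.
Qed.

Lemma psum_linear (L : X -> X) (u : Z -> X) (n : nat) : is_linear L ->
  psum (zpair (fun k => L (u k))) n = L (psum (zpair u) n).
Proof.
  intros HL. induction n as [| n IH]; simpl.
  - symmetry. exact (linear_zero L HL).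
  - rewrite IH. symmetry. etransitivity; [exact (linear_plus L HL _ _) |].
    f_equal. exact (linear_plus L HL _ _).
Qed.

Lemma zlim_linear (L : X -> X) (u : Z -> X) (x : X) : is_linear L ->
  zlim u x -> zlim (fun k => L (u k)) (L x).
Proof.
  intros HL H eps Heps. destruct (linear_norm L HL) as (M & HM & HMb).
  destruct (H (eps / M)) as [N HN]; [apply Rdiv_lt_0_compat; lra |].
  exists N. intros n Hn. specialize (HN n Hn). rewrite (psum_linear L u n HL).
  set (p := psum (zpair u) n) in *.
  assert (E : vsub (L p) (L x) = L (vsub p x)).
  { replace (vsub p x) with (vadd p (vscal (- (1))%C x)) by vec.
    symmetry. etransitivity; [exact (linear_plus L HL _ _) |].
    transitivity (vadd (L p) (vscal (- (1))%C (L x))); [| vec].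
    f_equal. exact (linear_scal L HL (- (1))%C x). }
  rewrite E. eapply Rle_trans; [exact (HMb _) |].
  apply Rle_trans with (M * (eps / M)); [apply Rmult_le_compat_l; lra |].
  right. field. lra.
Qed.

Lemma psum_sub (u v : Z -> X) (n : nat) :
  psum (zpair (fun k => vsub (u k) (v k))) n = vsub (psum (zpair u) n) (psum (zpair v) n).
Proof.
  induction n as [| n IH]; simpl; [vec |]. rewrite IH. unfold zpair. vec.
Qed.

Lemma zlim_sub (u v : Z -> X) (x y : X) : zlim u x -> zlim v y ->
  zlim (fun k => vsub (u k) (v k)) (vsub x y).
Proof.
  intros Hu Hv eps Heps.
  destruct (Hu (eps / 2)) as [N1 H1]; [lra |]. destruct (Hv (eps / 2)) as [N2 H2]; [lra |].
  exists (N1 + N2)%nat. intros n Hn. specialize (H1 n ltac:(lia)). specialize (H2 n ltac:(lia)).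
  rewrite psum_sub.
  replace (vsub (vsub (psum (zpair u) n) (psum (zpair v) n)) (vsub x y)) with
    (vsub (vsub (psum (zpair u) n) x) (vsub (psum (zpair v) n) y)) by vec.
  eapply Rle_trans; [apply norm_minus_le |]. lra.
Qed.

Lemma psum_shift (u : Z -> X) (n : nat) :
  psum (zpair (fun k => u (k + 1)%Z)) n =
  vadd (vsub (psum (zpair u) n) (u (- Z.of_nat n)%Z)) (u (Z.of_nat n)).
Proof.
  induction n as [| n IH].
  - simpl. vec.
  - cbn [psum]. rewrite IH. unfold zpair.
    replace (Z.of_nat n + 1)%Z with (Z.of_nat (S n)) by lia.
    replace (- Z.of_nat n - 1 + 1)%Z with (- Z.of_nat n)%Z by lia.
    replace (- Z.of_nat (S n))%Z with (- Z.of_nat n - 1)%Z by lia. vec.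
Qed.

Lemma zlim_shift (u : Z -> X) (x : X) :
  (forall eps, 0 < eps -> exists N : Z, forall k, (N <= Z.abs k)%Z -> norm (u k) <= eps) ->
  zlim u x -> zlim (fun k => u (k + 1)%Z) x.
Proof.
  intros H0 H eps Heps.
  destruct (H0 (eps / 3)) as [N0 HN0]; [lra |]. destruct (H (eps / 3)) as [N HN]; [lra |].
  exists (N + Z.to_nat N0)%nat. intros n Hn. rewrite psum_shift.
  specialize (HN n ltac:(lia)).
  pose proof (HN0 (- Z.of_nat n)%Z ltac:(lia)) as h1.
  pose proof (HN0 (Z.of_nat n) ltac:(lia)) as h2.
  set (p := psum (zpair u) n) in *.
  replace (vsub (vadd (vsub p (u (- Z.of_nat n)%Z)) (u (Z.of_nat n))) x) with
    (vadd (vsub (vsub p x) (u (- Z.of_nat n)%Z)) (u (Z.of_nat n))) by vec.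
  eapply Rle_trans; [apply (@norm_triangle C_AbsRing X) |].
  pose proof (norm_minus_le (vsub p x) (u (- Z.of_nat n)%Z)). lra.
Qed.

(** A bound of order 1 / n^2 written as a difference, so that the tail from rank p sums in closed
    form to at most B / p. *)
Definition telescoping_bound (B : R) (a : nat -> X) : Prop :=
  forall n, (1 <= n)%nat -> norm (a n) <= B * (/ INR n - / INR (S n)).

Lemma psum_tail (B : R) (a : nat -> X) (p k : nat) : telescoping_bound B a -> (1 <= p)%nat ->
  norm (vsub (psum a (p + k)) (psum a p)) <= B * (/ INR p - / INR (p + k)).
Proof.
  intros Ha Hp. induction k as [| k IH].
  - rewrite Nat.add_0_r. replace (vsub (psum a p) (psum a p)) with (vzero : X) by vec.
    rewrite (@norm_zero C_AbsRing X). lra.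
  - rewrite Nat.add_succ_r. cbn [psum].
    replace (vsub (vadd (psum a (p + k)) (a (p + k)%nat)) (psum a p)) with
      (vadd (vsub (psum a (p + k)) (psum a p)) (a (p + k)%nat)) by vec.
    eapply Rle_trans; [apply (@norm_triangle C_AbsRing X) |].
    pose proof (Ha (p + k)%nat ltac:(lia)). lra.
Qed.

(** Meant for the difference of two codes that agree on a window of half-width [L]: only the tail is
    left. *)
Lemma zlim_small (B : R) (u : Z -> X) (x : X) (L : nat) :
  0 <= B -> telescoping_bound B (zpair u) -> (1 <= L)%nat ->
  (forall k, (- Z.of_nat L <= k < Z.of_nat L)%Z -> u k = vzero) ->
  zlim u x -> norm x <= B / INR L.
Proof.
  intros HB Hu HL H0 Hx.
  assert (Hz : forall n, (n <= L)%nat -> psum (zpair u) n = vzero).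
  { induction n as [| n IH]; intros Hn; simpl; [reflexivity |].
    rewrite IH by lia. unfold zpair. rewrite !H0 by lia. vec. }
  apply le_epsilon. intros eps Heps. destruct (Hx eps Heps) as [N HN].
  specialize (HN (L + N)%nat ltac:(lia)).
  pose proof (psum_tail B (zpair u) L N Hu HL) as H.
  rewrite (Hz L (le_n L)) in H.
  set (p := psum (zpair u) (L + N)) in *.
  replace (vsub p vzero) with p in H by vec.
  pose proof (norm_le_minus x p) as h. rewrite norm_minus_sym in h.
  assert (0 < / INR (L + N)) by (apply Rinv_0_lt_compat, lt_0_INR; lia).
  unfold Rdiv. nra.
Qed.

End Sums.

Lemma zlim_exists {X : CompleteNormedModule C_AbsRing} (B : R) (u : Z -> X) :
  0 <= B -> telescoping_bound B (zpair u) -> exists x, zlim u x.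
Proof.
  intros HB Hu.
  destruct (proj1 (@filterlim_locally_cauchy nat X eventually _ (psum (zpair u)))) as [x Hx].
  - intros eps. destruct (archimed_cor1 (eps / (2 * (B + 1)))) as (N & HN & HN0).
    { apply Rdiv_lt_0_compat; [apply cond_pos | lra]. }
    exists (fun n => (N <= n)%nat). split; [exists N; auto |].
    assert (Hb : 2 * (B * / INR N) < eps).
    { assert (0 < / INR N) by (apply Rinv_0_lt_compat, lt_0_INR; lia).
      apply Rle_lt_trans with (2 * (B + 1) * / INR N); [nra |].
      apply (Rmult_lt_compat_l (2 * (B + 1))) in HN; [| lra].
      replace (2 * (B + 1) * (eps / (2 * (B + 1)))) with (pos eps) in HN by (field; lra). exact HN. }
    assert (Hc : forall n, (N <= n)%nat ->
      norm (vsub (psum (zpair u) n) (psum (zpair u) N)) <= B * / INR N).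
    { intros n Hn. replace n with (N + (n - N))%nat by lia.
      eapply Rle_trans; [apply (psum_tail B); [exact Hu | lia] |].
      apply Rmult_le_compat_l; [exact HB |].
      assert (0 < / INR (N + (n - N))) by (apply Rinv_0_lt_compat, lt_0_INR; lia). lra. }
    intros p q Hp Hq. apply (@norm_compat1 C_AbsRing X).
    pose proof (norm_minus_triangle (psum (zpair u) q) (psum (zpair u) N) (psum (zpair u) p)) as h.
    rewrite (norm_minus_sym (psum (zpair u) N) (psum (zpair u) p)) in h.
    pose proof (Hc p Hp). pose proof (Hc q Hq).
    change (norm (vsub (psum (zpair u) q) (psum (zpair u) p)) < eps). lra.
  - exists x. intros eps Heps.
    destruct (proj1 (@filterlim_locally_ball_norm C_AbsRing nat X eventually _ (psum (zpair u)) x) Hx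
      (mkposreal eps Heps)) as [N HN].
    exists N. intros n Hn. left. exact (HN n Hn).
Qed.

Lemma Rsqr_le_of_Rabs (c v : R) : 0 <= c -> c <= Rabs v -> c * c <= v * v.
Proof.
  intros Hc Hv. rewrite <- (Rabs_pos_eq (v * v)) by apply Rle_0_sqr. rewrite Rabs_mult.
  apply Rmult_le_compat; assumption.
Qed.

Section Coding.
Context {X : CompleteNormedModule C_AbsRing} (T : R -> X -> X) (HT : C0_semigroup X T).
Add Ring sq0_ring_co : (@sq0_ring X).

(** Both indices paired at rank n are at distance at least n - 1 from [s], and 4 (1 + (n - 1)^2) >=
    n (n + 1) by completing the square at n = 3 / 2; two terms give the constant 8. The bound is
    uniform in [s], hence in the fractional part of the time. *)
Lemma homoclinic_telescoping (m s : R) (theta : Z -> R -> X) : 0 <= m -> 0 <= s <= 1 ->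
  (forall k, homoclinic T m (theta k)) ->
  telescoping_bound (8 * m) (zpair (fun k => theta k (s - IZR k))).
Proof.
  intros Hm Hs Hth n Hn.
  assert (Hn1 : 1 <= INR n) by (apply (le_INR 1); exact Hn).
  set (x := INR n) in *.
  assert (Hden : 0 < 1 + (x - 1) * (x - 1)) by nra.
  assert (Hone : forall k, x - 1 <= Rabs (s - IZR k) -> norm (theta k (s - IZR k)) <= 4 * m * (/ x - / (x + 1))).
  { intros k Hk. destruct (Hth k) as [_ H].
    eapply Rle_trans; [apply H |].
    assert (Hsq : (x - 1) * (x - 1) <= (s - IZR k) * (s - IZR k)).
    { apply Rsqr_le_of_Rabs; lra. }
    apply Rle_trans with (m * / (1 + (x - 1) * (x - 1))).
    - apply Rmult_le_compat_l; [exact Hm |]. apply Rinv_le_contravar; lra.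
    - replace (4 * m * (/ x - / (x + 1))) with (m * (4 / (x * (x + 1)))) by (field; lra).
      apply Rmult_le_compat_l; [exact Hm |].
      apply Rmult_le_reg_r with ((1 + (x - 1) * (x - 1)) * (x * (x + 1))); [nra |].
      replace (/ (1 + (x - 1) * (x - 1)) * ((1 + (x - 1) * (x - 1)) * (x * (x + 1)))) with (x * (x + 1))
        by (field; lra).
      replace (4 / (x * (x + 1)) * ((1 + (x - 1) * (x - 1)) * (x * (x + 1)))) with
        (4 * (1 + (x - 1) * (x - 1))) by (field; lra).
      pose proof (Rle_0_sqr (x - 3 / 2)) as Hsq'. unfold Rsqr in Hsq'. lra. }
  unfold zpair. eapply Rle_trans; [apply (@norm_triangle C_AbsRing X) |].
  rewrite S_INR. fold x.
  replace (8 * m * (/ x - / (x + 1))) with (4 * m * (/ x - / (x + 1)) + 4 * m * (/ x - / (x + 1))) by ring.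
  apply Rplus_le_compat; apply Hone.
  - rewrite <- INR_IZR_INZ. fold x. rewrite Rabs_left1; lra.
  - rewrite minus_IZR, opp_IZR, <- INR_IZR_INZ. fold x. rewrite Rabs_pos_eq; lra.
Qed.

Lemma homoclinic_terms_vanish (m s : R) (theta : Z -> R -> X) : 0 <= m -> 0 <= s <= 1 ->
  (forall k, homoclinic T m (theta k)) ->
  forall eps, 0 < eps -> exists N : Z, forall k, (N <= Z.abs k)%Z ->
    norm (theta k (s - IZR k)) <= eps.
Proof.
  intros Hm Hs Hth eps Heps.
  destruct (INR_unbounded (m / eps)) as [N HN]. exists (Z.of_nat N + 2)%Z. intros k Hk.
  destruct (Hth k) as [_ H]. eapply Rle_trans; [apply H |].
  assert (Hk' : INR N + 1 <= Rabs (s - IZR k)).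
  { rewrite INR_IZR_INZ. apply IZR_le in Hk. rewrite plus_IZR, abs_IZR in Hk.
    revert Hk. unfold Rabs. destruct (Rcase_abs (IZR k)), (Rcase_abs (s - IZR k)); lra. }
  pose proof (pos_INR N) as HNp.
  assert (Hsq : INR N <= (s - IZR k) * (s - IZR k)).
  { apply Rle_trans with ((INR N + 1) * (INR N + 1)); [nra |]. apply Rsqr_le_of_Rabs; lra. }
  assert (Hme : m < eps * INR N).
  { apply (Rmult_lt_compat_l eps) in HN; [| lra].
    replace (eps * (m / eps)) with m in HN by (field; lra). exact HN. }
  apply Rmult_le_reg_r with (1 + (s - IZR k) * (s - IZR k)); [lra |].
  replace (m / (1 + (s - IZR k) * (s - IZR k)) * (1 + (s - IZR k) * (s - IZR k))) with m by (field; lra).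
  nra.
Qed.

(** Time 1 turns [theta k (- k)] into [theta k (1 - k)], the term of index k - 1 for the shifted
    sequence. Reindexing preserves the limit because the terms tend to zero. *)
Lemma coded_orbit (m : R) (theta : Z -> R -> X) (x : X) (j : nat) : 0 <= m ->
  (forall k, homoclinic T m (theta k)) ->
  zlim (fun k => theta k (0 - IZR k)) x ->
  zlim (fun k => theta (k + Z.of_nat j)%Z (0 - IZR k)) (T (INR j) x).
Proof.
  intros Hm Hth Hx. induction j as [| j IH].
  - simpl. rewrite (C0_zero HT). revert Hx. apply zlim_ext. intros k. rewrite Z.add_0_r. reflexivity.
  - assert (Hlin : is_linear (T 1)) by (apply (C0_bounded_linear HT); lra).
    apply (zlim_linear (T 1) _ _ Hlin) in IH.
    rewrite (C0_add HT) in IH by (try lra; apply pos_INR).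
    rewrite S_INR, Rplus_comm.
    apply (zlim_ext _ (fun k => theta (k + Z.of_nat j)%Z (1 - IZR k))) in IH.
    + apply zlim_shift in IH.
      * revert IH. apply zlim_ext. intros k. rewrite plus_IZR.
        replace (k + 1 + Z.of_nat j)%Z with (k + Z.of_nat (S j))%Z by lia. f_equal. ring.
      * apply (homoclinic_terms_vanish m 1 (fun k => theta (k + Z.of_nat j)%Z)); auto; lra.
    + intros k. destruct (Hth (k + Z.of_nat j)%Z) as [Hf _]. rewrite Hf by lra. f_equal. ring.
Qed.

Lemma coded_orbit_real (m s : R) (theta : Z -> R -> X) (x : X) (j : nat) : 0 <= m -> 0 <= s ->
  (forall k, homoclinic T m (theta k)) ->
  zlim (fun k => theta k (0 - IZR k)) x ->
  zlim (fun k => theta (k + Z.of_nat j)%Z (s - IZR k)) (T (s + INR j) x).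
Proof.
  intros Hm Hs Hth Hx. apply (coded_orbit m theta x j Hm Hth) in Hx.
  apply (zlim_linear (T s) _ _ (C0_bounded_linear HT Hs)) in Hx.
  rewrite (C0_add HT) in Hx by (try lra; apply pos_INR).
  revert Hx. apply zlim_ext. intros k. destruct (Hth (k + Z.of_nat j)%Z) as [Hf _].
  rewrite Hf by lra. f_equal. ring.
Qed.

Definition coded (n : nat) (x : X) : Prop :=
  exists theta : Z -> R -> X, (forall k, homoclinic T (INR n) (theta k)) /\
    zlim (fun k => theta k (0 - IZR k)) x.

Lemma coded_dense :
  (forall (x : X) (eps : R), 0 < eps -> exists m eta,
    homoclinic T m eta /\ norm (vsub x (eta 0)) < eps) ->
  norm_dense X (fun x => exists n : nat, (1 <= n)%nat /\ coded n x).
Proof.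
  intros H x eps Heps. destruct (H x eps Heps) as (m & eta & Heta & Hx).
  exists (eta 0). split; [| exact Hx].
  destruct (INR_unbounded m) as [n Hn]. exists (S n). split; [lia |].
  exists (fun k => if Z.eq_dec k 0 then eta else fun _ => vzero). split.
  - intros k. destruct Z.eq_dec.
    + apply (homoclinic_mono T m); [rewrite S_INR; lra | exact Heta].
    + apply (homoclinic_zero T HT). apply pos_INR.
  - intros e He. exists 1%nat. intros p Hp.
    assert (E : psum (zpair (fun k : Z => (if Z.eq_dec k 0 then eta else fun _ => vzero) (0 - IZR k))) p = eta 0).
    { destruct p as [| p]; [lia |]. clear Hp. induction p as [| p IH].
      - simpl. unfold zpair. simpl. replace (0 - 0) with 0 by ring. vec.
      - cbn [psum] in *. rewrite IH. unfold zpair at 1.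
        destruct (Z.eq_dec (Z.of_nat (S p)) 0) as [h | _]; [lia |].
        destruct (Z.eq_dec (- Z.of_nat (S p) - 1) 0) as [h | _]; [lia |]. vec. }
    rewrite E. replace (vsub (eta 0) (eta 0)) with (vzero : X) by vec.
    rewrite (@norm_zero C_AbsRing X). lra.
Qed.

(** At time t the codes must agree at [L] indices on either side of the integer part of t. Blocks
    are therefore widened by L + 1, the 1 absorbing the fractional part, and gaps of 2 L + 4 keep
    them disjoint, also across the end of a period. Each of the two codes adds 8 n to the tail
    constant, hence 16 n / L. *)
Lemma coded_shadow (n s : nat) (delta : R) (L : nat) (y : nat -> X) (a b : nat -> R) (N : nat) :
  (1 <= n)%nat -> (1 <= L)%nat -> 16 * INR n / INR L < delta ->
  (1 <= s)%nat ->
  (forall r, (1 <= r <= s)%nat -> coded n (y r)) ->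
  a 1%nat = 0 -> (forall r, (1 <= r <= s)%nat -> a r <= b r) ->
  (forall r, (1 <= r < s)%nat -> 2 * INR L + 4 <= a (S r) - b r) ->
  2 * INR L + 4 + b s <= INR N ->
  exists x, coded n x /\
    (forall r, (1 <= r <= s)%nat -> forall t, a r <= t <= b r ->
      norm (vsub (T t x) (T t (y r))) < delta) /\
    T (INR N) x = x.
Proof.
  intros Hn HL Hdelta Hs Hy Ha1 Hab Hgap HN.
  assert (HL0 : 0 <= INR L) by apply pos_INR.
  assert (Hnp : 0 <= INR n) by apply pos_INR.
  assert (Hsep : forall r k, (1 <= r)%nat -> (r + S k <= s)%nat ->
    2 * INR L + 4 + b r <= a (r + S k)%nat /\ b r <= b (r + S k)%nat).
  { intros r k Hr. induction k as [| k IH]; intros Hrk.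
    - rewrite Nat.add_1_r in *. pose proof (Hgap r ltac:(lia)). pose proof (Hab (S r) ltac:(lia)). lra.
    - rewrite (Nat.add_succ_r r (S k)) in *. pose proof (IH ltac:(lia)).
      pose proof (Hgap (r + S k)%nat ltac:(lia)). pose proof (Hab (r + S k)%nat ltac:(lia)).
      pose proof (Hab (S (r + S k)) ltac:(lia)). lra. }
  assert (Hbs : forall r, (1 <= r <= s)%nat -> b r <= b s).
  { intros r Hr. destruct (Nat.eq_dec r s) as [-> | Hne]; [lra |].
    pose proof (Hsep r (s - r - 1)%nat ltac:(lia) ltac:(lia)) as [_ h].
    replace (r + S (s - r - 1))%nat with s in h by lia. exact h. }
  assert (Ha0 : forall r, (1 <= r <= s)%nat -> 0 <= a r).
  { intros r Hr. destruct (Nat.eq_dec r 1) as [-> | Hne]; [lra |].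
    pose proof (Hsep 1%nat (r - 2)%nat ltac:(lia) ltac:(lia)) as [h _].
    replace (1 + S (r - 2))%nat with r in h by lia. pose proof (Hab 1%nat ltac:(lia)). lra. }
  (* The range of [r] is a premise inside the existential so that choice gives a total family;
     outside it the zero code serves as default. *)
  assert (Hcode : forall r, exists eta : Z -> R -> X, (1 <= r <= s)%nat ->
    (forall k, homoclinic T (INR n) (eta k)) /\ zlim (fun k => eta k (0 - IZR k)) (y r)).
  { intros r. destruct (classic (1 <= r <= s)%nat) as [Hr | Hr].
    - destruct (Hy r Hr) as [eta Heta]. exists eta. auto.
    - exists (fun _ _ => vzero). tauto. }
  apply functional_choice in Hcode. destruct Hcode as [eta Heta].
  set (cond := fun (r : nat) (k : Z) => (1 <= r <= s)%nat /\
    a r - INR L - 1 <= IZR k <= b r + INR L + 1).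
  assert (Hcu : forall r r' k, cond r k -> cond r' k -> (r < r')%nat -> False).
  { intros r r' k [Hr Hk] [Hr' Hk'] Hlt.
    pose proof (Hsep r (r' - r - 1)%nat ltac:(lia) ltac:(lia)) as [h _].
    replace (r + S (r' - r - 1))%nat with r' in h by lia. lra. }
  assert (Hbase : forall k, exists zeta, homoclinic T (INR n) zeta /\
    forall r, cond r k -> zeta = eta r k).
  { intros k. destruct (classic (exists r, cond r k)) as [[r Hr] | Hno].
    - exists (eta r k). split; [apply Heta; apply Hr |]. intros r' Hr'.
      destruct (Nat.lt_trichotomy r r') as [h | [-> | h]]; [exfalso; eauto | reflexivity | exfalso; eauto].
    - exists (fun _ => vzero). split; [apply (homoclinic_zero T HT); exact Hnp |].
      intros r Hr. exfalso. apply Hno. exists r. exact Hr. }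
  apply functional_choice in Hbase. destruct Hbase as [zeta Hzeta].
  (* Representatives modulo [N] are taken from - (L + 1) on, where the widened first block begins;
     thus no block is cut by the periodic extension. *)
  set (off := (Z.of_nat L + 1)%Z).
  set (theta := fun k : Z => zeta ((k + off) mod (Z.of_nat N) - off)%Z).
  assert (HNpos : (0 < Z.of_nat N)%Z).
  { apply lt_IZR. rewrite <- INR_IZR_INZ.
    pose proof (Hab s ltac:(lia)). pose proof (Ha0 s ltac:(lia)). simpl. lra. }
  assert (Hth : forall k, homoclinic T (INR n) (theta k)) by (intros k; apply Hzeta).
  assert (Hmatch : forall r k, cond r k -> theta k = eta r k).
  { intros r k Hrk. unfold theta. destruct Hrk as [Hr Hk].
    replace ((k + off) mod Z.of_nat N - off)%Z with k.
    - apply Hzeta. split; assumption.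
    - rewrite Z.mod_small; [lia |]. unfold off. split.
      + apply le_IZR. rewrite !plus_IZR, <- INR_IZR_INZ. pose proof (Ha0 r Hr). lra.
      + apply lt_IZR. rewrite !plus_IZR, <- !INR_IZR_INZ. pose proof (Hbs r Hr). lra. }
  assert (Hper : forall k, theta (k + Z.of_nat N)%Z = theta k).
  { intros k. unfold theta. f_equal. f_equal.
    replace (k + Z.of_nat N + off)%Z with (k + off + 1 * Z.of_nat N)%Z by ring.
    apply Z.mod_add. lia. }
  destruct (zlim_exists (8 * INR n) (fun k => theta k (0 - IZR k))) as [x Hx].
  - lra.
  - apply homoclinic_telescoping; auto; lra.
  - exists x. split; [exists theta; auto | split].
    + intros r Hr t Ht.
      pose proof (Ha0 r Hr) as Har.
      (* The integer part of [t]: the whole steps shift both codes, and the remainder [sg] lies in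
         [0, 1], where the telescoping bound is uniform. *)
      set (j := Z.to_nat (up t - 1)).
      destruct (archimed t) as [Hup1 Hup2].
      assert (Hj : INR j = IZR (up t) - 1).
      { unfold j. rewrite INR_IZR_INZ, Z2Nat.id, minus_IZR; [reflexivity |].
        assert (0 < up t)%Z by (apply lt_IZR; simpl; lra). lia. }
      set (sg := t - INR j). assert (Hsg : 0 <= sg <= 1) by (unfold sg; lra).
      replace t with (sg + INR j) by (unfold sg; ring).
      destruct (Heta r Hr) as [Hetar Hyr].
      pose proof (coded_orbit_real (INR n) sg theta x j Hnp (proj1 Hsg) Hth Hx) as H1.
      pose proof (coded_orbit_real (INR n) sg (eta r) (y r) j Hnp (proj1 Hsg) Hetar Hyr) as H2.
      pose proof (zlim_sub _ _ _ _ H1 H2) as H3.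
      eapply Rle_lt_trans; [| exact Hdelta].
      apply (zlim_small (16 * INR n) (fun k => vsub (theta (k + Z.of_nat j)%Z (sg - IZR k)) (eta r (k + Z.of_nat j)%Z (sg - IZR k)))); auto.
      * lra.
      * intros p Hp.
        pose proof (homoclinic_telescoping (INR n) sg (fun k => theta (k + Z.of_nat j)%Z) Hnp Hsg (fun k => Hth _) p Hp) as h1.
        pose proof (homoclinic_telescoping (INR n) sg (fun k => eta r (k + Z.of_nat j)%Z) Hnp Hsg (fun k => Hetar _) p Hp) as h2.
        match goal with |- norm ?z <= _ => replace z with
          (vsub (zpair (fun k => theta (k + Z.of_nat j)%Z (sg - IZR k)) p)
                (zpair (fun k => eta r (k + Z.of_nat j)%Z (sg - IZR k)) p)) by (unfold zpair; vec) end.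
        eapply Rle_trans; [apply norm_minus_le |]. lra.
      * intros k Hk. rewrite (Hmatch r); [vec |].
        split; [exact Hr |]. rewrite plus_IZR, <- INR_IZR_INZ.
        destruct Hk as [Hk1 Hk2]. apply IZR_le in Hk1. apply IZR_lt in Hk2.
        rewrite opp_IZR in Hk1. rewrite <- INR_IZR_INZ in *. unfold sg in Hsg. lra.
    + apply (zlim_unique (fun k => theta k (0 - IZR k))); [| exact Hx].
      pose proof (coded_orbit (INR n) theta x N Hnp Hth Hx) as H.
      revert H. apply zlim_ext. intros k. rewrite Hper. reflexivity.
Qed.

Lemma SgSP_of_homoclinic_dense :
  (forall (x : X) (eps : R), 0 < eps -> exists m eta,
    homoclinic T m eta /\ norm (vsub x (eta 0)) < eps) -> SgSP X T.
Proof.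
  intros Hdense. exists coded, 1. split; [lra | split; [| split; [| split]]].
  - intros n Hn x [theta [Hth Hx]]. exists theta. split; [| exact Hx].
    intros k. apply (homoclinic_mono T (INR n)); [apply le_INR; lia | apply Hth].
  - exists (fun _ _ => vzero). split; [intros; apply (homoclinic_zero T HT); apply pos_INR |].
    intros eps Heps. exists O. intros n _.
    assert (E : psum (zpair (fun _ : Z => (vzero : X))) n = vzero).
    { induction n as [| n IH]; simpl; [reflexivity |]. rewrite IH. unfold zpair. vec. }
    change (norm (vsub (psum (zpair (fun _ : Z => (vzero : X))) n) vzero) <= eps).
    rewrite E. replace (vsub (vzero : X) vzero) with (vzero : X) by vec.
    rewrite (@norm_zero C_AbsRing X). lra.
  - apply coded_dense. exact Hdense.
  - intros n Hn. split.
    + intros x [theta [Hth Hx]]. exists (fun k => theta (k + 1)%Z). split; [auto |].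
      exact (coded_orbit (INR n) theta x 1 (pos_INR n) Hth Hx).
    + intros delta Hdelta.
      destruct (INR_unbounded (16 * INR n / delta)) as [L0 HL0].
      set (L := S L0).
      assert (HL : 16 * INR n / INR L < delta).
      { assert (HLp : INR L0 < INR L) by (apply lt_INR; unfold L; lia).
        pose proof (pos_INR L0).
        apply Rmult_lt_reg_r with (INR L / delta).
        - apply Rdiv_lt_0_compat; lra.
        - replace (16 * INR n / INR L * (INR L / delta)) with (16 * INR n / delta) by (field; lra).
          replace (delta * (INR L / delta)) with (INR L) by (field; lra). lra. }
      exists (2 * INR L + 4). split; [pose proof (pos_INR L); lra |].
      intros s y a b Hs Hy Ha1 Hab _ Hgap.
      assert (Hbs : 0 <= b s).
      { assert (H : forall r, (1 <= r <= s)%nat -> 0 <= a r).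
        { induction r as [| r IH]; [lia |]. intros Hr.
          destruct (Nat.eq_dec r 0) as [-> | Hr0]; [lra |].
          pose proof (IH ltac:(lia)). pose proof (Hab r ltac:(lia)). pose proof (Hgap r ltac:(lia)).
          pose proof (pos_INR L). lra. }
        pose proof (H s ltac:(lia)). pose proof (Hab s ltac:(lia)). lra. }
      set (c := 2 * INR L + 4 + b s).
      assert (Hc : 0 < c) by (unfold c; pose proof (pos_INR L); lra).
      destruct (archimed (- c)) as [Hup1 Hup2].
      (* This is the ceiling of [c], which lies in [c, c + 1). The more direct [up c] lies in (c, c
         + 1] and leaves the half-open interval when [c] is an integer. *)
      set (N := Z.to_nat (1 - up (- c))).
      assert (HN : INR N = 1 - IZR (up (- c))).
      { unfold N. rewrite INR_IZR_INZ, Z2Nat.id, minus_IZR; [reflexivity |].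
        apply le_IZR. rewrite minus_IZR. lra. }
      destruct (coded_shadow n s delta L y a b N) as (x & Hxc & Hsh & Hpx); auto; try lia.
      * fold c. lra.
      * exists x. split; [exact Hxc | split; [exact Hsh |]].
        exists N. rewrite Rmult_1_r. split; [fold c; lra | exact Hpx].
Qed.

End Coding.

Theorem corollary13 (X : CompleteNormedModule C_AbsRing) (T : R -> X -> X)
    (Xsep : separable X) (HT : C0_semigroup X T)
    (J : Type) (U : C -> Prop) (f : J -> C -> X)
    (Uopen : @open C_UniformSpace U) (Uconn : @connected C_UniformSpace U)
    (fhol : forall j : J, weakly_holomorphic X U (f j))
    (Uim : exists theta : R, U (Ci * RtoC theta)%C)
    (fker : forall (j : J) (lambda : C), U lambda -> ker_shift X T lambda (f j lambda))
    (ftot : forall phi : X -> C, in_dual X phi ->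
       (forall (j : J) (lambda : C), U lambda -> phi (f j lambda) = RtoC 0) ->
       forall x : X, phi x = RtoC 0) :
  SgSP X T.
Proof.
  apply (SgSP_of_homoclinic_dense T HT).
  exact (homoclinic_dense T HT Xsep J U f Uopen Uconn fhol Uim fker ftot).
Qed.
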